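(* Let $L\in(0,\infty]$ and let $\|\cdot\|_{X(0,L)}$ be a rearrangement-invariant function norm on $(0,L)$. Let $\nu\colon(0,L)\to(0,L)$ be an increasing bijection; if $L=\infty$, assume that $\nu^{-1}\in\underline{D}^{\infty}$. Let $u\colon(0,L)\to(0,\infty)$ be nonincreasing. Let $v\colon(0,L)\to(0,\infty)$ be defined by $$\frac1{v(t)}=\int_0^{\nu(t)}\xi(s)\,ds\quad\text{for every } t\in(0,L),$$ where $\xi\colon(0,L)\to(0,\infty)$ is a measurable function. If $L<\infty$, assume that $v(L^-)>0$. Furthermore, assume that $$\Big\|u(t)\chi_{(0,\nu(a))}(t)\int_{\nu^{-1}(t)}^av(s)\,ds\Big\|_{X'(0,L)}<\infty,$$ where $a=L$ if $L<\infty$ and $a=1$ if $L=\infty$. Finally, assume that the operator $T_\varphi$ is bounded on $X(0,L)$, where $\varphi=\frac u\xi$. Let $\|\cdot\|_{Y(0,L)}$ be the rearrangement-invariant function norm whose associate function norm $\|\cdot\|_{Y'(0,L)}$ is defined as $$\|f\|_{Y'(0,L)}=\sup_{\substack{g\in\mathfrak M^+(0,L)\\ \|g\|_{X(0,L)}\le1}}\int_0^Lf^*(t)v(t)\int_0^{\nu(t)}T_\varphi g(s)u(s)\,ds\,dt,\quad f\in\mathfrak M^+(0,L).$$ The rearrangement-invariant function space $Y(0,L)$ is the optimal target space for the operator $R_{u,v,\nu}$ and $X(0,L)$. Moreover, $$\|H_{u,v,\nu^{-1}}(f^* )\|_{X'(0,L)}\le\|f\|_{Y'(0,L)}\le\|T_\varphi\|_{X(0,L)}\|H_{u,v,\nu^{-1}}(f^*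 )\|_{X'(0,L)}$$ for every $f\in\mathfrak M^+(0,L)$, where $\|T_\varphi\|_{X(0,L)}$ stands for the operator norm of $T_\varphi$ on $X(0,L)$.
   Context: Conventions: $\frac1\infty=0\cdot\infty=0$, and $\nu(L)=L$ when $L<\infty$. $\mathfrak{M}(0,L)$ is the set of (Lebesgue) measurable functions on $(0,L)$ with values in $[-\infty,\infty]$, and $\mathfrak{M}^+(0,L)$ is the subset of those that are nonnegative a.e. For $f\in\mathfrak M(0,L)$, $f^*(t)=\inf\{\lambda\in(0,\infty):|\{s\in(0,L):|f(s)|>\lambda\}|\le t\}$, $t\in(0,\infty)$, is its nonincreasing rearrangement. Functions $f,g$ are equimeasurable, $f\sim g$, if $|\{|f|>\lambda\}|=|\{|g|>\lambda\}|$ for every $\lambda\in(0,\infty)$. A rearrangement-invariant function norm on $(0,L)$ is a functional $\|\cdot\|_{X(0,L)}\colon\mathfrak{M}^+(0,L)\to[0,\infty]$ such that, for all $f,g,f_k\in\mathfrak M^+(0,L)$ and $\lambda\in[0,\infty)$: (P1) $\|f\|=0$ iff $f=0$ a.e., $\|\lambda f\|=\lambda\|f\|$, $\|f+g\|\le\|f\|+\|g\|$; (P2) $f\le g$ a.e. implies $\|f\|\le\|g\|$; (P3) $f_k\nearrow f$ a.e. implies $\|f_k\|\nearrow\|f\|$; (P4) $\|\chi_E\|<\infty$ for every measurable $E$ of finite measure; (P5) for every measurable $E$ of finite measure there is a finite constant $C_E>0$ with $\int_E f\le C_E\|f\|$ for all $f$; (P6) $\|f\|=\|g\|$ whenever $f\sim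 g$. It is extended to $\mathfrak M(0,L)$ by $\|f\|=\|\,|f|\,\|$, and $X(0,L)=\{f\in\mathfrak M(0,L):\|f\|_{X(0,L)}<\infty\}$ is the induced rearrangement-invariant function space. The associate function norm is $\|f\|_{X'(0,L)}=\sup\{\int_0^Lf(t)g(t)\,dt: g\in\mathfrak M^+(0,L),\|g\|_{X(0,L)}\le1\}$, $f\in\mathfrak M^+(0,L)$; it is again a rearrangement-invariant function norm and $(X')'=X$ with equality of norms, so a rearrangement-invariant function norm is uniquely determined by its associate norm. $X(0,L)\hookrightarrow Y(0,L)$ means that there is $C>0$ with $\|f\|_{Y(0,L)}\le C\|f\|_{X(0,L)}$ for all $f\in\mathfrak M(0,L)$. $v(L^-)$ is the left limit at $L$. For an increasing bijection $\mu$ of $(0,\infty)$, $\mu\in\underline{D}^\infty$ means that there is $\theta>1$ with $\liminf_{t\to\infty}\frac{\mu(\theta t)}{\mu(t)}>1$. For $g\in\mathfrak M(0,L)$ and an increasing bijection $\mu$ of $(0,L)$: $R_{u,v,\mu}g(t)=v(t)\int_0^{\mu(t)}|g(s)|u(s)\,ds$ and $H_{u,v,\mu}g(t)=u(t)\int_{\mu(t)}^L|g(s)|v(s)\,ds$, $t\in(0,L)$. For $\varphi\colon(0,L)\to(0,\infty)$ measurable, $$T_\varphi f(t)=\frac1{\varphi(t)}\operatorname*{ess\,sup}_{s\in[t,L)}\varphi(s)f^*(s),\quad t\in(0,L),\ f\in\mathfrak M(0,L).$$ An operator $T$ is bounded from $X(0,L)$ to $Y(0,L)$ (on $X(0,L)$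 if $Y=X$) if $\|Tf\|_{Y(0,L)}\le C\|f\|_{X(0,L)}$ for some $C$ and all $f$; the least such $C$ is the operator norm. A rearrangement-invariant function space $Y(0,L)$ is the optimal target space for $T$ and $X(0,L)$ if $T\colon X(0,L)\to Y(0,L)$ is bounded and $Y(0,L)\hookrightarrow Z(0,L)$ whenever $Z(0,L)$ is a rearrangement-invariant function space such that $T\colon X(0,L)\to Z(0,L)$ is bounded. *)

(* Defs.v *)
From HB Require Import structures.
From mathcomp Require Import all_boot all_order all_algebra.
From mathcomp Require Import all_classical all_reals all_analysis.
From mathcomp Require Import measurable_realfun ess_sup_inf.

Set Implicit Arguments.
Unset Strict Implicit.
Unset Printing Implicit Defensive.

Import Order.TTheory GRing.Theory Num.Theory.
Import numFieldNormedType.Exports.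

Local Open Scope classical_set_scope.
Local Open Scope ring_scope.
Local Open Scope ereal_scope.

(** The real line with its Lebesgue (not only Borel) sigma-algebra, that is,
    with the Caratheodory sigma-algebra of the Lebesgue outer measure. *)
Definition lebesgueR (R : realType) :=
  caratheodory_type (@wlength R idfun)^*%mu.

Notation cleb := completed_lebesgue_measure.

Definition oitv (R : realType) (a b : \bar R) : set R :=
  [set s | a < s%:E < b].

(** Functions on (0, L) are total functions on R whose values outside (0, L)
    are irrelevant: [ri_norm] below only ever constrains them on (0, L), up to
    null sets. *)
Definition Meas (R : realType) (L : \bar R) (f : R -> \bar R) : Prop :=
  @measurable_fun _ _ (lebesgueR R) (\bar R) (oitv 0 L) f.

Definition MeasPos (R : realType) (L : \bar R) (f : R -> \bar R) : Prop :=
  Meas L f /\ \forall s \ae @cleb R, oitv 0 L s -> 0 <= f s.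

Definition dist_fun (R : realType) (L : \bar R) (f : R -> \bar R) (lam : R) :
    \bar R :=
  cleb [set s : R | oitv 0 L s /\ lam%:E < `|f s|].

Definition equimeasurable (R : realType) (L : \bar R) (f g : R -> \bar R) :
    Prop :=
  forall lam : R, (0 < lam)%R -> dist_fun L f lam = dist_fun L g lam.

Definition rearr (R : realType) (L : \bar R) (f : R -> \bar R) (t : R) :
    \bar R :=
  ereal_inf [set lam%:E | lam in
    [set lam : R | (0 < lam)%R /\ dist_fun L f lam <= t%:E]].

Record ri_norm (R : realType) (L : \bar R)
    (N : (R -> \bar R) -> \bar R) : Prop := RiNorm {
  ri_ge0 : forall f, MeasPos L f -> 0 <= N f ;
  ri_eq0 : forall f, MeasPos L f ->
    (N f = 0 <-> \forall s \ae @cleb R, oitv 0 L s -> f s = 0) ;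
  ri_scale : forall f (lam : R), MeasPos L f -> (0 <= lam)%R ->
    N (fun s => lam%:E * f s) = lam%:E * N f ;
  ri_triangle : forall f g, MeasPos L f -> MeasPos L g ->
    N (fun s => f s + g s) <= N f + N g ;
  ri_mono : forall f g, MeasPos L f -> MeasPos L g ->
    (\forall s \ae @cleb R, oitv 0 L s -> f s <= g s) -> N f <= N g ;
  ri_fatou : forall (fk : nat -> R -> \bar R) f,
    (forall k, MeasPos L (fk k)) -> MeasPos L f ->
    (\forall s \ae @cleb R, oitv 0 L s ->
       nondecreasing_seq (fun k => fk k s) /\ fk k s @[k --> \oo] --> f s) ->
    nondecreasing_seq (fun k => N (fk k)) /\ N (fk k) @[k --> \oo] --> N f ;
  ri_indic : forall E : set (lebesgueR R), measurable E -> E `<=` oitv 0 L ->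
    cleb E < +oo -> N (fun s => (\1_E s)%:E) < +oo ;
  ri_local : forall E : set (lebesgueR R), measurable E -> E `<=` oitv 0 L ->
    cleb E < +oo ->
    exists2 C : R, (0 < C)%R &
      forall f, MeasPos L f -> \int[cleb]_(s in E) f s <= C%:E * N f ;
  ri_equi : forall f g, MeasPos L f -> MeasPos L g ->
    equimeasurable L f g -> N f = N g
}.

Definition nrm (R : realType) (N : (R -> \bar R) -> \bar R)
    (f : R -> \bar R) : \bar R :=
  N (fun s => `|f s|).

Definition assoc_norm (R : realType) (L : \bar R) (N : (R -> \bar R) -> \bar R)
    (f : R -> \bar R) : \bar R :=
  ereal_sup [set \int[cleb]_(t in oitv 0 L) (f t * g t) | g in
    [set g : R -> \bar R | MeasPos L g /\ N g <= 1]].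

Definition embeds (R : realType) (L : \bar R)
    (NX NY : (R -> \bar R) -> \bar R) : Prop :=
  exists2 C : R, (0 < C)%R &
    forall f, Meas L f -> nrm NY f <= C%:E * nrm NX f.

Definition op_bound (R : realType) (L : \bar R)
    (T : (R -> \bar R) -> (R -> \bar R))
    (NX NY : (R -> \bar R) -> \bar R) (C : R) : Prop :=
  (0 <= C)%R /\ forall f, Meas L f -> nrm NY (T f) <= C%:E * nrm NX f.

Definition bounded_op (R : realType) (L : \bar R)
    (T : (R -> \bar R) -> (R -> \bar R))
    (NX NY : (R -> \bar R) -> \bar R) : Prop :=
  exists C : R, op_bound L T NX NY C.

Definition op_norm (R : realType) (L : \bar R)
    (T : (R -> \bar R) -> (R -> \bar R))
    (NX NY : (R -> \bar R) -> \bar R) : \bar R :=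
  ereal_inf [set C%:E | C in op_bound L T NX NY].

Definition optimal_target (R : realType) (L : \bar R)
    (T : (R -> \bar R) -> (R -> \bar R))
    (NX NY : (R -> \bar R) -> \bar R) : Prop :=
  [/\ ri_norm L NY, bounded_op L T NX NY &
      forall NZ, ri_norm L NZ -> bounded_op L T NX NZ -> embeds L NY NZ].

Definition incr_bij (R : realType) (L : \bar R) (mu : R -> R) : Prop :=
  set_bij (oitv 0 L) (oitv 0 L) mu /\
  {in oitv 0 L &, {homo mu : x y / (x < y)%R}}.

Definition bij_inv (R : realType) (L : \bar R) (mu : R -> R) : R -> R :=
  pinv (oitv 0 L) mu.

Definition lowerDinfty (R : realType) (mu : R -> R) : Prop :=
  exists2 theta : R, (1 < theta)%R &
    1 < limf_einf (fun t : R => (mu (theta * t) / mu t)%:E) +oo%R.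

Definition opR (R : realType) (u v mu : R -> R)
    (g : R -> \bar R) (t : R) : \bar R :=
  (v t)%:E * \int[cleb]_(s in oitv 0 (mu t)%:E) (`|g s| * (u s)%:E).

Definition opH (R : realType) (L : \bar R) (u v mu : R -> R)
    (g : R -> \bar R) (t : R) : \bar R :=
  (u t)%:E * \int[cleb]_(s in oitv (mu t)%:E L) (`|g s| * (v s)%:E).

(** The essential supremum over [t, L) is taken as the essential supremum over
    R of the extension by 0 outside [t, L): the two agree for t < L, because
    the function is nonnegative and [t, L) is not a null set. *)
Definition opT (R : realType) (L : \bar R) (phi : R -> R)
    (f : R -> \bar R) (t : R) : \bar R :=
  ((phi t)^-1)%:E *
  ess_sup cleb ((fun s => (phi s)%:E * rearr L f s) \_
                 [set s : R | t%:E <= s%:E < L]).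

Definition cut_pt (R : realType) (L : \bar R) : \bar R :=
  if L is +oo then 1 else L.

(** The image of [cut_pt L] under nu, with the convention nu(L) = L when L is
    finite. *)
Definition nu_cut_pt (R : realType) (L : \bar R) (nu : R -> R) : \bar R :=
  if L is +oo then (nu 1)%:E else L.

Definition targetDual (R : realType) (L : \bar R) (u xi v nu : R -> R)
    (NX : (R -> \bar R) -> \bar R) (f : R -> \bar R) : \bar R :=
  ereal_sup [set \int[cleb]_(t in oitv 0 L)
      (rearr L f t * (v t)%:E *
       \int[cleb]_(s in oitv 0 (nu t)%:E)
         (opT L (fun r => u r / xi r)%R g s * (u s)%:E)) | g in
    [set g : R -> \bar R | MeasPos L g /\ NX g <= 1]].

(* Main.v *)
(* Write f* for the rearrangement, T for T_phi, R and H for R_{u,v,nu} and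
   H_{u,v,nu^-1}, Z for the functional defining the associate norm of Y, and
   W g (t) = v(t) int_0^{nu(t)} (T g) u. Since u T g = xi S with S nonincreasing
   and 1/v(t) = int_0^{nu(t)} xi, the function W g is a mean of S over (0, nu(t))
   and is therefore nonincreasing. Hence Z f = sup int f* W g is a supremum of
   seminorms of Lorentz type, which makes Z a rearrangement-invariant norm, and
   the Lorentz-Luxemburg theorem Z'' = Z shows that Y = Z' has associate norm Z.

   By Tonelli's theorem int g H f* = int f* R g and int T g H f* = int f* W g.
   As g* <= T g a.e., the Hardy-Littlewood inequality gives R g <= W g. So the
   associate norm of H f* is at most Z f, and it is at least a multiple of Z f
   since T is bounded. Moreover Y(R g) <= Y(W g) <= Y''(W g) <= X(g). If R maps X
   into a space N boundedly, the first identity bounds the associate norm of H f*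
   by a multiple of N'(f), so Z <= K N' and Y embeds in N'' = N. *)
Require Import Defs.
From HB Require Import structures.
From mathcomp Require Import all_boot all_order all_algebra.
From mathcomp Require Import all_classical all_reals all_analysis.
From mathcomp Require Import measurable_realfun ess_sup_inf.
From mathcomp Require Import ring lra zify.

Set Implicit Arguments.
Unset Strict Implicit.
Unset Printing Implicit Defensive.

Import Order.TTheory GRing.Theory Num.Theory.
Import numFieldNormedType.Exports.

Local Open Scope classical_set_scope.
Local Open Scope ring_scope.
Local Open Scope ereal_scope.

(** * Dyadic layers *)

Section layers.
Context {R : realType}.
Implicit Types (x : \bar R) (n : nat).

(** Rearrangement invariance carries the abstract part. Replacing a function on a set of finite
    measure by its mean does not increase an invariant norm, because the mean is a limit of averages
    of equimeasurable functions. On finitely many cells this turns a test function into a step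
    function adapted to the level sets of f, which makes an associate norm invariant. It also
    reduces the hard half of N'' = N to step functions over fixed cells, a finite-dimensional space
    where the Hahn-Banach theorem is elementary.

    The rearrangement is not subadditive pointwise, only after integration over initial segments;
    this is why the monotonicity of W g is indispensable, a nonincreasing weight being a
    superposition of such segments.

    The two size assumptions enter through the last axioms for Z. For f the indicator of (0, a), H
    f* is exactly the function whose X' norm is assumed finite, so Z is finite on indicators of sets
    of finite measure. A positive lower bound for v yields some W g bounded below on (0, b), hence
    the local integral bound. *)

Definition layer_sum (d : R) (m : nat) x : R :=
  (\sum_(j < m) d * (((j.+1)%:R * d)%:E < x)%E%:R)%R.

(** A staircase below [x] with step 2^-n, capped at height [n]. The strict inequality makes each
    step the indicator of a superlevel set, the kind of set measured by the distribution
    function. *)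
Definition layer n x : R := layer_sum (2 ^- n)%R (n * 2 ^ n) x.

Lemma layer_sum_ge0 d m x : (0 <= d)%R -> (0 <= layer_sum d m x)%R.
Proof. by move=> d0; apply: sumr_ge0 => j _; rewrite mulr_ge0. Qed.

Lemma layer_sumS d m x : layer_sum d m.+1 x =
  (layer_sum d m x + d * (((m.+1)%:R * d)%:E < x)%E%:R)%R.
Proof. by rewrite /layer_sum big_ord_recr. Qed.

Lemma layer_sum_le d m x : (0 < d)%R -> 0 <= x ->
  (layer_sum d m x <= m%:R * d)%R /\ (layer_sum d m x)%:E <= x.
Proof.
move=> d0 x0; elim: m => [|m [IH1 IH2]].
  by rewrite /layer_sum big_ord0 mul0r.
rewrite layer_sumS; have [hx|hx] := ltP (((m.+1)%:R * d)%:E) x.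
  have h : (layer_sum d m x + d * true%:R <= m.+1%:R * d)%R.
    by rewrite -natr1 mulrDl mulr1 mul1r lerD2r.
  by split => //; apply: le_trans (ltW hx); rewrite lee_fin.
rewrite mulr0 addr0; split => //; apply: le_trans IH1 _.
by rewrite ler_pM2r// ler_nat.
Qed.

Lemma layer_sum_ge d m x : (0 < d)%R -> 0 <= x ->
  layer_sum d m x = (m%:R * d)%R \/ x <= (layer_sum d m x + d)%:E.
Proof.
move=> d0 x0; elim: m => [|m IH]; first by left; rewrite /layer_sum big_ord0 mul0r.
have [h1 _] := layer_sum_le m d0 x0.
rewrite layer_sumS; have [hx|hx] := ltP (((m.+1)%:R * d)%:E) x.
  left; rewrite -natr1 mulrDl mul1r mulr1; congr (_ + _)%R.
  case: IH => // IH; have := lt_le_trans hx IH.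
  by rewrite lte_fin -natr1 mulrDl mul1r ltrD2r ltNge h1.
rewrite mulr0 addr0; case: IH => [IH|]; [right|by right].
by rewrite IH; move: hx; rewrite -natr1 mulrDl mul1r.
Qed.

Lemma layer_ge0 n x : (0 <= layer n x)%R.
Proof. by rewrite layer_sum_ge0. Qed.

Lemma layer_le n x : 0 <= x -> (layer n x)%:E <= x.
Proof. by move=> x0; case: (@layer_sum_le (2 ^- n)%R (n * 2 ^ n) x). Qed.

(** Each threshold [(j + 1) d] gives rise to two thresholds at mesh [d / 2], and both lie below [x]
    if the old one does. *)
Lemma layer_sum_half d m x : (0 < d)%R -> 
  (layer_sum d m x <= layer_sum (d / 2) m.*2 x)%R.
Proof.
move=> d0; elim: m => [|m IH]; first by rewrite /layer_sum !big_ord0.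
rewrite doubleS !layer_sumS -addrA lerD//.
have -> : (m.*2.+2%:R * (d / 2) = m.+1%:R * d :> R)%R.
  by rewrite -doubleS -muln2 natrM; field.
have [hx|hx] := ltP (((m.+1)%:R * d)%:E) x; last first.
  by rewrite mulr0 addr_ge0// mulr_ge0// ?divr_ge0// ltW.
suff -> : (m.*2.+1%:R * (d / 2))%:E < x by rewrite !mulr1; lra.
apply: le_lt_trans hx; rewrite lee_fin.
have -> : (m.+1%:R * d = m.*2.+2%:R * (d / 2) :> R)%R.
  by rewrite -doubleS -muln2 natrM; field.
by rewrite ler_wpM2r ?divr_ge0 ?ler_nat// ltW.
Qed.

Lemma layer_sum_widen d m k x : (0 <= d)%R -> (m <= k)%N ->
  (layer_sum d m x <= layer_sum d k x)%R.
Proof.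
move=> d0 /subnK <-; elim: (k - m)%N => [//|p IH].
by rewrite addSn layer_sumS (le_trans IH)// lerDl mulr_ge0.
Qed.

Lemma layer_nd x : nondecreasing_seq (layer ^~ x).
Proof.
apply/nondecreasing_seqP => n; rewrite /layer.
apply: le_trans (layer_sum_half _ _ _) _; first by rewrite invr_gt0 exprn_gt0.
have -> : (2 ^- n / 2 = 2 ^- n.+1 :> R)%R by rewrite -invfM -exprSr.
apply: layer_sum_widen; first by rewrite invr_ge0 exprn_ge0.
by rewrite -muln2 -mulnA -expnSr leq_mul2r leqnSn orbT.
Qed.

Lemma layer_cvg x : 0 <= x -> (layer n x)%:E @[n --> \oo] --> x.
Proof.
move=> x0.
have pn n : ((n * 2 ^ n)%:R * 2 ^- n = n%:R :> R)%R.
  by rewrite natrM natrX mulfK// expf_neq0.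
have d0 n : (0 < 2 ^- n :> R)%R by rewrite invr_gt0 exprn_gt0.
have nd : nondecreasing_seq (fun n => (layer n x)%:E).
  by move=> m n mn; rewrite lee_fin layer_nd.
suff xE : x = ereal_sup (range (fun n => (layer n x)%:E)).
  by rewrite [X in _ --> X]xE; exact: ereal_nondecreasing_cvgn.
apply/eqP; rewrite eq_le; apply/andP; split; last first.
  by apply: ge_ereal_sup => _ [n _ <-]; exact: layer_le.
have sup n : (layer n x)%:E <= ereal_sup (range (fun n => (layer n x)%:E)).
  by apply: ereal_sup_ubound; exists n.
set S := ereal_sup _ in sup *.
(* Either the cap [n] is reached, so that the supremum is at least [n], or the error is at most one
   step. *)
have big n : n%:R%:E <= S \/ x <= S + (2 ^- n)%:E.
  case: (layer_sum_ge (n * 2 ^ n) (d0 n) x0) => h.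
    by left; rewrite -pn -h; exact: sup.
  by right; apply: le_trans h _; rewrite EFinD leeD2r// sup.
have S0 : 0 <= S by apply: le_trans (sup 0%N); rewrite lee_fin layer_ge0.
case: S S0 sup big => [s||] S0 sup big; [|by rewrite leey|by []].
apply/lee_addgt0Pr => e e0; rewrite -EFinD.
pose n := maxn (Num.truncn s).+1 (Num.truncn (e^-1)%R).+1.
have sn : (s < n%:R)%R.
  apply: lt_le_trans (truncnS_gt s) _; rewrite ler_nat leq_maxl//.
have en : (2 ^- n <= e)%R.
  rewrite -[e]invrK lef_pV2 ?posrE ?invr_gt0 ?exprn_gt0//.
  apply: le_trans (ltW (truncnS_gt _)) _.
  rewrite -natrX ler_nat; apply: leq_trans (ltnW (ltn_expl n _)) => //.
  by rewrite leq_maxr.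
case: (big n) => h; first by move: h; rewrite lee_fin leNgt sn.
by apply: le_trans h _; rewrite -EFinD lee_fin lerD2l.
Qed.

End layers.

(** * Integral inequalities summed over layers *)

Section layer_integral.
Context {d} {T : measurableType d} {R : realType} (mu : {measure set T -> \bar R}).
Implicit Types (D : set T) (f g w k : T -> \bar R).

(** The factor [y = +oo] escapes the continuity of the product: for [x = 0] every layer vanishes and
    [0 * +oo = 0]; otherwise the layers are eventually positive. *)
Lemma layer_mul_cvg (x y : \bar R) : 0 <= x -> 0 <= y ->
  (layer n x)%:E * y @[n --> \oo] --> x * y.
Proof.
move=> x0; case: y => [r|_|//] => [r0|].
  by apply: cvgeZr => //; exact: layer_cvg.
move: x0; rewrite le_eqVlt => /predU1P[<-|x0].
  rewrite mul0e; under eq_fun.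
    move=> n; have -> : layer n (0 : \bar R) = 0%R.
      by apply/eqP; rewrite eq_le layer_ge0 -lee_fin layer_le.
    rewrite mul0e; over.
  exact: cvg_cst.
rewrite gt0_muley//; apply: cvg_near_cst.
have : \forall n \near \oo, 0 < (layer n x)%:E.
  have nb : nbhs x [set y | 0 < y].
    by apply: open_nbhs_nbhs; split => //; exact: open_ereal_gt_ereal.
  exact: (layer_cvg (ltW x0) nb).
by apply: filterS => n h; rewrite gt0_muley.
Qed.

Lemma measurable_layer D f n : measurable D -> measurable_fun D f ->
  measurable_fun D (fun s => (layer n (f s))%:E).
Proof.
move=> mD mf; apply/measurable_EFinP; apply: measurable_sum => j.
apply: measurable_funM => //.
apply: (eq_measurable_fun
    (\1_(D `&` [set s | ((j.+1)%:R * 2 ^- n)%:E < f s]) : T -> R)).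
  by move=> s sD; rewrite indicE in_setI sD/= mem_setE.
by apply: measurable_indic; exact: emeasurable_fun_o_infty.
Qed.

Lemma integral_layer D f g n : measurable D -> measurable_fun D f ->
  measurable_fun D g -> (forall s, D s -> 0 <= g s) ->
  \int[mu]_(s in D) ((layer n (f s))%:E * g s) =
  \sum_(j < n * 2 ^ n) (2 ^- n)%:E *
    \int[mu]_(s in D `&` [set s | ((j.+1)%:R * 2 ^- n)%:E < f s]) g s.
Proof.
move=> mD mf mg g0.
have mE c : measurable (D `&` [set s | c < f s]) by exact: emeasurable_fun_o_infty.
have mB c : measurable_fun D (g \_ [set s | c < f s]).
  apply: (eq_measurable_fun (g \_ (D `&` [set s | c < f s]))).
    by move=> s sD; rewrite /patch in_setI sD.
  apply/measurable_restrict => //.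
  by apply: measurable_funS mg => //; rewrite setIAC setIid.
have B0 c s : D s -> 0 <= (g \_ [set s | c < f s]) s.
  by move=> Ds; rewrite /patch; case: ifPn => // _; exact: g0.
transitivity (\int[mu]_(s in D) \sum_(j < n * 2 ^ n)
   ((2 ^- n)%:E * (g \_ [set s | ((j.+1)%:R * 2 ^- n)%:E < f s]) s)).
  apply: eq_integral => s _; rewrite /layer /layer_sum -sumEFin ge0_sume_distrl.
    apply: eq_bigr => j _; rewrite EFinM -muleA; congr (_ * _).
    rewrite /patch; have [h|h] := boolP (((j.+1)%:R * 2 ^- n)%:E < f s).
      by rewrite mem_set// mul1e.
    by rewrite memNset ?mul0e//; exact/negP.
  by move=> j _; rewrite lee_fin mulr_ge0.
rewrite ge0_integral_sum//.
- apply: eq_bigr => j _; rewrite ge0_integralZl// ?lee_fin//; last exact: B0.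
  by rewrite -integral_mkcondr.
- by move=> j; apply: measurable_funeM.
- by move=> j s Ds; apply: mule_ge0; [rewrite lee_fin|exact: B0].
Qed.

(* The comparison of the level sets is summed over the dyadic layers of [f]. *)
Lemma le_integral_layers D D' f g f' g' : measurable D -> measurable D' ->
  measurable_fun D f -> measurable_fun D g ->
  measurable_fun D' f' -> measurable_fun D' g' ->
  (forall s, D s -> 0 <= f s) -> (forall s, D s -> 0 <= g s) ->
  (forall s, D' s -> 0 <= f' s) -> (forall s, D' s -> 0 <= g' s) ->
  (forall l : R, (0 < l)%R ->
     \int[mu]_(s in D `&` [set s | l%:E < f s]) g s <=
     \int[mu]_(s in D' `&` [set s | l%:E < f' s]) g' s) ->
  \int[mu]_(s in D) (f s * g s) <= \int[mu]_(s in D') (f' s * g' s).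
Proof.
move=> mD mD' mf mg mf' mg' f0 g0 f'0 g'0 H.
have cv : \int[mu]_(s in D) ((layer n (f s))%:E * g s) @[n --> \oo] -->
    \int[mu]_(s in D) (f s * g s).
  rewrite (eq_integral (fun s => limn (fun n => (layer n (f s))%:E * g s))).
    apply: cvg_monotone_convergence => //.
    - by move=> n; apply: emeasurable_funM => //; exact: measurable_layer.
    - by move=> n s Ds; rewrite mule_ge0 ?g0// lee_fin layer_ge0.
    - by move=> s Ds m n mn; rewrite lee_wpmul2r ?g0// lee_fin layer_nd.
  move=> s; rewrite inE => Ds; apply/esym/cvg_lim => //.
  by apply: layer_mul_cvg; [exact: f0|exact: g0].
rewrite -(cvg_lim _ cv)//; apply: lime_le; first by apply/cvg_ex; eexists; exact: cv.
apply: nearW => n.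
apply: (@le_trans _ _ (\int[mu]_(s in D') ((layer n (f' s))%:E * g' s))).
  rewrite !integral_layer//; apply: lee_sum => j _.
  apply: lee_wpmul2l; first by rewrite lee_fin.
  by apply: H; rewrite mulr_gt0// ?ltr0n// invr_gt0 exprn_gt0.
apply: ge0_le_integral => //.
- by move=> s Ds; rewrite mule_ge0 ?g'0// lee_fin layer_ge0.
- by apply: emeasurable_funM => //; exact: measurable_layer.
- by apply: emeasurable_funM.
- by move=> s Ds; rewrite lee_wpmul2r ?g'0//; apply: layer_le; exact: f'0.
Qed.

Lemma le_integral_distribution D D' f f' : measurable D -> measurable D' ->
  measurable_fun D f -> measurable_fun D' f' ->
  (forall s, D s -> 0 <= f s) -> (forall s, D' s -> 0 <= f' s) ->
  (forall l : R, (0 < l)%R ->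
     mu (D `&` [set s | l%:E < f s]) <= mu (D' `&` [set s | l%:E < f' s])) ->
  \int[mu]_(s in D) f s <= \int[mu]_(s in D') f' s.
Proof.
move=> mD mD' mf mf' f0 f'0 H.
have E A h : \int[mu]_(s in A) h s = \int[mu]_(s in A) (h s * cst 1 s).
  by apply: eq_integral => s _; rewrite mule1.
rewrite E [leRHS]E; apply: le_integral_layers => // l l0.
rewrite !integral_cst ?mul1e ?H//; exact: emeasurable_fun_o_infty.
Qed.

(** Two layer decompositions reduce the claim to level sets. For nested sets the measure of the
    intersection is the smaller of the two measures, and this dominates the measure of the
    intersection on the left. *)
Lemma hardy_littlewood_nested D f g w k : measurable D ->
  measurable_fun D f -> measurable_fun D g ->
  measurable_fun D w -> measurable_fun D k ->
  (forall s, D s -> 0 <= f s) -> (forall s, D s -> 0 <= g s) ->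
  (forall s, D s -> 0 <= w s) -> (forall s, D s -> 0 <= k s) ->
  (forall l : R, (0 < l)%R ->
     mu (D `&` [set s | l%:E < f s]) <= mu (D `&` [set s | l%:E < w s])) ->
  (forall l : R, (0 < l)%R ->
     mu (D `&` [set s | l%:E < g s]) <= mu (D `&` [set s | l%:E < k s])) ->
  (forall l m : \bar R,
     D `&` [set s | l < w s] `<=` D `&` [set s | m < k s] \/
     D `&` [set s | m < k s] `<=` D `&` [set s | l < w s]) ->
  \int[mu]_(s in D) (f s * g s) <= \int[mu]_(s in D) (w s * k s).
Proof.
move=> mD mf mg mw mk f0 g0 w0 k0 fw gk nest.
have mE h c : measurable_fun D h -> measurable (D `&` [set s | c < h s]).
  by move=> mh; exact: emeasurable_fun_o_infty.
apply: le_integral_layers => // l l0; apply: le_integral_distribution.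
- exact: mE.
- exact: mE.
- by apply: measurable_funS mg => //; exact: subIsetl.
- by apply: measurable_funS mk => //; exact: subIsetl.
- by move=> s [/g0].
- by move=> s [/k0].
move=> m m0; rewrite setIAC [leRHS in _ <= mu leRHS]setIAC.
set F := D `&` [set s | l%:E < f s]; set G := D `&` [set s | m%:E < g s].
set W := D `&` [set s | l%:E < w s]; set K := D `&` [set s | m%:E < k s].
have -> : D `&` [set s | m%:E < g s] `&` [set s | l%:E < f s] = F `&` G.
  by rewrite /F /G; apply/seteqP; split => s /= []; tauto.
have -> : D `&` [set s | m%:E < k s] `&` [set s | l%:E < w s] = W `&` K.
  by rewrite /W /K; apply/seteqP; split => s /= []; tauto.
have mF : measurable F by exact: mE.
have mG : measurable G by exact: mE.
case: (nest l%:E m%:E) => sub.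
  have -> : W `&` K = W by apply/setIidPl.
  by apply: le_trans (fw _ l0); apply: measureIl.
have -> : W `&` K = K by apply/setIidPr.
by apply: le_trans (gk _ m0); apply: measureIr.
Qed.

End layer_integral.

(** * Rearrangements *)

Section lebesgue.
Context {R : realType}.
Local Notation T := (lebesgueR R).
Local Notation mu := (@cleb R).

Lemma clebE (A : set R) : mu A = lebesgue_measure A.
Proof. by []. Qed.

Lemma interval_measurable (A : set T) : is_interval (A : set R) -> measurable A.
Proof. by move=> iA; apply: sub_caratheodory; exact: is_interval_measurable. Qed.

Lemma is_interval_oitv (a b : \bar R) : is_interval (oitv a b).
Proof.
move=> x y /andP[ax xb] /andP[ay yb] z /andP[xz zy]; apply/andP; split.
  by apply: lt_le_trans ax _; rewrite lee_fin.
by apply: le_lt_trans yb; rewrite lee_fin.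
Qed.

Lemma oitv_measurable (a b : \bar R) : measurable (oitv a b : set T).
Proof. by apply: interval_measurable; exact: is_interval_oitv. Qed.

Lemma oitvE (a : R) (b : \bar R) : a%:E <= b ->
  oitv a%:E b = if b is b'%:E then `]a, b'[%classic else `]a, +oo[%classic.
Proof.
case: b => [b||] ab //; apply/seteqP; split=> s; rewrite /oitv /= ?in_itv/= ?lte_fin//.
- by move=> /andP[-> _].
- by rewrite andbT => ->; rewrite ltry.
Qed.

Lemma cleb_oitv (a : R) (b : \bar R) : a%:E <= b -> mu (oitv a%:E b) = b - a%:E.
Proof.
move=> ab; rewrite clebE (oitvE ab); case: b ab => [b||] ab //.
  rewrite lebesgue_measure_itv /=; case: ifPn => // h.
  have ba : (b <= a)%R by rewrite leNgt; apply: contraNN h; rewrite lte_fin.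
  apply/esym/eqP.
  by rewrite -EFinB eqe subr_eq0 eq_le ba -lee_fin ab.
by rewrite lebesgue_measure_itv /= ltry addye.
Qed.

Lemma cleb_set1 (a : R) : mu [set a] = 0.
Proof. by rewrite clebE lebesgue_measure_set1. Qed.

Lemma le_ereal_gt (x y : \bar R) : 0 <= y ->
  (forall l : R, (0 < l)%R -> l%:E < x -> l%:E < y) -> x <= y.
Proof.
move=> y0 H; rewrite leNgt; apply/negP => yx.
case: y y0 yx H => [r||] //; last by move=> _; rewrite ltNge leey.
rewrite lee_fin => r0 rx H.
case: x rx H => [x||] // rx H; last first.
  have := H (r + 1)%R; rewrite ltry lte_fin; lra.
move: rx; rewrite lte_fin => rx.
have := H ((r + x) / 2)%R; rewrite !lte_fin; lra.
Qed.

Lemma eq_ereal_gt (x y : \bar R) : 0 <= x -> 0 <= y ->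
  (forall l : R, (0 < l)%R -> (l%:E < x) = (l%:E < y)) -> x = y.
Proof.
move=> x0 y0 H; apply/eqP; rewrite eq_le.
by apply/andP; split; apply: le_ereal_gt => // l l0; rewrite H.
Qed.

Lemma gee0_addye (x : \bar R) : 0 <= x -> +oo + x = +oo.
Proof. by case: x. Qed.

Lemma le_adde_congr (a b c a' b' c' : \bar R) :
  a = a' -> b = b' -> c = c' -> a <= b + c -> a' <= b' + c'.
Proof. by move=> -> -> ->. Qed.

Lemma cvge_ub (u : nat -> \bar R) l M : u n @[n --> \oo] --> l ->
  (forall n, u n <= M) -> l <= M.
Proof.
move=> cv H; rewrite -(cvg_lim _ cv)//; apply: lime_le.
  by apply/cvg_ex; eexists; exact: cv.
exact: nearW.
Qed.

Lemma nd_cvge_le (u : nat -> \bar R) l n : nondecreasing_seq u ->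
  u n @[n --> \oo] --> l -> u n <= l.
Proof.
move=> nd cv; rewrite -(cvg_lim _ cv)//; apply: lime_ge.
  by apply/cvg_ex; eexists; exact: cv.
by exists n => // m /=; exact: nd.
Qed.

(* For finite [x] and [l] this is the positive part of [x - l]; the rearrangement
   of [f] up to [t] has integral at most [l t] plus that of [excess f l], with
   equality when [l] is the value of the rearrangement at [t]. *)
Definition excess (x : \bar R) (l : R) := maxe (x - l%:E) 0.

Lemma excess_ge0 x l : 0 <= excess x l.
Proof. by rewrite /excess le_max lexx orbT. Qed.

Lemma le_excessD x (l : R) : 0 <= x -> x <= excess x l + l%:E.
Proof.
rewrite /excess; case: x => [x||] x0 //.
by rewrite -EFinB -EFin_max -EFinD lee_fin -lerBlDr le_max lexx.
Qed.

Lemma excessD_eq x (l : R) : l%:E <= x -> excess x l + l%:E = x.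
Proof.
by move=> lx; rewrite /excess (max_idPl _) ?subeK// sube_ge0.
Qed.

Lemma excess_eq0 x (l : R) : x <= l%:E -> excess x l = 0.
Proof. by move=> lx; rewrite /excess (max_idPr _)// leeBlDr// add0e. Qed.

Lemma excess_gt x (l m : R) : (0 < m)%R -> (m%:E < excess x l) = ((m + l)%:E < x).
Proof.
move=> m0; rewrite /excess lt_max [X in _ || X]lte_fin [X in _ || X]ltNge ltW// orbF.
by rewrite lteBrDr// -EFinD.
Qed.

Lemma excess_subadd x y (l m : R) : 0 <= x -> 0 <= y ->
  excess (x + y) (l + m) <= excess x l + excess y m.
Proof.
move=> x0 y0; rewrite {1}/excess ge_max adde_ge0 ?excess_ge0// andbT EFinD.
rewrite leeBlDr// addeACA; apply: leeD; exact: le_excessD.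
Qed.

Implicit Types (D : set T) (f g : R -> \bar R).

Lemma int_eq D f g : (forall s, D s -> f s = g s) ->
  \int[mu]_(s in D) f s = \int[mu]_(s in D) g s.
Proof. by move=> fg; apply: eq_integral => s /set_mem; exact: fg. Qed.

Lemma int_le D f g : measurable D -> 
  measurable_fun D (f : T -> _) -> measurable_fun D (g : T -> _) ->
  (forall s, D s -> 0 <= f s) -> (forall s, D s -> f s <= g s) ->
  \int[mu]_(s in D) f s <= \int[mu]_(s in D) g s.
Proof. by move=> mD mf mg f0 fg; exact: ge0_le_integral. Qed.

Lemma int_add D f g : measurable D ->
  measurable_fun D (f : T -> _) -> measurable_fun D (g : T -> _) ->
  (forall s, D s -> 0 <= f s) -> (forall s, D s -> 0 <= g s) ->
  \int[mu]_(s in D) (f s + g s) = \int[mu]_(s in D) f s + \int[mu]_(s in D) g s.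
Proof. by move=> mD mf mg f0 g0; exact: ge0_integralD. Qed.

Lemma int_scale D f (c : \bar R) : measurable D -> measurable_fun D (f : T -> _) ->
  (forall s, D s -> 0 <= f s) -> 0 <= c ->
  \int[mu]_(s in D) (c * f s) = c * \int[mu]_(s in D) f s.
Proof. by move=> mD mf f0 c0; exact: ge0_integralZl. Qed.

Lemma int_subset (A D : set T) f : measurable A -> measurable D ->
  measurable_fun D (f : T -> _) -> (forall s, D s -> 0 <= f s) -> A `<=` D ->
  \int[mu]_(s in A) f s <= \int[mu]_(s in D) f s.
Proof. by move=> mA mD mf f0 AD; exact: ge0_subset_integral. Qed.

Lemma int_ge0 D f : (forall s, D s -> 0 <= f s) -> 0 <= \int[mu]_(s in D) f s.
Proof. by move=> f0; exact: integral_ge0. Qed.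

Lemma int_cst D (c : \bar R) : measurable D -> \int[mu]_(s in D) c = c * mu D.
Proof. by move=> mD; rewrite (integral_cst mu mD). Qed.

Lemma int_ae_eq D f g : measurable D ->
  measurable_fun D (f : T -> _) -> measurable_fun D (g : T -> _) ->
  (\forall s \ae mu, D s -> f s = g s) ->
  \int[mu]_(s in D) f s = \int[mu]_(s in D) g s.
Proof. by move=> mD mf mg fg; exact: ae_eq_integral. Qed.

Lemma int_cvg D (fk : nat -> R -> \bar R) f : measurable D ->
  (forall k, measurable_fun D (fk k : T -> _)) ->
  (forall k s, D s -> 0 <= fk k s) ->
  (forall s, D s -> nondecreasing_seq (fun k => fk k s)) ->
  (forall s, D s -> fk k s @[k --> \oo] --> f s) ->
  \int[mu]_(s in D) fk k s @[k --> \oo] --> \int[mu]_(s in D) f s.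
Proof.
move=> mD mk k0 nd cv.
rewrite (@int_eq D f (fun s => limn (fun k => fk k s))); last first.
  by move=> s Ds; apply/esym/cvg_lim => //; exact: cv.
exact: (@cvg_monotone_convergence _ T R mu D mD fk mk k0 nd).
Qed.

End lebesgue.

Lemma measurable_excess d (T : measurableType d) (R : realType) (D : set T)
    (f : T -> \bar R) l : measurable_fun D f ->
  measurable_fun D (fun s => excess (f s) l).
Proof. by move=> mf; apply: measurable_maxe => //; exact: emeasurable_funB. Qed.

(** * The nonincreasing rearrangement and Hardy-Littlewood inequalities *)

Section rearrangement.
Context {R : realType} (L : \bar R) (L0 : 0 < L).
Local Notation T := (lebesgueR R).
Local Notation mu := (@cleb R).
Local Notation I := (oitv 0 L).
Implicit Types (f g w : R -> \bar R).

Definition noninc w := forall s t, I s -> I t -> (s <= t)%R -> w t <= w s.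
Definition nneg f := forall s, I s -> 0 <= f s.

Lemma measI : measurable (I : set T). Proof. exact: oitv_measurable. Qed.
#[local] Hint Resolve measI : core.

Lemma mu_I : mu I = L.
Proof. by rewrite cleb_oitv ?sube0 // ltW. Qed.

Lemma Meas_gt f (c : \bar R) : Meas L f -> measurable (I `&` [set s | c < f s] : set T).
Proof. by move=> mf; exact: emeasurable_fun_o_infty. Qed.

Lemma Meas_abs f : Meas L f -> Meas L (fun s => `|f s|).
Proof. by move=> mf; apply: measurableT_comp mf; exact: abse_measurable. Qed.

Lemma dist_nneg f (l : R) : nneg f ->
  dist_fun L f l = mu (I `&` [set s | l%:E < f s]).
Proof.
move=> f0; rewrite /dist_fun; congr (mu _); apply/seteqP; split => s /= [Is].
  by rewrite gee0_abs// f0.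
by rewrite gee0_abs ?f0.
Qed.

Lemma dist_le_L f l : Meas L f -> dist_fun L f l <= L.
Proof.
move=> mf; rewrite -[leRHS]mu_I; apply: le_measure; rewrite ?inE//.
  exact: (Meas_gt _ (Meas_abs mf)).
by move=> s [].
Qed.

Lemma dist_ge0 f l : 0 <= dist_fun L f l.
Proof. exact: measure_ge0. Qed.

Lemma dist_anti f (l m : R) : Meas L f -> (l <= m)%R ->
  dist_fun L f m <= dist_fun L f l.
Proof.
move=> mf lm; apply: le_measure; rewrite ?inE; try exact: (Meas_gt _ (Meas_abs mf)).
by move=> s [Is ms]; split => //; apply: le_lt_trans ms; rewrite lee_fin.
Qed.

(** Right continuity of the distribution function: the measure is continuous from below along the
    levels [l + 1 / (n + 1)]. *)
Lemma dist_right f (l : R) t : Meas L f ->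
  (forall m : R, (l < m)%R -> dist_fun L f m <= t) -> dist_fun L f l <= t.
Proof.
move=> mf H.
pose F n := I `&` [set s | (l + n.+1%:R^-1)%:E < `|f s|].
have mF n : measurable (F n : set T) by exact: (Meas_gt _ (Meas_abs mf)).
have FE : \bigcup_n F n = [set s | I s /\ l%:E < `|f s|].
  apply/seteqP; split => [s [n _ [Is h]]|s [Is h]].
    by split => //; apply: lt_trans h; rewrite lte_fin ltrDl.
  have [e e0 le] : exists2 e : R, (0 < e)%R & (l + e)%:E < `|f s|.
    case: `|f s| h => [r||] //.
      rewrite lte_fin => lr; exists ((r - l) / 2)%R; rewrite ?lte_fin; lra.
    by move=> _; exists 1%R; rewrite ?ltry.
  exists (Num.truncn e^-1) => //; split => //=; apply: le_lt_trans le.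
  rewrite lee_fin lerD2l -[leRHS]invrK lef_pV2 ?posrE ?invr_gt0 ?ltr0n//.
  exact: ltW (truncnS_gt _).
have ndF : nondecreasing_seq F.
  move=> n m nm; apply/subsetPset => s [Is h]; split => //.
  apply: le_lt_trans h; rewrite lee_fin lerD2l lef_pV2 ?posrE ?ltr0n//.
  by rewrite ler_nat.
have := nondecreasing_cvg_mu (mu := mu) mF (bigcupT_measurable _ mF) ndF.
rewrite FE => cv; apply: (cvge_ub cv) => n /=.
by apply: H; rewrite ltrDl invr_gt0 ltr0n.
Qed.

Lemma rearr_ge0 f t : 0 <= rearr L f t.
Proof. by apply: le_ereal_inf_tmp => _ [l [l0 _] <-]; rewrite lee_fin ltW. Qed.

(** The rearrangement is a generalized inverse of the distribution function, and right continuity of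
    the latter makes the equivalence exact. Most properties of the rearrangement are read off from
    it. *)
Lemma rearr_gt f (l t : R) : Meas L f -> (0 < l)%R ->
  (l%:E < rearr L f t) = (t%:E < dist_fun L f l).
Proof.
move=> mf l0; apply/idP/idP.
  apply: contraTT; rewrite -!leNgt => h.
  by apply: ereal_inf_lbound; exists l.
apply: contraTT; rewrite -!leNgt => h; apply: dist_right => // m lm.
have : rearr L f t < m%:E by apply: le_lt_trans h _; rewrite lte_fin.
move/ereal_inf_lt => [_ [p [p0 pt] <-]]; rewrite lte_fin => pm.
by apply: le_trans pt; apply: dist_anti => //; exact: ltW.
Qed.

Lemma rearr_noninc f : noninc (rearr L f).
Proof.
move=> s t _ _ st; apply: le_ereal_inf => _ [l [l0 h] <-].
by exists l => //; split => //; apply: le_trans h _; rewrite lee_fin.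
Qed.

Lemma noninc_gt w c s t : noninc w -> I s -> (s <= t)%R ->
  (I `&` [set s | c < w s]) t -> (I `&` [set s | c < w s]) s.
Proof.
by move=> nw Is st [It /= ct]; split => //=; apply: lt_le_trans ct _; exact: nw.
Qed.

(** The superlevel sets are intervals. This is the source of measurability for [u], [v], [nu] and
    the monotone functions built by the operators. *)
Lemma noninc_Meas w : noninc w -> Meas L w.
Proof.
move=> nw _; apply: (measurability _ (ErealGenOInfty.measurableE R)).
move=> _ [_ [c ->] <-]; apply: interval_measurable.
have -> : I `&` w @^-1` `]c%:E, +oo[%classic = I `&` [set s | c%:E < w s].
  by apply/seteqP; split => s /=; rewrite in_itv/= andbT.
move=> x y xI yI z /andP[xz zy].
apply: (noninc_gt nw _ zy yI).
by   by apply: (is_interval_oitv xI.1 yI.1); rewrite xz zy.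
exact: measI.
Qed.

Lemma rearr_Meas f : Meas L (rearr L f).
Proof. by apply: noninc_Meas; exact: rearr_noninc. Qed.

Lemma rearr_nneg f : nneg (rearr L f).
Proof. by move=> s _; exact: rearr_ge0. Qed.

Lemma dist_rearr f (l : R) : Meas L f -> (0 < l)%R ->
  dist_fun L (rearr L f) l = dist_fun L f l.
Proof.
move=> mf l0; rewrite dist_nneg; last exact: rearr_nneg.
have -> : I `&` [set s | l%:E < rearr L f s] = oitv 0 (dist_fun L f l).
  apply/seteqP; split => s /=.
    by move=> [/andP[s0 _]]; rewrite rearr_gt// => h; apply/andP.
  move=> /andP[s0 h]; rewrite rearr_gt//; split => //.
  by apply/andP; split => //; apply: lt_le_trans h _; exact: dist_le_L.
by rewrite cleb_oitv ?sube0// dist_ge0.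
Qed.

Lemma rearr_equi f : Meas L f -> equimeasurable L (rearr L f) f.
Proof. by move=> mf l l0; exact: dist_rearr. Qed.

Lemma le_rearr f g t : Meas L f -> Meas L g ->
  (forall l : R, (0 < l)%R -> dist_fun L f l <= dist_fun L g l) ->
  rearr L f t <= rearr L g t.
Proof.
move=> mf mg H; apply: le_ereal_gt; first exact: rearr_ge0.
move=> l l0; rewrite !rearr_gt// => h; exact: lt_le_trans h (H _ l0).
Qed.

(** Superlevel sets of [w] and [k] are initial segments of (0, L), hence nested. *)
Lemma hardy_littlewood_noninc f g w k :
  Meas L f -> Meas L g -> noninc w -> noninc k ->
  nneg f -> nneg g -> nneg w -> nneg k ->
  (forall l : R, (0 < l)%R -> dist_fun L f l <= dist_fun L w l) ->
  (forall l : R, (0 < l)%R -> dist_fun L g l <= dist_fun L k l) ->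
  \int[mu]_(s in I) (f s * g s) <= \int[mu]_(s in I) (w s * k s).
Proof.
move=> mf mg nw nk f0 g0 w0 k0 fw gk.
apply: hardy_littlewood_nested => //.
- exact: noninc_Meas.
- exact: noninc_Meas.
- by move=> l l0; have := fw _ l0; rewrite !dist_nneg.
- by move=> l l0; have := gk _ l0; rewrite !dist_nneg.
move=> l m; apply: contrapT => /not_orP[/existsNP[x /not_implyP[xW xK]]].
move=> /existsNP[y /not_implyP[yK yW]].
case: (leP x y) => xy; first by apply: xK; exact: (noninc_gt nk xW.1 xy yK).
by apply: yW; exact: (noninc_gt nw yK.1 (ltW xy) xW).
Qed.

#[local] Instance ae_cleb_filter : Filter (almost_everywhere mu) :=
  ae_filter_ringOfSetsType mu.

Lemma ae_nneg f : MeasPos L f -> ae_eq mu I f (fun s => `|f s|).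
Proof. by move=> [mf]; apply: filterS => s h Is; rewrite gee0_abs// h. Qed.

Lemma MeasPos_abs f : Meas L f -> MeasPos L (fun s => `|f s|).
Proof.
by move=> mf; split; [exact: Meas_abs|apply: aeW => s _; exact: abse_ge0].
Qed.

Lemma nneg_abs f : nneg (fun s => `|f s|).
Proof. by move=> s _; exact: abse_ge0. Qed.

Lemma nneg_MeasPos f : Meas L f -> nneg f -> MeasPos L f.
Proof. by move=> mf f0; split => //; apply: aeW. Qed.

Lemma ae_nneg_mul f g : MeasPos L f -> MeasPos L g ->
  ae_eq mu I (fun s => f s * g s) (fun s => `|f s| * `|g s|).
Proof.
move=> pf pg.
have := ae_nneg pf; have := ae_nneg pg; rewrite /ae_eq; apply: filterS2.
by move=> s gE fE Is; rewrite -fE// -gE.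
Qed.

Lemma integral_abs_mul f g : MeasPos L f -> MeasPos L g ->
  \int[mu]_(s in I) (f s * g s) = \int[mu]_(s in I) (`|f s| * `|g s|).
Proof.
move=> pf pg; apply: (@ae_eq_integral _ T R mu I); first exact: measI.
- by apply: emeasurable_funM; [exact: pf.1|exact: pg.1].
- by apply: emeasurable_funM; apply: Meas_abs; [exact: pf.1|exact: pg.1].
- exact: ae_nneg_mul.
Qed.

Lemma dist_abs f l : dist_fun L (fun s => `|f s|) l = dist_fun L f l.
Proof. by rewrite /dist_fun; under eq_set do rewrite abse_id. Qed.

Lemma rearr_abs f t : rearr L (fun s => `|f s|) t = rearr L f t.
Proof. by rewrite /rearr; under eq_set do rewrite dist_abs. Qed.

Lemma hardy_littlewood f g : MeasPos L f -> MeasPos L g ->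
  \int[mu]_(s in I) (f s * g s) <= \int[mu]_(s in I) (rearr L f s * rearr L g s).
Proof.
move=> pf pg; rewrite integral_abs_mul//.
have [mf _] := pf; have [mg _] := pg.
apply: hardy_littlewood_noninc.
all: try exact: Meas_abs.
all: try exact: rearr_noninc.
all: try exact: rearr_nneg.
all: try exact: nneg_abs.
by move=> l l0; rewrite dist_abs dist_rearr.
by move=> l l0; rewrite dist_abs dist_rearr.
Qed.

(** A nonincreasing weight serves as its own rearrangement, so only [f] is rearranged. The weights
    to come are [u] cut off at a point and [target_weight]. *)
Lemma le_rearr_noninc f w : MeasPos L f -> noninc w -> nneg w ->
  \int[mu]_(s in I) (f s * w s) <= \int[mu]_(s in I) (rearr L f s * w s).
Proof.
move=> pf nw w0; have mw := noninc_Meas nw; have [mf _] := pf.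
rewrite integral_abs_mul//; last exact: nneg_MeasPos.
apply: hardy_littlewood_noninc.
all: try exact: Meas_abs.
all: try exact: rearr_noninc.
all: try exact: rearr_nneg.
all: try exact: nneg_abs.
all: try exact: nw.
all: try exact: w0.
by move=> l l0; rewrite dist_abs dist_rearr.
by move=> l l0; rewrite dist_abs.
Qed.

Lemma le_dist_ae f g : Meas L f -> Meas L g ->
  (\forall s \ae mu, I s -> `|f s| <= `|g s|) ->
  forall l, dist_fun L f l <= dist_fun L g l.
Proof.
move=> mf mg [N [mN N0 sub]] l.
have mE := Meas_gt l%:E (Meas_abs mf); have mG := Meas_gt l%:E (Meas_abs mg).
apply: (@le_trans _ _ (mu ((I `&` [set s | l%:E < `|g s|]) `|` N))).
  apply: le_measure; rewrite ?inE; [exact: mE|exact: measurableU|].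
  move=> s [Is ls]; case: (pselect (N s)) => Ns; [by right|left; split => //].
  apply: lt_le_trans ls _; apply: contrapT => h; apply: Ns; apply: sub => /=.
  by move/(_ Is).
apply: le_trans (measureU2 _ _ _) _; [exact: mG|exact: mN|].
by rewrite [X in _ + X]N0 adde0.
Qed.

Lemma le_rearr_ae f g t : MeasPos L f -> MeasPos L g ->
  (\forall s \ae mu, I s -> f s <= g s) -> rearr L f t <= rearr L g t.
Proof.
move=> pf pg fg; apply: le_rearr; [exact: pf.1|exact: pg.1|move=> l _].
apply: le_dist_ae; [exact: pf.1|exact: pg.1|].
move: (ae_nneg pf) (ae_nneg pg) fg; rewrite /ae_eq; apply: filterS3.
by move=> s fE gE fg Is; rewrite -fE// -gE// fg.
Qed.

Lemma distZ f (c l : R) : (0 < c)%R ->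
  dist_fun L (fun s => c%:E * f s) l = dist_fun L f (l / c).
Proof.
move=> c0; rewrite /dist_fun; congr (mu _); apply/seteqP.
have E s : (l%:E < `|c%:E * f s|) = ((l / c)%:E < `|f s|).
  by rewrite abseM gee0_abs ?lee_fin ?ltW// muleC -lte_pdivrMr// muleC EFinM muleC.
by split => s /= [Is]; rewrite ?E// -E.
Qed.

Lemma rearrZ f (c t : R) : Meas L f -> (0 < c)%R ->
  rearr L (fun s => c%:E * f s) t = c%:E * rearr L f t.
Proof.
move=> mf c0; apply: eq_ereal_gt; first exact: rearr_ge0.
  by rewrite mule_ge0 ?rearr_ge0// lee_fin ltW.
move=> l l0; have mcf : Meas L (fun s => c%:E * f s).
  by apply: measurable_funeM.
rewrite rearr_gt// distZ// -rearr_gt ?divr_gt0//.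
by rewrite muleC -lte_pdivrMr// muleC EFinM muleC.
Qed.

Lemma rearr_indic (E : set T) t : measurable E -> E `<=` I -> (0 <= t)%R ->
  rearr L (fun s => (\1_E s)%:E) t = if t%:E < mu E then 1 else 0.
Proof.
move=> mE EI t0; have mf : Meas L (fun s => (\1_E s)%:E).
  by apply/measurable_EFinP; exact: measurable_indic.
have dE (l : R) : (0 < l)%R ->
    dist_fun L (fun s => (\1_E s)%:E) l = if (l < 1)%R then mu E else 0.
  move=> l0; rewrite dist_nneg; last by move=> s _; rewrite lee_fin.
  case: ifPn => l1.
    congr (mu _); apply/seteqP; split => s /=.
      move=> [Is]; rewrite lte_fin indicE; case: (boolP (s \in E)) => [/set_mem//|_] /=.
      by rewrite ltNge ltW.
    by move=> Es; split; [exact: EI|rewrite indicE mem_set// lte_fin].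
  rewrite -(measure0 mu); congr (mu _); apply/seteqP; split => s //= [Is].
  rewrite indicE lte_fin; case: (_ \in _) => /=; first by rewrite (negbTE l1).
  by rewrite ltNge ltW.
apply: eq_ereal_gt; first exact: rearr_ge0.
  by case: ifP.
move=> l l0; rewrite rearr_gt// dE//; case: (ltP l 1%R) => l1.
  case: ifPn => _; first by rewrite lte_fin.
  by rewrite lte_fin ltNge ltW.
rewrite lte_fin ltNge t0/=; case: ifPn => h; rewrite lte_fin ltNge.
  by rewrite l1.
by rewrite ltW.
Qed.

(** Off a null set the superlevel sets of the [fk] increase to that of [f], since a strict
    inequality [l < f s] is already met by some [fk k s]; the measure is continuous from below. *)
Lemma dist_cvg (fk : nat -> R -> \bar R) f l :
  (forall k : nat, Meas L (fk k)) -> Meas L f ->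
  (forall k : nat, nneg (fk k)) -> nneg f ->
  (\forall s \ae mu, I s ->
     nondecreasing_seq (fun k : nat => fk k s) /\ fk k s @[k --> \oo] --> f s) ->
  forall t, t < dist_fun L f l -> exists k : nat, t < dist_fun L (fk k) l.
Proof.
move=> mk mf k0 f0 [N [mN N0 sub]] t tf; apply: contrapT => /forallNP H.
have {}H k : dist_fun L (fk k) l <= t by rewrite leNgt; exact/negP/H.
move: tf; rewrite ltNge => /negP; apply.
pose F k := (I `\` N) `&` [set s | l%:E < fk k s].
have mF k : measurable (F k : set T).
  rewrite /F -setIA [X in I `&` X]setIC setIA; apply: measurableI.
    exact: Meas_gt.
  exact: measurableC.
have ndF : nondecreasing_seq F.
  move=> n m nm; apply/subsetPset => s [[Is Ns] h]; split => //.
  have [nd _] : nondecreasing_seq (fun k : nat => fk k s) /\ fk k s @[k --> \oo] --> f s.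
    by apply: contrapT => h'; apply: Ns; apply: sub => /= /(_ Is).
  by apply: lt_le_trans h _; exact: nd.
have FE : \bigcup_k F k = (I `\` N) `&` [set s | l%:E < f s].
  apply/seteqP; split => s.
    move=> [k _ [[Is Ns] /= h]]; split => //=.
    have [nd cv] : nondecreasing_seq (fun k : nat => fk k s) /\ fk k s @[k --> \oo] --> f s.
      by apply: contrapT => h'; apply: Ns; apply: sub => /= /(_ Is).
    by apply: lt_le_trans h _; exact: nd_cvge_le nd cv.
  move=> [[Is Ns] /= h].
  have [nd cv] : nondecreasing_seq (fun k : nat => fk k s) /\ fk k s @[k --> \oo] --> f s.
    by apply: contrapT => h'; apply: Ns; apply: sub => /= /(_ Is).
  apply: contrapT => /forall2NP nF; move: h; rewrite ltNge => /negP; apply.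
  apply: (cvge_ub cv) => k; rewrite leNgt; apply/negP => h.
  by case: (nF k) => //; apply.
have := nondecreasing_cvg_mu (mu := mu) mF (bigcupT_measurable _ mF) ndF.
rewrite FE => cv.
apply: (@le_trans _ _ (mu ((I `\` N) `&` [set s | l%:E < f s]))).
  rewrite dist_nneg//.
  have mE := Meas_gt l%:E mf.
  apply: (@le_trans _ _ (mu (((I `\` N) `&` [set s | l%:E < f s]) `|` N))).
    apply: le_measure; rewrite ?inE; [exact: mE| |].
      by apply: measurableU => //; rewrite -FE; exact: bigcupT_measurable.
    by move=> s [Is h]; case: (pselect (N s)) => Ns; [right|left].
  apply: le_trans (measureU2 _ _ _) _; [|exact: mN|].
    by rewrite -FE; exact: bigcupT_measurable.
  by rewrite [X in _ + X]N0 adde0.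
apply: (cvge_ub cv) => k /=; apply: le_trans (H k); rewrite dist_nneg//.
apply: le_measure; rewrite ?inE; [exact: mF|exact: Meas_gt|].
by move=> s [[]].
Qed.

Lemma rearr_cvg (fk : nat -> R -> \bar R) f t :
  (forall k : nat, MeasPos L (fk k)) -> MeasPos L f ->
  (\forall s \ae mu, I s ->
     nondecreasing_seq (fun k : nat => fk k s) /\ fk k s @[k --> \oo] --> f s) ->
  nondecreasing_seq (fun k : nat => rearr L (fk k) t) /\
  rearr L (fk k) t @[k --> \oo] --> rearr L f t.
Proof.
move=> pk pf ae.
have nd : nondecreasing_seq (fun k : nat => rearr L (fk k) t).
  move=> m n mn; apply: le_rearr_ae => //.
  by move: ae; apply: filterS => s h Is; have [nd _] := h Is; exact: nd.
split => //.
suff -> : rearr L f t = ereal_sup (range (fun k : nat => rearr L (fk k) t)).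
  exact: ereal_nondecreasing_cvgn.
apply/eqP; rewrite eq_le; apply/andP; split; last first.
  apply: ge_ereal_sup => _ [k _ <-]; apply: le_rearr_ae => //.
  move: ae; apply: filterS => s h Is; have [ndk cv] := h Is.
  exact: nd_cvge_le ndk cv.
apply: le_ereal_gt.
  by apply: le_trans (rearr_ge0 (fk 0%N) t) _; apply: ereal_sup_ubound; exists 0%N.
move=> l l0; rewrite rearr_gt; [|exact: pf.1|by []].
rewrite -dist_abs => h.
have [k] : exists k : nat, t%:E < dist_fun L (fun s => `|fk k s|) l.
  apply: dist_cvg h.
  - by move=> k; apply: Meas_abs; exact: (pk k).1.
  - by apply: Meas_abs; exact: pf.1.
  - by move=> k; exact: nneg_abs.
  - exact: nneg_abs.
  have kE : \forall s \ae mu, forall k : nat, I s -> fk k s = `|fk k s|.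
    by apply/ae_foralln => k; exact: ae_nneg.
  move: kE (ae_nneg pf) ae; rewrite /ae_eq; apply: filterS3 => s kE fE cv Is.
  rewrite -fE//; have -> : (fun k : nat => `|fk k s|) = fk^~ s.
    by apply/funext => k; rewrite -kE.
  exact: cv.
rewrite dist_abs -rearr_gt; [|exact: (pk k).1|by []].
by move=> h'; apply: lt_le_trans h' _; apply: ereal_sup_ubound; exists k.
Qed.

(** * Integrals of rearrangements over initial segments *)

Lemma le_integral_dist f g : Meas L f -> Meas L g -> nneg f -> nneg g ->
  (forall l : R, (0 < l)%R -> dist_fun L f l <= dist_fun L g l) ->
  \int[mu]_(s in I) f s <= \int[mu]_(s in I) g s.
Proof.
move=> mf mg f0 g0 H.
apply: (@le_integral_distribution _ T R mu I I f g measI measI mf mg f0 g0).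
by move=> l l0; have := H l l0; rewrite !dist_nneg.
Qed.

Lemma integral_equi f g : Meas L f -> Meas L g -> nneg f -> nneg g ->
  equimeasurable L f g -> \int[mu]_(s in I) f s = \int[mu]_(s in I) g s.
Proof.
move=> mf mg f0 g0 H; apply/eqP; rewrite eq_le.
by apply/andP; split; apply: le_integral_dist => // l l0; rewrite H.
Qed.

Lemma integral_rearr f : Meas L f -> nneg f ->
  \int[mu]_(s in I) rearr L f s = \int[mu]_(s in I) f s.
Proof.
move=> mf f0; apply: integral_equi (rearr_equi mf) => //; [exact: rearr_Meas|].
exact: rearr_nneg.
Qed.

Lemma Meas_excess f l : Meas L f -> Meas L (fun s => excess (f s) l).
Proof. by move=> mf; exact: measurable_excess. Qed.

(** Passing to the excess shifts the distribution function by [l], so the excesses of [f] and of its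
    rearrangement are equimeasurable. *)
Lemma integral_excess_rearr f (l : R) : (0 <= l)%R -> Meas L f -> nneg f ->
  \int[mu]_(s in I) excess (rearr L f s) l = \int[mu]_(s in I) excess (f s) l.
Proof.
move=> l0 mf f0.
apply: (integral_equi (Meas_excess l (rearr_Meas f)) (Meas_excess l mf)).
- by move=> s _; exact: excess_ge0.
- by move=> s _; exact: excess_ge0.
have E h (m : R) : (0 < m)%R -> nneg h ->
    dist_fun L (fun s => excess (h s) l) m = dist_fun L h (m + l)%R.
  move=> m0 h0; rewrite (dist_nneg _ h0) dist_nneg; last first.
    by move=> s _; exact: excess_ge0.
  by congr (mu _); apply/seteqP; split => s [Is] /=; rewrite excess_gt.
move=> m m0; rewrite (E _ _ m0 f0) (E _ _ m0 (@rearr_nneg f)).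
by apply: dist_rearr => //; rewrite ltr_wpDr.
Qed.

Lemma integral_rearr_le_excess f (J : set T) (l : R) : (0 <= l)%R ->
  Meas L f -> nneg f -> measurable J -> J `<=` I ->
  \int[mu]_(s in J) rearr L f s <=
  \int[mu]_(s in I) excess (f s) l + l%:E * mu J.
Proof.
move=> l0 mf f0 mJ JI.
have mr : measurable_fun J (rearr L f : T -> _).
  by apply: measurable_funS (rearr_Meas f); [exact: measI|exact: JI].
have me : measurable_fun J (fun s : T => excess (rearr L f s) l).
  exact: measurable_excess.
have mc : measurable_fun J (fun _ : T => l%:E) by exact: measurable_cst.
rewrite -integral_excess_rearr// -(int_cst _ mJ).
apply: (@le_trans _ _ (\int[mu]_(s in J) (excess (rearr L f s) l + l%:E))).
  apply: (int_le mJ mr (emeasurable_funD me mc)) => s Js; first exact: rearr_ge0.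
  by apply: le_excessD; exact: rearr_ge0.
rewrite (int_add mJ me mc) => [|s _|s _]; [|exact: excess_ge0|by rewrite lee_fin].
apply: leeD2r; apply: (int_subset mJ measI (Meas_excess l (rearr_Meas f)) _ JI).
by move=> s _; exact: excess_ge0.
Qed.

Lemma excess_le_integral_rearr f (J : set T) (l : R) : (0 <= l)%R ->
  Meas L f -> nneg f -> measurable J -> J `<=` I ->
  (forall s, J s -> l%:E <= rearr L f s) ->
  (forall s, I s -> ~ J s -> rearr L f s <= l%:E) ->
  \int[mu]_(s in I) excess (f s) l + l%:E * mu J <= \int[mu]_(s in J) rearr L f s.
Proof.
move=> l0 mf f0 mJ JI lJ Jl.
have mr : measurable_fun J (rearr L f : T -> _).
  by apply: measurable_funS (rearr_Meas f); [exact: measI|exact: JI].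
have me : measurable_fun J (fun s : T => excess (rearr L f s) l).
  exact: measurable_excess.
have mc : measurable_fun J (fun _ : T => l%:E) by exact: measurable_cst.
rewrite -integral_excess_rearr// -(int_cst _ mJ).
have -> : \int[mu]_(s in I) excess (rearr L f s) l =
          \int[mu]_(s in J) excess (rearr L f s) l.
  rewrite [RHS]integral_mkcond [LHS]integral_mkcond; apply: int_eq => s _.
  rewrite /patch; case: (boolP (s \in J)) => [/set_mem Js|sJ].
    by rewrite mem_set//; exact: JI.
  case: ifPn => // /set_mem Is; apply: excess_eq0; apply: Jl => //.
  by move/mem_set; apply/negP.
rewrite -(int_add mJ me mc) => [|s _|s _]; [|exact: excess_ge0|by rewrite lee_fin].
apply: (int_le mJ (emeasurable_funD me mc) mr) => s Js.
  by rewrite adde_ge0 ?excess_ge0// lee_fin.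
by rewrite excessD_eq// lJ.
Qed.

(** The levels [l] and [m] are the values of the two rearrangements at [c = sup J]. Each integral on
    the right is then at least the integral of the excess plus level times measure, the integral on
    the left is at most the same expression with level [l + m], and the excess is subadditive. [J]
    is a general initial segment because a superlevel set of the weight may or may not contain its
    end point. *)
Lemma rearr_sublinear_segment f g (J : set T) :
  Meas L f -> Meas L g -> nneg f -> nneg g ->
  measurable J -> J `<=` I ->
  (forall s t, I s -> (s <= t)%R -> J t -> J s) ->
  \int[mu]_(s in J) rearr L (fun x => f x + g x) s <=
  \int[mu]_(s in J) (rearr L f s + rearr L g s).
Proof.
move=> mf mg f0 g0 mJ JI dJ.
have mfg : Meas L (fun x => f x + g x) by exact: emeasurable_funD.
have fg0 : nneg (fun x => f x + g x).
  by move=> s Is; rewrite adde_ge0//; [exact: f0|exact: g0].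
have mJr h : measurable_fun J (rearr L h : T -> _).
  by apply: measurable_funS (rearr_Meas h); [exact: measI|exact: JI].
have r0 h s : J s -> 0 <= rearr L h s by move=> _; exact: rearr_ge0.
rewrite (int_add mJ (mJr f) (mJr g) (r0 f) (r0 g)).
(* On all of (0, L) rearranging preserves the integrals, and their additivity suffices. *)
have [JE|/existsNP[b /not_implyP[Ib Jb]]] := pselect (I `<=` J).
  have -> : J = I by apply/seteqP.
  rewrite (integral_rearr mf f0) (integral_rearr mg g0) (integral_rearr mfg fg0).
  by rewrite (int_add measI mf mg f0 g0).
have [JE|/set0P[a Ja]] := eqVneq J set0.
  by rewrite JE !integral_set0 adde0.
pose c := sup J.
have Jb' s : J s -> (s <= b)%R.
  move=> Js; rewrite leNgt; apply/negP => bs; apply: Jb.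
  exact: dJ Ib (ltW bs) Js.
have hsJ : has_sup J by split; [exists a|exists b].
have Jc s : J s -> (s <= c)%R by move=> Js; apply: sup_upper_bound.
have cJ s : I s -> ~ J s -> (c <= s)%R.
  move=> Is Js; apply: sup_le_ub; first by exists a.
  move=> x Jx; rewrite leNgt; apply/negP => sx; apply: Js.
  exact: dJ Is (ltW sx) Jx.
have Ic : I c.
  apply: (is_interval_oitv (JI _ Ja) Ib); apply/andP; split; first exact: Jc.
  exact: cJ.
have c0 : (0 < c)%R by move/andP: Ic => [].
have muJ0 : 0 < mu J.
  apply: (@lt_le_trans _ _ (mu (oitv 0 c%:E))).
    by rewrite cleb_oitv ?sube0 ?lte_fin// lee_fin ltW.
  apply: le_measure; rewrite ?inE; [exact: oitv_measurable|exact: mJ|].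
  move=> s /andP[s0 sc]; apply: contrapT => Js.
  have Is : I s.
    by move/andP: Ic => [_ cL]; apply/andP; split => //; exact: lt_trans sc cL.
  by have := cJ _ Is Js; rewrite leNgt -lte_fin sc.
have lJ h l : rearr L h c = l -> forall s, J s -> l <= rearr L h s.
  by move=> <- s Js; apply: rearr_noninc => //; [exact: JI|exact: Jc].
have Jl h l : rearr L h c = l -> forall s, I s -> ~ J s -> rearr L h s <= l.
  by move=> <- s Is Js; apply: rearr_noninc => //; exact: cJ.
(* An infinite value at [c] forces an infinite integral over [J], which has positive measure. *)
have inf h : rearr L h c = +oo -> \int[mu]_(s in J) rearr L h s = +oo.
  move=> hc; apply/eqP; rewrite -leye_eq.
  apply: (@le_trans _ _ (\int[mu]_(s in J) (cst +oo s))).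
    by rewrite (integral_cst mu mJ) gt0_mulye.
  apply: (int_le mJ (measurable_cst _) (mJr h)) => s Js /=; first by rewrite leey.
  exact: lJ Js.
have [fy|fy] := eqVneq (rearr L f c) +oo.
  by rewrite (inf f fy) gee0_addye ?leey// int_ge0//; exact: r0.
have [gy|gy] := eqVneq (rearr L g c) +oo.
  by rewrite (inf g gy) addeC gee0_addye ?leey// int_ge0//; exact: r0.
have fin h : rearr L h c != +oo -> exists2 l : R, rearr L h c = l%:E & (0 <= l)%R.
  move=> hy; exists (fine (rearr L h c)); last by rewrite fine_ge0// rearr_ge0.
  by rewrite fineK// ge0_fin_numE ?rearr_ge0// ltey.
have [l fl l0] := fin f fy; have [m gm m0] := fin g gy.
apply: le_trans (leeD (excess_le_integral_rearr l0 mf f0 mJ JI (lJ _ _ fl) (Jl _ _ fl))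
  (excess_le_integral_rearr m0 mg g0 mJ JI (lJ _ _ gm) (Jl _ _ gm))).
apply: le_trans (integral_rearr_le_excess (addr_ge0 l0 m0) mfg fg0 mJ JI) _.
rewrite [X in _ + X](_ : _ = l%:E * mu J + m%:E * mu J); last first.
  by rewrite EFinD ge0_muleDl ?lee_fin.
rewrite [leRHS]addeACA; apply: leeD; last exact: lexx.
have e0 h k : nneg (fun s => excess (h s) k) by move=> s _; exact: excess_ge0.
rewrite -(int_add measI (Meas_excess _ mf) (Meas_excess _ mg) (e0 _ _) (e0 _ _)).
apply: (int_le measI (Meas_excess _ mfg) _ (e0 _ _)).
  by apply: emeasurable_funD; exact: Meas_excess.
by move=> s Is; apply: excess_subadd; [exact: f0|exact: g0].
Qed.

Lemma rearr_ae_eq f g t : Meas L f -> Meas L g ->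
  (\forall s \ae mu, I s -> f s = g s) -> rearr L f t = rearr L g t.
Proof.
move=> mf mg fg; apply/eqP; rewrite eq_le; apply/andP; split.
  apply: (le_rearr _ mf mg) => l _; apply: (le_dist_ae mf mg).
  by move: fg; apply: filterS => s /[apply] ->.
apply: (le_rearr _ mg mf) => l _; apply: (le_dist_ae mg mf).
by move: fg; apply: filterS => s /[apply] ->.
Qed.

(** Superlevel sets of [w] are initial segments, so the inequality over segments is summed over the
    layers of [w]. *)
Lemma rearr_sublinear_nneg f g w : Meas L f -> Meas L g -> nneg f -> nneg g ->
  noninc w -> nneg w ->
  \int[mu]_(s in I) (rearr L (fun x => f x + g x) s * w s) <=
  \int[mu]_(s in I) (rearr L f s * w s) + \int[mu]_(s in I) (rearr L g s * w s).
Proof.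
move=> mf mg f0 g0 nw w0; have mw := noninc_Meas nw.
have mrw h : Meas L (fun s => rearr L h s * w s).
  by apply: emeasurable_funM => //; exact: rearr_Meas.
have rw0 h : nneg (fun s => rearr L h s * w s).
  by move=> s Is; rewrite mule_ge0 ?rearr_ge0// w0.
rewrite -(int_add measI (mrw f) (mrw g) (rw0 f) (rw0 g)).
under int_eq do rewrite muleC.
rewrite [leRHS](int_eq (g := fun s => w s * (rearr L f s + rearr L g s))); last first.
  by move=> s _; rewrite ge0_muleDr ?rearr_ge0// !(muleC (w s)).
apply: (@le_integral_layers _ T R mu I I w _ w _ measI measI mw _ mw _ w0 _ w0).
+ exact: rearr_Meas.
+ by apply: emeasurable_funD; exact: rearr_Meas.
+ exact: rearr_nneg.
+ by move=> s _; rewrite adde_ge0// rearr_ge0.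
move=> l l0; apply: (rearr_sublinear_segment mf mg f0 g0).
+ exact: Meas_gt.
+ exact: subIsetl.
+ by move=> s t Is st Jt; exact: (noninc_gt nw Is st Jt).
Qed.

Lemma rearr_sublinear f g w : MeasPos L f -> MeasPos L g -> noninc w -> nneg w ->
  \int[mu]_(s in I) (rearr L (fun x => f x + g x) s * w s) <=
  \int[mu]_(s in I) (rearr L f s * w s) + \int[mu]_(s in I) (rearr L g s * w s).
Proof.
move=> pf pg nw w0; have [mf _] := pf; have [mg _] := pg.
have := rearr_sublinear_nneg (Meas_abs mf) (Meas_abs mg) (@nneg_abs f) (@nneg_abs g) nw w0.
have E t : rearr L (fun x => `|f x| + `|g x|) t = rearr L (fun x => f x + g x) t.
  apply: rearr_ae_eq.
  - by apply: emeasurable_funD; exact: Meas_abs.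
  - exact: emeasurable_funD.
  move: (ae_nneg pf) (ae_nneg pg); rewrite /ae_eq; apply: filterS2 => s fE gE Is.
  by rewrite -(fE Is) -(gE Is).
have A h : \int[mu]_(s in I) (rearr L (fun x => `|h x|) s * w s) =
           \int[mu]_(s in I) (rearr L h s * w s).
  by apply: int_eq => s _; rewrite rearr_abs.
have B : \int[mu]_(s in I) (rearr L (fun x => `|f x| + `|g x|) s * w s) =
         \int[mu]_(s in I) (rearr L (fun x => f x + g x) s * w s).
  by apply: int_eq => s _; rewrite E.
by move=> H; exact: (le_adde_congr B (A f) (A g) H).
Qed.

End rearrangement.

(** * Finite-dimensional Hahn-Banach theorem *)

Section sublinear.
Context {R : realType} {V : lmodType R}.
Implicit Types (p q : V -> R).
Local Open Scope ring_scope.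

Definition sublinear p :=
  (forall x y, p (x + y) <= p x + p y) /\
  (forall (t : R) x, 0 <= t -> p (t *: x) = t * p x).

Lemma sublinear0 p : sublinear p -> p 0 = 0.
Proof. by move=> [_ h]; rewrite -(scale0r 0) h// mul0r. Qed.

Lemma sublinear_opp p x : sublinear p -> - p (- x) <= p x.
Proof.
move=> hp; have [h _] := hp; have := h x (- x).
by rewrite subrr sublinear0// => H; lra.
Qed.

(** One step of the Hahn-Banach argument: [q x] is the infimum of [p (x + t a) - t p a] over
    [t >= 0]. Taking [t = 1] at [x = - a] gives the last bound, which forces [q a = p a] and
    [q (- a) = - q a]. *)
Lemma sublinear_reduce p a : sublinear p ->
  exists q, [/\ sublinear q, (forall x, q x <= p x) & q (- a) <= - p a].
Proof.
move=> hp; have [pD pZ] := hp.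
pose S x := [set p (x + t *: a) - t * p a | t in [set t : R | 0 <= t]]%classic.
pose q x := inf (S x).
have Slb x : lbound (S x) (- p (- x)).
  move=> _ [t /= t0 <-].
  have : p (t *: a) <= p (x + t *: a) + p (- x).
    by apply: le_trans (pD _ _); rewrite addrAC subrr add0r.
  rewrite pZ//; lra.
have qle x t : 0 <= t -> q x <= p (x + t *: a) - t * p a.
  by move=> t0; apply: inf_lbound; [exists (- p (- x)); exact: Slb|exists t].
have leq x m : (forall t, 0 <= t -> m <= p (x + t *: a) - t * p a) -> m <= q x.
  move=> H; apply: lb_le_inf; first by exists (p (x + 0 *: a) - 0 * p a), 0 => /=.
  by move=> _ [t /= t0 <-]; exact: H.
exists q; split.
- split.
    move=> x y; rewrite -lerBlDl; apply: (leq) => t t0.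
    suff : q (x + y) - (p (y + t *: a) - t * p a) <= q x by lra.
    apply: (leq) => s s0; rewrite lerBlDr; apply: le_trans (qle (x + y) (s + t) (addr_ge0 s0 t0)) _.
    have := pD (x + s *: a) (y + t *: a).
    rewrite addrACA -scalerDl; lra.
  have sub c x : 0 < c -> q (c *: x) <= c * q x.
    move=> c0; rewrite -ler_pdivrMl//; apply: (leq) => t t0.
    rewrite ler_pdivrMl// mulrBr -pZ ?(ltW c0)// scalerDr scalerA mulrA.
    by apply: qle; rewrite mulr_ge0// ltW.
  move=> c x; rewrite le_eqVlt => /predU1P[<-|c0].
    rewrite scale0r mul0r; apply/eqP; rewrite eq_le; apply/andP; split.
      by have := qle 0 0 (lexx 0); rewrite scale0r addr0 mul0r subr0 (sublinear0 hp).
    by apply: (leq) => t t0; rewrite add0r pZ// subrr.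
  apply/eqP; rewrite eq_le sub//= -ler_pdivlMl//.
  have c1 : 0 < c^-1 by rewrite invr_gt0.
  by have := sub _ (c *: x) c1; rewrite scalerA mulVf ?gt_eqF// scale1r.
- by move=> x; have := qle x 0 (lexx 0); rewrite scale0r addr0 mul0r subr0.
- by have := qle (- a) 1 ler01; rewrite scale1r addNr (sublinear0 hp) mul1r sub0r.
Qed.

Lemma sublinear_reduce_seq (e : seq V) p : sublinear p ->
  exists q, [/\ sublinear q, (forall x, q x <= p x) &
    (forall a, a \in e -> q (- a) <= - q a)].
Proof.
elim: e p => [|a e IH] p hp; first by exists p.
have [q1 [h1 q1p q1a]] := sublinear_reduce a hp.
have [q [hq qq1 qe]] := IH _ h1.
exists q; split => // [x|b]; first exact: le_trans (qq1 x) (q1p x).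
rewrite inE => /predU1P[->|]; last exact: qe.
(* The bound for [a] survives the later reductions: [q (- a) <= q1 (- a) <= - p a <= - q a]. *)
have := qq1 (- a); have := qq1 a; have := q1p a; lra.
Qed.

End sublinear.

Section finite_hahn_banach.
Local Open Scope ring_scope.

(** Reducing along [a] fixes the value at [a]. Reducing along the basis vectors bounds the
    functional above by its coordinate expansion; the same bound at [- c] gives equality. *)
Lemma finite_hahn_banach (R : realType) n (p : 'rV[R]_n -> R) (a : 'rV[R]_n) :
  sublinear p -> exists b : 'I_n -> R,
    (p a <= \sum_i b i * a 0 i)%R /\
    forall c : 'rV[R]_n, (\sum_i b i * c 0 i <= p c)%R.
Proof.
move=> hp.
have [q0 [h0 q0p q0a]] := sublinear_reduce a hp.
have [q [hq qq0 qe]] := sublinear_reduce_seq [seq delta_mx 0 i | i : 'I_n] h0.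
have [qD qZ] := hq.
have qe' i : (q (- delta_mx 0 i) <= - q (delta_mx 0 i))%R.
  by apply: qe; apply: map_f; rewrite mem_enum.
have qd i (c : R) : (q (c *: delta_mx 0 i) <= q (delta_mx 0 i) * c)%R.
  have [c0|c0] := leP 0%R c; first by rewrite qZ// mulrC.
  have -> : (c *: delta_mx 0 i = (- c) *: - delta_mx 0 i :> 'rV[R]_n)%R.
    by rewrite scaleNr scalerN opprK.
  rewrite qZ; last by rewrite oppr_ge0 ltW.
  by have := qe' i; nra.
have qs (c : 'rV[R]_n) : (q c <= \sum_i q (delta_mx 0 i) * c 0 i)%R.
  rewrite {1}(row_sum_delta c).
  elim/big_ind2 : _ => [|x1 x2 y1 y2 h1 h2|i _]; first by rewrite sublinear0.
    by apply: le_trans (qD _ _) _; exact: lerD.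
  exact: qd.
have sq (c : 'rV[R]_n) : (\sum_i q (delta_mx 0 i) * c 0 i <= q c)%R.
  apply: le_trans (sublinear_opp c hq); rewrite lerNr.
  apply: le_trans (qs _) _; rewrite -sumrN; apply: ler_sum => i _.
  by rewrite mxE mulrN.
exists (fun i => q (delta_mx 0 i)); split.
  have := sq (- a)%R; have := qq0 (- a)%R.
  have -> : (\sum_i q (delta_mx 0 i) * (- a) 0 i =
    - \sum_i q (delta_mx 0 i) * a 0 i)%R.
    by rewrite -sumrN; apply: eq_bigr => i _; rewrite mxE mulrN.
  lra.
move=> c; apply: le_trans (sq c) _; exact: le_trans (qq0 c) (q0p c).
Qed.

End finite_hahn_banach.

(** * Averaging and resonance *)

Lemma sume_const (R : realType) n (y : \bar R) : 0 <= y ->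
  \sum_(i < n) y = n%:R%:E * y.
Proof.
move=> y0; elim: n => [|n IH]; first by rewrite big_ord0 mul0e.
by rewrite big_ord_recr /= IH -natr1 EFinD ge0_muleDl ?lee_fin// mul1e.
Qed.

Section riprops.
Context {R : realType} (L : \bar R) (L0 : 0 < L).
Local Notation T := (lebesgueR R).
Local Notation mu := (@cleb R).
Local Notation I := (oitv 0 L).
Implicit Types (f g h w : R -> \bar R).
#[local] Existing Instance ae_cleb_filter.

Lemma MeasPosD f g : MeasPos L f -> MeasPos L g -> MeasPos L (fun s => f s + g s).
Proof.
move=> [mf pf] [mg pg]; split; first exact: emeasurable_funD.
by move: pf pg; apply: filterS2 => s f0 g0 Is; rewrite adde_ge0 ?f0 ?g0.
Qed.

Lemma MeasPosZ (c : R) f : (0 <= c)%R -> MeasPos L f -> MeasPos L (fun s => c%:E * f s).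
Proof.
move=> c0 [mf pf]; split; first exact: measurable_funeM.
by move: pf; apply: filterS => s f0 Is; rewrite mule_ge0 ?f0// lee_fin.
Qed.

Lemma MeasPos0 : MeasPos L (fun _ => 0).
Proof. by split; [exact: measurable_cst|apply: aeW]. Qed.

Lemma Meas_indic (E : set T) : measurable E -> Meas L (fun s => (\1_E s)%:E).
Proof. by move=> mE; apply/measurable_EFinP; exact: measurable_indic. Qed.

Lemma MeasPos_indic (E : set T) : measurable E -> MeasPos L (fun s => (\1_E s)%:E).
Proof.
by move=> mE; apply: nneg_MeasPos; [exact: Meas_indic|move=> s _; rewrite lee_fin].
Qed.

(** An infinite value [c] is allowed; off [D] it is annihilated by [0 * +oo = 0]. *)
Definition cell (D : set R) (c : \bar R) (s : R) : \bar R := (\1_D s)%:E * c.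

Lemma cell_in D c s : D s -> cell D c s = c.
Proof. by move=> Ds; rewrite /cell indicE mem_set// mul1e. Qed.

Lemma cell_out D c s : ~ D s -> cell D c s = 0.
Proof. by move=> Ds; rewrite /cell indicE memNset// mul0e. Qed.

Lemma cell_ge0 D c s : 0 <= c -> 0 <= cell D c s.
Proof. by move=> c0; rewrite mule_ge0// lee_fin. Qed.

Lemma cell_Meas (D : set T) c : measurable D -> Meas L (cell D c).
Proof.
move=> mD; apply: emeasurable_funM; first exact: Meas_indic.
exact: measurable_cst.
Qed.

Lemma cell_nneg D c : 0 <= c -> nneg L (cell D c).
Proof. by move=> c0 s _; exact: cell_ge0. Qed.

Lemma dist_cell (D : set T) c (l : R) : D `<=` I -> 0 <= c -> (0 < l)%R ->
  dist_fun L (cell D c) l = if l%:E < c then mu D else 0.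
Proof.
move=> DI c0 l0; rewrite dist_nneg; last exact: cell_nneg.
case: ifPn => lc.
  congr (mu _); apply/seteqP; split => s /=.
    move=> [Is]; case: (pselect (D s)) => // Ds; rewrite cell_out// lte_fin ltNge.
    by rewrite ltW.
  by move=> Ds; split; [exact: DI|rewrite cell_in].
rewrite -(measure0 mu); congr (mu _); apply/seteqP; split => s //= [Is].
case: (pselect (D s)) => Ds; first by rewrite cell_in// (negbTE lc).
by rewrite cell_out// lte_fin ltNge ltW.
Qed.

Lemma dist_add_disjoint f g (l : R) : Meas L f -> Meas L g -> nneg L f -> nneg L g ->
  (forall s, I s -> f s = 0 \/ g s = 0) -> (0 < l)%R ->
  dist_fun L (fun s => f s + g s) l = dist_fun L f l + dist_fun L g l.
Proof.
move=> mf mg f0 g0 fg l0; rewrite !dist_nneg//; last first.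
  by move=> s Is; rewrite adde_ge0 ?f0 ?g0.
have mF := Meas_gt l%:E mf; have mG := Meas_gt l%:E mg.
transitivity (mu ((I `&` [set s | l%:E < f s]) `|` (I `&` [set s | l%:E < g s]))).
  congr (mu _); apply/seteqP; split => s /=.
    move=> [Is]; case: (fg _ Is) => ->; rewrite ?add0e ?adde0; tauto.
  case=> [] [Is h]; split => //; apply: lt_le_trans h _.
    by rewrite leeDl// g0.
  by rewrite leeDr// f0.
apply: measureU; [exact: mF|exact: mG|].
apply/seteqP; split => s //= [[Is h1] [_ h2]].
case: (fg _ Is) => e; first by move: h1; rewrite e lte_fin ltNge ltW.
by move: h2; rewrite e lte_fin ltNge ltW.
Qed.

Definition step (D : nat -> set R) (v : nat -> \bar R) n (s : R) : \bar R :=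
  \sum_(i < n) cell (D i) (v i) s.

Lemma stepS D v n s : step D v n.+1 s = step D v n s + cell (D n) (v n) s.
Proof. by rewrite /step big_ord_recr. Qed.

Lemma step_ge0 D v n s : (forall i, 0 <= v i) -> 0 <= step D v n s.
Proof. by move=> v0; apply: sume_ge0 => i _; exact: cell_ge0. Qed.

Lemma step_Meas (D : nat -> set T) v n : (forall i, measurable (D i)) ->
  Meas L (step D v n).
Proof.
move=> mD; elim: n => [|n IH].
  apply: (eq_measurable_fun (fun _ : T => 0)); last exact: measurable_cst.
  by move=> s _; rewrite /step big_ord0.
apply: (eq_measurable_fun (fun s : T => step D v n s + cell (D n) (v n) s)).
  by move=> s _; rewrite stepS.
by apply: emeasurable_funD => //; exact: cell_Meas.
Qed.

Lemma step_out D v n s : (forall i, (i < n)%N -> ~ D i s) -> step D v n s = 0.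
Proof. by move=> H; rewrite /step big1// => i _; rewrite cell_out//; exact: H. Qed.

Lemma step_in D v n i s : trivIset setT D -> (i < n)%N -> D i s -> step D v n s = v i.
Proof.
move=> tD ni Di; rewrite /step (bigD1 (Ordinal ni))//= cell_in// big1 ?adde0//.
move=> j ij; rewrite cell_out// => Dj; move/eqP: ij; apply; apply: val_inj => /=.
by apply: tD => //; exists s.
Qed.

Lemma dist_step (D : nat -> set T) v n (l : R) : trivIset setT D ->
  (forall i, measurable (D i)) -> (forall i, (i < n)%N -> D i `<=` I) ->
  (forall i, 0 <= v i) -> (0 < l)%R ->
  dist_fun L (step D v n) l = \sum_(i < n) (if l%:E < v i then mu (D i) else 0).
Proof.
move=> tD mD + v0 l0; elim: n => [_|n IH DI].
  rewrite big_ord0 dist_nneg; last by move=> s _; exact: step_ge0.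
  rewrite -(measure0 mu); congr (mu _); apply/seteqP; split => s //= [_].
  by rewrite /step big_ord0 lte_fin ltNge ltW.
rewrite big_ord_recr /= -IH; last by move=> i ni; apply: DI; exact: ltnW.
rewrite -dist_cell//; last exact: DI.
rewrite -dist_add_disjoint//.
- by rewrite /dist_fun; congr (mu _); apply/seteqP; split => s /=; rewrite stepS.
- exact: step_Meas.
- exact: cell_Meas.
- by move=> s _; exact: step_ge0.
- exact: cell_nneg.
move=> s _; case: (pselect (D n s)) => Dn; last by right; rewrite cell_out.
left; apply: step_out => i ni Di; move: (ni).
by rewrite (tD i n Logic.I Logic.I) ?ltnn//; exists s.
Qed.

Lemma rearr_anti f (s t : R) : (s <= t)%R -> rearr L f t <= rearr L f s.
Proof.
move=> st; apply: le_ereal_inf => _ [l [l0 h] <-].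
by exists l => //; split => //; apply: le_trans h _; rewrite lee_fin.
Qed.

(** The rearrangement is nonincreasing on the whole line, so its measurability is not confined to
    (0, L); the half-open intervals below may end at [L]. *)
Lemma rearr_Meas_pos f (D : set T) : measurable D -> D `<=` oitv 0 +oo ->
  measurable_fun D (rearr L f : T -> _).
Proof.
move=> mD D0.
apply: (measurable_funS _ D0); first exact: oitv_measurable.
by apply: noninc_Meas => s t _ _; exact: rearr_anti.
Qed.

(** * Moving a function behind a given interval *)

Section tail.
Context (F : set T) (a : R) (hO : R -> \bar R).
Hypotheses (mF : measurable F) (FI : F `<=` I) (muF : mu F = a%:E).
Hypotheses (mhO : Meas L hO) (hO0 : nneg L hO) (hOF : forall s, F s -> hO s = 0).

(** An equimeasurable copy of [hO] placed behind [(0, a)]. It fits into (0, L) because [hO] vanishes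
    on [F], a set of measure [a]. *)
Definition tail (x : R) : \bar R := cell (oitv a%:E +oo) (rearr L hO (x - a)) x.

Let a0 : (0 <= a)%R. Proof. by rewrite -lee_fin -muF measure_ge0. Qed.

Lemma tail_out x : (x <= a)%R -> tail x = 0.
Proof. by move=> xa; rewrite /tail cell_out// => /andP[]; rewrite lte_fin ltNge xa. Qed.

Lemma tail_nneg : nneg L tail.
Proof. by move=> s _; apply: cell_ge0; exact: rearr_ge0. Qed.

Lemma tail_Meas : Meas L tail.
Proof.
(* Extending by [+oo] up to [a] makes the function nonincreasing, hence measurable. *)
pose k x : \bar R := if (x <= a)%R then +oo else rearr L hO (x - a).
have mk : Meas L k.
  apply: noninc_Meas => s t _ _ st; rewrite /k.
  case: (leP t a) => ta; first by rewrite (le_trans st ta).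
  case: (leP s a) => sa; first by rewrite leey.
  by apply: rearr_anti; rewrite lerD2r.
apply: (eq_measurable_fun (fun x : T => (\1_(oitv a%:E +oo) x)%:E * k x)); last first.
  by apply: emeasurable_funM => //; apply: Meas_indic; exact: oitv_measurable.
move=> x _; rewrite /tail /cell /k indicE; case: (boolP (x \in _)); last by rewrite !mul0e.
by move=> /set_mem/andP[]; rewrite lte_fin ltNge => /negbTE ->.
Qed.

Lemma dist_tail (l : R) : (0 < l)%R -> dist_fun L tail l = dist_fun L hO l.
Proof.
move=> l0; set d := dist_fun L hO l.
have d0 : 0 <= d by exact: dist_ge0.
have adL : a%:E + d <= L.
  rewrite -[leRHS](mu_I L0) -muF /d dist_nneg//.
  rewrite -measureU; [|exact: mF|exact: Meas_gt|].
    apply: le_measure; rewrite ?inE; [|exact: measI|].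
      by apply: measurableU => //; exact: Meas_gt.
    by move=> s [/FI//|[]].
  by apply/seteqP; split => s //= [/hOF h [_]]; rewrite h lte_fin ltNge ltW.
rewrite dist_nneg; last exact: tail_nneg.
have -> : I `&` [set s | l%:E < tail s] = oitv a%:E (a%:E + d).
  apply/seteqP; split => s /=.
    move=> [Is]; rewrite /tail; case: (leP s a) => sa.
      by rewrite -/(tail s) tail_out// lte_fin ltNge ltW.
    rewrite cell_in; last by rewrite /oitv /= lte_fin sa ltry.
    by rewrite rearr_gt// -/d EFinB lteBlDl// => h; apply/andP.
  move=> /andP[as_ sd]; split.
    by apply/andP; split; [apply: le_lt_trans as_; rewrite lee_fin|exact: lt_le_trans sd adL].
  rewrite /tail cell_in; last by rewrite /oitv /= as_ ltry.
  by rewrite rearr_gt// -/d EFinB lteBlDl.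
rewrite cleb_oitv; last by rewrite leeDl.
by rewrite addeC addeA [_ + a%:E]addeC subee// add0e.
Qed.

End tail.

(** * Consequences of the norm axioms and averaging over one set *)

Section norm.
Context (N : (R -> \bar R) -> \bar R) (hN : ri_norm L N).

Lemma N_ae f g : MeasPos L f -> MeasPos L g ->
  (\forall s \ae mu, I s -> f s = g s) -> N f = N g.
Proof.
move=> pf pg fg; apply/eqP; rewrite eq_le; apply/andP; split; apply: (ri_mono hN) => //.
  by move: fg; apply: filterS => s /[apply] ->.
by move: fg; apply: filterS => s /[apply] ->.
Qed.

Lemma N_eq f g : MeasPos L f -> MeasPos L g -> (forall s, I s -> f s = g s) -> N f = N g.
Proof. by move=> pf pg fg; apply: N_ae => //; exact: aeW. Qed.

Lemma N_abs f : MeasPos L f -> N (fun s => `|f s|) = N f.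
Proof.
move=> pf; apply/esym; apply: N_ae => //; last exact: ae_nneg.
by apply: MeasPos_abs; exact: pf.1.
Qed.

Lemma N_le f g : MeasPos L f -> MeasPos L g -> (forall s, I s -> f s <= g s) -> N f <= N g.
Proof. by move=> pf pg fg; apply: (ri_mono hN) => //; exact: aeW. Qed.

Lemma rearr_MeasPos f : MeasPos L (rearr L f).
Proof. by apply: nneg_MeasPos; [exact: rearr_Meas|exact: rearr_nneg]. Qed.

Lemma N_rearr f : MeasPos L f -> N (rearr L f) = N f.
Proof.
move=> pf; apply: (ri_equi hN) => //; first exact: rearr_MeasPos.
by apply: rearr_equi => //; exact: pf.1.
Qed.

Lemma N_le_dist f g : MeasPos L f -> MeasPos L g ->
  (forall l : R, (0 < l)%R -> dist_fun L f l <= dist_fun L g l) -> N f <= N g.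
Proof.
move=> pf pg fg; rewrite -(N_rearr pf) -(N_rearr pg).
apply: N_le; [exact: rearr_MeasPos|exact: rearr_MeasPos|move=> s _].
by apply: le_rearr => //; [exact: pf.1|exact: pg.1].
Qed.

Lemma N0 : N (fun _ => 0) = 0.
Proof. by apply/(ri_eq0 hN); [exact: MeasPos0|apply: aeW]. Qed.

Lemma MeasPos_sum (F : nat -> R -> \bar R) n : (forall i, MeasPos L (F i)) ->
  MeasPos L (fun s => \sum_(i < n) F i s).
Proof.
move=> pF; elim: n => [|n IH].
  by under eq_fun do rewrite big_ord0; exact: MeasPos0.
by under eq_fun do rewrite big_ord_recr /=; exact: MeasPosD.
Qed.

Lemma N_sum (F : nat -> R -> \bar R) n : (forall i, MeasPos L (F i)) ->
  N (fun s => \sum_(i < n) F i s) <= \sum_(i < n) N (F i).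
Proof.
move=> pF; elim: n => [|n IH].
  by rewrite big_ord0; under eq_fun do rewrite big_ord0; rewrite N0.
rewrite big_ord_recr /=; under eq_fun do rewrite big_ord_recr /=.
apply: le_trans (ri_triangle hN (MeasPos_sum n pF) (pF n)) _.
exact: leeD.
Qed.

Lemma N_fatou_le (fk : nat -> R -> \bar R) f M :
  (forall k, MeasPos L (fk k)) -> MeasPos L f ->
  (forall s, I s -> nondecreasing_seq (fun k => fk k s)) ->
  (forall s, I s -> fk k s @[k --> \oo] --> f s) ->
  (forall k, N (fk k) <= M) -> N f <= M.
Proof.
move=> pk pf nd cv H.
have [|_ c] := ri_fatou hN pk pf; last exact: cvge_ub c H.
by apply: aeW => s Is; split; [exact: nd|exact: cv].
Qed.

(* The constant mean is the average of the cyclic shifts of the values [c], and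
   each shifted step function has the same distribution as the original one. *)
Lemma N_cyclic (a : R) n (c : 'I_n.+1 -> \bar R) (k h : R -> \bar R) :
  (0 < a)%R -> a%:E <= L -> (forall i, 0 <= c i) ->
  Meas L k -> nneg L k -> (forall s, (s <= a)%R -> k s = 0) -> MeasPos L h ->
  let d := (a / n.+1%:R)%R in
  let J i : set R := oitv (i%:R * d)%:E (i.+1%:R * d)%:E in
  (forall l : R, (0 < l)%R ->
    \sum_i (if l%:E < c i then d%:E else 0) + dist_fun L k l <= dist_fun L h l) ->
  N (fun s => step J (fun _ => (n.+1%:R^-1)%:E * \sum_i c i) n.+1 s + k s) <= N h.
Proof.
move=> a0 aL c0 mk k0 ka ph d J H.
have d0 : (0 < d)%R by rewrite divr_gt0.
have nd : (n.+1%:R * d = a)%R by rewrite /d mulrC divfK.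
have mJ i : measurable (J i : set T) by exact: oitv_measurable.
have Ja i : (i < n.+1)%N -> J i `<=` [set s | (s < a)%R].
  move=> ni s /andP[_]; rewrite lte_fin => h'; apply: lt_le_trans h' _.
  by rewrite -nd ler_pM2r// ler_nat.
have muJ i : mu (J i) = d%:E.
  rewrite cleb_oitv; last by rewrite lee_fin ler_pM2r// ler_nat.
  by rewrite -EFinB -natr1 mulrDl mul1r addrC addKr.
have tJ : trivIset setT J.
  apply: ltn_trivIset => i j ij; apply/seteqP; split => s //= [/andP[_]].
  rewrite lte_fin => sj /andP[]; rewrite lte_fin => is_ _.
  have := lt_trans is_ sj; rewrite ltr_pM2r// ltr_nat ltnS leqNgt.
  by rewrite ij.
have JI i : (i < n.+1)%N -> J i `<=` I.
  move=> ni s Js; apply/andP; split.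
    by move: Js => /andP[+ _]; apply: le_lt_trans; rewrite lee_fin mulr_ge0// ltW.
  by apply: lt_le_trans aL; rewrite lte_fin; exact: Ja Js.
(* Addition in ['I_n.+1] is modulo [n.+1], so [v r] is a cyclic shift of the values. *)
pose v (r : 'I_n.+1) (i : nat) := c (inord i + r)%R.
have pM r : MeasPos L (fun s => step J (v r) n.+1 s + k s).
  apply: nneg_MeasPos; first by apply: emeasurable_funD => //; exact: step_Meas.
  by move=> s Is; rewrite adde_ge0 ?k0// step_ge0// => i; exact: c0.
have disj y s : I s -> step J y n.+1 s = 0 \/ k s = 0.
  move=> _; case: (leP s a) => sa; [right; exact: ka|left].
  apply: step_out => i ni Ji; have := Ja _ ni _ Ji => /=.
  by rewrite ltNge ltW.
have distM y l : (forall i, 0 <= y i) -> (0 < l)%R ->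
    dist_fun L (fun s => step J y n.+1 s + k s) l =
    \sum_(i < n.+1) (if l%:E < y i then d%:E else 0) + dist_fun L k l.
  move=> y0 l0; rewrite dist_add_disjoint//.
  - by rewrite dist_step//; under eq_bigr do rewrite muJ.
  - exact: step_Meas.
  - by move=> s _; exact: step_ge0.
  - by move=> s Is; exact: disj.
have NM r : N (fun s => step J (v r) n.+1 s + k s) <= N h.
  apply: N_le_dist => // l l0; rewrite distM//; last by move=> i; exact: c0.
  apply: le_trans (H _ l0); rewrite [X in _ <= X + _](reindex_inj (addIr r)) /=.
  by under eq_bigr do rewrite /v inord_val.
have mp : 0 <= (n.+1%:R^-1)%:E * \sum_i c i.
  by rewrite mule_ge0 ?sume_ge0// lee_fin.
pose G (r : nat) s := step J (v (inord r)) n.+1 s + k s.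
have E s : I s -> step J (fun _ => (n.+1%:R^-1)%:E * \sum_i c i) n.+1 s + k s =
    (n.+1%:R^-1)%:E * \sum_(r < n.+1) G r s.
  move=> Is; have [/eqP ks|ks] := eqVneq (k s) 0; last first.
    have st y : step J y n.+1 s = 0.
      by case: (disj y s Is) => // k0'; rewrite k0' eqxx in ks.
    have GE (r : 'I_n.+1) : G r s = k s by rewrite /G /= st add0e.
    rewrite [X in _ = _ * X](eq_bigr (fun _ => k s)); last by move=> r _; exact: GE.
    rewrite st add0e sume_const ?k0// muleA.
    by rewrite -EFinM mulVf// mul1e.
  have [ [i [ni Ji]] | nJ] := pselect (exists i, (i < n.+1)%N /\ J i s); last first.
    have st y : step J y n.+1 s = 0.
      by apply: step_out => i ni Ji; apply: nJ; exists i.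
    rewrite st add0e (eqP ks) big1 ?mule0// => r _.
    by rewrite /G /= st add0e (eqP ks).
  rewrite (step_in _ tJ ni Ji) (eqP ks) adde0; congr (_ * _).
  rewrite (reindex_inj (addrI (inord i))).
  apply: eq_bigr => r _.
  by rewrite /G inord_val (step_in _ tJ ni Ji) (eqP ks) adde0.
have pG r : MeasPos L (G r) by exact: pM.
rewrite (N_eq _ _ E); last 2 first.
- apply: nneg_MeasPos; first by apply: emeasurable_funD => //; exact: step_Meas.
  by move=> s Is; rewrite adde_ge0 ?k0// step_ge0.
- by apply: MeasPosZ => //; exact: MeasPos_sum.
rewrite (ri_scale hN)//; last exact: MeasPos_sum.
apply: (@le_trans _ _ ((n.+1%:R^-1)%:E * \sum_(r < n.+1) N h)).
  apply: lee_wpmul2l; first by rewrite lee_fin.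
  apply: le_trans (N_sum n.+1 pG) _.
  by apply: lee_sum => r _; exact: NM.
rewrite sume_const; last exact: ri_ge0 ph.
by rewrite muleA -EFinM mulVf// mul1e.
Qed.

Lemma cleb_itvoc (a b : R) : (a <= b)%R -> mu `]a, b]%classic = (b - a)%:E.
Proof.
move=> ab; rewrite clebE lebesgue_measure_itv /= lte_fin.
case: ltP => // ba; have -> : a = b by apply/eqP; rewrite eq_le ab ba.
by rewrite subrr.
Qed.

Lemma itvoc_measurable (a b : R) : measurable (`]a, b]%classic : set T).
Proof. by apply: interval_measurable; exact: interval_is_interval. Qed.

Lemma itvoc_pos (a b : R) : (0 <= a)%R -> `]a, b]%classic `<=` oitv 0 +oo.
Proof.
move=> a0 s /=; rewrite in_itv /= => /andP[as_ _]; rewrite /oitv /= lte_fin ltry andbT.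
exact: le_lt_trans as_.
Qed.

(** Each interval of length [d] is estimated by the value at its left end point. The first interval
    is left out, since the rearrangement may be unbounded near 0; only the values at the points
    [(i + 1) d] occur. *)
Lemma integral_rearr_oc f (d : R) m : (0 < d)%R ->
  \int[mu]_(x in `]d, (m.+1%:R * d)%R]%classic) rearr L f x <=
  \sum_(i < m) d%:E * rearr L f (i.+1%:R * d).
Proof.
move=> d0; elim: m => [|m IH].
  by rewrite big_ord0 mul1r set_itv_ge ?integral_set0// bnd_simp ltxx.
rewrite big_ord_recr /=.
have dm : (d <= m.+1%:R * d)%R by rewrite ler_peMl ?(ltW d0)// ler1n.
have mm : (m.+1%:R * d <= m.+2%:R * d)%R by rewrite ler_pM2r// ler_nat.
rewrite (@itv_bndbnd_setU _ _ _ (BRight (m.+1%:R * d)%R)) ?bnd_simp//.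
rewrite ge0_integral_setU.
- apply: leeD; first exact: IH.
  apply: (@le_trans _ _ (\int[mu]_(x in `](m.+1%:R * d)%R, (m.+2%:R * d)%R]%classic)
     rearr L f (m.+1%:R * d))).
    apply: (int_le (itvoc_measurable _ _)).
    + apply: rearr_Meas_pos; first exact: itvoc_measurable.
      by apply: itvoc_pos; rewrite mulr_ge0// ltW.
    + exact: measurable_cst.
    + by move=> s _; exact: rearr_ge0.
    + move=> s /=; rewrite in_itv /= => /andP[h _].
      by apply: rearr_anti; exact: ltW.
  rewrite (int_cst _ (itvoc_measurable _ _)) cleb_itvoc// muleC.
  by rewrite -mulrBl -natrB// subSnn mul1r.
- exact: itvoc_measurable.
- exact: itvoc_measurable.
- apply: rearr_Meas_pos; first by apply: measurableU; exact: itvoc_measurable.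
  move=> s [|]; apply: itvoc_pos; first exact: ltW.
  by rewrite mulr_ge0// ltW.
- by move=> s _; exact: rearr_ge0.
- rewrite disj_set2E; apply/eqP; apply/seteqP; split => s //= [].
  by rewrite !in_itv /= => /andP[_ h1] /andP[h2 _]; move: h2; rewrite ltNge h1.
Qed.

(* The rearrangement of [hF] is compared with step functions on [n] equal
   subintervals of [(0, mu F)], [hO] is moved behind them, and [n] tends to
   infinity in [N_cyclic]. *)
Lemma N_average (F : set T) hF hO : measurable F -> F `<=` I -> mu F < +oo ->
  Meas L hF -> nneg L hF -> Meas L hO -> nneg L hO ->
  (forall s, F s -> hO s = 0) -> (forall s, ~ F s -> hF s = 0) ->
  N (fun s => cell F ((fine (mu F))^-1%:E * \int[mu]_(s in I) hF s) s + hO s) <=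
  N (fun s => hF s + hO s).
Proof.
move=> mF FI Ffin mhF hF0 mhO hO0 hOF hFO.
have ph : MeasPos L (fun s => hF s + hO s).
  apply: nneg_MeasPos; first exact: emeasurable_funD.
  by move=> s Is; rewrite adde_ge0 ?hF0 ?hO0.
have int0 : 0 <= \int[mu]_(s in I) hF s by apply: int_ge0.
have pc c : 0 <= c -> MeasPos L (fun s => cell F c s + hO s).
  move=> c0; apply: nneg_MeasPos.
    by apply: emeasurable_funD => //; exact: cell_Meas.
  by move=> s Is; rewrite adde_ge0 ?hO0// cell_ge0.
set a := fine (mu F).
have muF : mu F = a%:E by rewrite /a fineK// ge0_fin_numE.
have a0' : (0 <= a)%R by rewrite -lee_fin -muF measure_ge0.
(* For a null set [F] the value on the cell is 0, since the inverse of 0 is 0. *)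
have [a0|a0] := eqVneq a 0%R.
  rewrite a0 invr0 mul0e; apply: N_le => //; first exact: pc.
  by move=> s Is; rewrite /cell mule0 leeD2r// hF0.
have {a0 a0'} a0 : (0 < a)%R by rewrite lt_neqAle eq_sym a0.
have aL : a%:E <= L.
  by rewrite -(mu_I L0) -muF; apply: le_measure; rewrite ?inE//; exact: measI.
pose d n : R := (a / n.+1%:R)%R.
pose r n := \int[mu]_(x in `]d n, a]%classic) rearr L hF x.
have dF l : (0 < l)%R -> dist_fun L hF l <= a%:E.
  move=> l0; rewrite -muF dist_nneg//; apply: le_measure; rewrite ?inE//.
    exact: Meas_gt.
  move=> s [_ /= h]; apply: contrapT => /hFO e.
  by move: h; rewrite e lte_fin ltNge ltW.
have disj c s : I s -> cell F c s = 0 \/ hO s = 0.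
  by move=> _; case: (pselect (F s)) => Fs; [right; exact: hOF|left; exact: cell_out].
have r0 n : 0 <= r n by apply: int_ge0 => s _; exact: rearr_ge0.
have main n : N (fun s => cell F (a^-1%:E * r n) s + hO s) <= N (fun s => hF s + hO s).
  pose c (i : 'I_n.+1) := rearr L hF (i.+1%:R * d n).
  pose k := tail a hO.
  have mk : Meas L k by exact: tail_Meas.
  have k0 : nneg L k by exact: tail_nneg.
  have dn0 : (0 < d n)%R by rewrite divr_gt0.
  have nd : (n.+1%:R * d n = a)%R by rewrite /d mulrC divfK.
  have c0 i : 0 <= c i by exact: rearr_ge0.
  pose m := (n.+1%:R^-1)%:E * \sum_i c i.
  have m0 : 0 <= m by rewrite mule_ge0 ?sume_ge0// lee_fin.
  apply: (@le_trans _ _ (N (fun s => cell F m s + hO s))).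
    apply: N_le; [apply: pc|exact: pc|].
      by rewrite mule_ge0// lee_fin invr_ge0 ltW.
    move=> s Is; apply: leeD => //; apply: lee_wpmul2l; first by rewrite lee_fin.
    have -> : m = a^-1%:E * \sum_i (d n)%:E * c i.
      rewrite -ge0_sume_distrr//.
      rewrite muleA -EFinM; congr (_%:E * _).
      by rewrite /d mulrA mulVf ?mul1r// gt_eqF.
    apply: lee_wpmul2l; first by rewrite lee_fin invr_ge0 ltW.
    apply: le_trans (_ : _ <= \sum_(i < n) (d n)%:E * rearr L hF (i.+1%:R * d n)) _.
      by rewrite /r -[X in `]_, X]](nd) ; apply: integral_rearr_oc.
    rewrite big_ord_recr /= leeDl// mule_ge0//.
      by rewrite lee_fin ltW.
  apply: le_trans (N_cyclic (n := n) a0 aL c0 mk k0 _ ph _); last first.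
  - move=> l l0; rewrite -/(d n) dist_add_disjoint//.
      rewrite /k (dist_tail mF FI muF)//; apply: leeD => //.
      (* The number of grid points [(i + 1) d] below the measure of a level set, times [d], is a
         layer of that measure and so does not exceed it. *)
      have -> : \sum_i (if l%:E < c i then (d n)%:E else 0) =
          (layer_sum (d n) n.+1 (dist_fun L hF l))%:E.
        rewrite /layer_sum -sumEFin; apply: eq_bigr => i _.
        rewrite /c rearr_gt//; by case: ifP => _; rewrite ?mulr1 ?mulr0.
      by case: (@layer_sum_le R (d n) n.+1 _ dn0 (dist_ge0 L hF l)).
    move=> s Is; case: (pselect (F s)) => Fs; [right; exact: hOF|left; exact: hFO].
  - by move=> s sa; exact: tail_out.
  rewrite -/(d n).
  set J := fun i : nat => oitv _ _.
  apply: N_le_dist; [exact: pc| |].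
    apply: nneg_MeasPos.
      by apply: emeasurable_funD => //; apply: step_Meas => i; exact: oitv_measurable.
    by move=> s Is; rewrite adde_ge0 ?k0// step_ge0.
  move=> l l0; rewrite dist_add_disjoint//; last 3 first.
  - exact: cell_Meas.
  - exact: cell_nneg.
  - by move=> s Is; exact: disj.
  rewrite dist_cell//.
  have Ja i : (i < n.+1)%N -> J i `<=` [set s | (s < a)%R].
    move=> ni s /andP[_]; rewrite lte_fin => h'; apply: lt_le_trans h' _.
    by rewrite -nd ler_pM2r// ler_nat.
  have muJ i : mu (J i) = (d n)%:E.
    rewrite cleb_oitv; last by rewrite lee_fin ler_pM2r// ler_nat.
    by rewrite -EFinB -natr1 mulrDl mul1r addrC addKr.
  have tJ : trivIset setT J.
    apply: ltn_trivIset => i j ij; apply/seteqP; split => s //= [/andP[_]].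
    rewrite lte_fin => sj /andP[]; rewrite lte_fin => is_ _.
    have := lt_trans is_ sj; rewrite ltr_pM2r// ltr_nat ltnS leqNgt.
    by rewrite ij.
  have JI i : (i < n.+1)%N -> J i `<=` I.
    move=> ni s Js; apply/andP; split.
      by move: Js => /andP[+ _]; apply: le_lt_trans; rewrite lee_fin mulr_ge0// ltW.
    by apply: lt_le_trans aL; rewrite lte_fin; exact: Ja Js.
  rewrite dist_add_disjoint//.
  - rewrite /k (dist_tail mF FI muF)//; apply: leeD => //.
    rewrite dist_step//; last by move=> i; exact: oitv_measurable.
    under eq_bigr do rewrite muJ; rewrite -/m.
    case: ifPn => lm; last by rewrite big1.
    rewrite sume_const; last by rewrite lee_fin ltW.
    by rewrite muF -nd -EFinM.
  - by apply: step_Meas => i; exact: oitv_measurable.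
  - by move=> s _; exact: step_ge0.
  - move=> s _; case: (leP s a) => sa; [right; exact: tail_out|left].
    apply: step_out => i ni Ji; have := Ja _ ni _ Ji => /=.
    by rewrite ltNge ltW.
have dpos n : (0 < d n)%R by rewrite divr_gt0.
have rcv : r n @[n --> \oo] --> \int[mu]_(x in `]0%R, a]%classic) rearr L hF x.
  have -> : `]0%R, a]%classic = \bigcup_n `]d n, a]%classic.
    apply/seteqP; split => s /=; rewrite ?in_itv /=.
      move=> /andP[s0 sa]; exists (Num.truncn (a / s)) => //=.
      rewrite in_itv /= sa andbT /d ltr_pdivrMr// mulrC -ltr_pdivrMr//.
      exact: truncnS_gt.
    move=> [n _] /=; rewrite in_itv /= => /andP[h ->]; rewrite andbT.
    exact: lt_trans h.
  apply: ge0_nondecreasing_set_cvg_integral.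
  - apply/nondecreasing_seqP => n; apply/subsetPset => s /=; rewrite !in_itv /=.
    move=> /andP[h ->]; rewrite andbT; apply: le_lt_trans h.
    by rewrite /d ler_pM2l// lef_pV2 ?posrE// ler_nat.
  - by move=> n; exact: itvoc_measurable.
  - move=> n; apply: rearr_Meas_pos; first exact: itvoc_measurable.
    by apply: itvoc_pos; rewrite ltW.
  - by move=> n s _; exact: rearr_ge0.
have rnd : nondecreasing_seq r.
  move=> n p np; apply: (int_subset (itvoc_measurable _ _) (itvoc_measurable _ _)).
  - apply: rearr_Meas_pos; first exact: itvoc_measurable.
    by apply: itvoc_pos; rewrite ltW.
  - by move=> s _; exact: rearr_ge0.
  - move=> s /=; rewrite !in_itv /= => /andP[h ->]; rewrite andbT.
    apply: le_lt_trans h.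
    by rewrite /d ler_pM2l// lef_pV2 ?posrE// ler_nat.
set z := \int[mu]_(x in `]0%R, a]%classic) rearr L hF x in rcv.
have z0 : 0 <= z by apply: int_ge0 => s _; exact: rearr_ge0.
have ai0 : (0 <= a^-1)%R by rewrite invr_ge0 ltW.
apply: (@le_trans _ _ (N (fun s => cell F (a^-1%:E * z) s + hO s))).
  apply: N_le; [apply: pc|apply: pc|move=> s Is].
  - by rewrite mule_ge0.
  - by rewrite mule_ge0.
  apply: leeD => //; apply: lee_wpmul2l; first by rewrite lee_fin.
  apply: lee_wpmul2l => //; rewrite /z.
  (* A level set of the rearrangement is an initial interval whose length, the measure of the level
     set of [hF], is at most [a]. *)
  apply: (@le_integral_distribution _ T R mu I (`]0%R, a]%classic) hF (rearr L hF)
    (oitv_measurable _ _) (itvoc_measurable _ _) mhF _ hF0).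
  - apply: rearr_Meas_pos; first exact: itvoc_measurable.
    exact: itvoc_pos.
  - by move=> x _; exact: rearr_ge0.
  move=> l l0; have da := dF _ l0.
  rewrite (_ : _ (_ `&` _) = dist_fun L hF l); last by rewrite dist_nneg.
  have := cleb_oitv (dist_ge0 L hF l); rewrite sube0 => <-.
  apply: le_measure; rewrite ?inE.
  - exact: oitv_measurable.
  - apply: interval_measurable => x y /= [+ hx] [+ hy] t /andP[xt ty].
    rewrite !in_itv /= => /andP[x0 _] /andP[_ ya]; split.
      by rewrite (lt_le_trans x0 xt) (le_trans ty ya).
    by apply: lt_le_trans hy _; exact: rearr_anti.
  move=> x /andP[x0 xd]; split => /=; last by rewrite rearr_gt.
  by rewrite in_itv /= -lte_fin x0 -lee_fin (le_trans (ltW xd)).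
apply: (@N_fatou_le (fun n s => cell F (a^-1%:E * r n) s + hO s)).
- by move=> n; apply: pc; rewrite mule_ge0.
- by apply: pc; rewrite mule_ge0.
- move=> s Is n p np; apply: leeD => //; apply: lee_wpmul2l; first by rewrite lee_fin.
  by apply: lee_wpmul2l => //; exact: rnd.
- move=> s Is; case: (pselect (F s)) => Fs.
    under eq_fun do rewrite cell_in//; rewrite cell_in// hOF// adde0.
    by under eq_fun do rewrite adde0; apply: cvgeZl.
  under eq_fun do rewrite cell_out// add0e; rewrite cell_out// add0e.
  exact: cvg_cst.
- exact: main.
Qed.

End norm.
End riprops.

(** * Averaging over several cells and resonance *)

Section resonance.
Context {R : realType} (L : \bar R) (L0 : 0 < L).
Local Notation T := (lebesgueR R).
Local Notation mu := (@cleb R).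
Local Notation I := (oitv 0 L).
Implicit Types (f g h w : R -> \bar R).
#[local] Existing Instance ae_cleb_filter.

Lemma nd_cvge_mulr (u : nat -> \bar R) l y : nondecreasing_seq u ->
  (forall n, 0 <= u n) -> 0 <= y -> u n @[n --> \oo] --> l ->
  u n * y @[n --> \oo] --> l * y.
Proof.
move=> nd u0 + cv; case: y => [r|_|//]; first by move=> _; exact: cvgeZr.
have l0 : 0 <= l by apply: le_trans (u0 0%N) _; exact: nd_cvge_le nd cv.
move: (l0); rewrite le_eqVlt => /predU1P[lE|lp].
  have uE n : u n = 0.
    by apply/eqP; rewrite eq_le u0 andbT lE; exact: nd_cvge_le nd cv.
  by under eq_fun do rewrite uE mul0e; rewrite -lE mul0e; exact: cvg_cst.
rewrite gt0_muley//; apply: cvg_near_cst.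
have nb : nbhs l [set y | 0 < y].
  by apply: open_nbhs_nbhs; split => //; exact: open_ereal_gt_ereal.
have : \forall n \near \oo, 0 < u n by exact: (cv _ nb).
by apply: filterS => n h; rewrite gt0_muley.
Qed.

Lemma set1_measurable (a : R) : measurable ([set a] : set T).
Proof.
apply: interval_measurable => x y -> -> z /andP[az za].
by apply/eqP; rewrite eq_le za az.
Qed.

(** The mean is 0 when [mu F] is 0 or infinite, by the conventions for [fine] and for the inverse of
    0. *)
Definition average (F : set R) h : \bar R :=
  (fine (mu F))^-1%:E * \int[mu]_(s in F) h s.

Lemma average_ge0 (F : set T) h : F `<=` I -> nneg L h -> 0 <= average F h.
Proof.
move=> FI h0; rewrite mule_ge0//; first by rewrite lee_fin invr_ge0 fine_ge0.
by apply: int_ge0 => s /FI; exact: h0.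
Qed.

Lemma average_mulr (F : set T) h : measurable F -> F `<=` I -> mu F < +oo ->
  Meas L h -> nneg L h -> average F h * mu F = \int[mu]_(s in F) h s.
Proof.
move=> mF FI Ff mh h0; rewrite /average.
have Ffin : mu F \is a fin_num by rewrite ge0_fin_numE.
have mhF : measurable_fun F (h : T -> _).
  by apply: measurable_funS mh => //; exact: measI.
have [F0|F0] := eqVneq (fine (mu F)) 0%R.
  rewrite F0 invr0 mul0e mul0e.
  have muF0 : mu F = 0 by rewrite -(fineK Ffin) F0.
  apply/esym; rewrite (int_eq (g := fun s => `|h s|)); last first.
    by move=> s /FI Is; rewrite gee0_abs// h0.
  exact: integral_abs_eq0.
rewrite -[X in _ * X](fineK Ffin) muleC muleA -EFinM mulfV// mul1e//.
Qed.

Section iterate.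
Context (N : (R -> \bar R) -> \bar R) (hN : ri_norm L N).
Context (F : nat -> set T) (h : R -> \bar R).
Hypotheses (tF : trivIset setT F) (mF : forall i, measurable (F i)).
Hypotheses (FI : forall i, F i `<=` I) (Ff : forall i, mu (F i) < +oo).
Hypotheses (mh : Meas L h) (h0 : nneg L h).

Let U n : set T := \bigcup_(i in `I_n) F i.

Let mU n : measurable (U n).
Proof. by apply: bigcup_measurable => i _. Qed.

Let Meas_patch (A : set T) : measurable A -> Meas L (h \_ A).
Proof.
move=> mA; apply: (eq_measurable_fun (fun s : T => (\1_A s)%:E * h s)).
  move=> s _; rewrite /patch indicE; case: (pselect (A s)) => As.
    by rewrite mem_set// mul1e.
  by rewrite memNset// mul0e.
by apply: emeasurable_funM => //; exact: Meas_indic.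
Qed.

Let nneg_patch (A : set T) : nneg L (h \_ A).
Proof. by move=> s Is; rewrite /patch; case: ifP => // _; exact: h0. Qed.

Let a i := average (F i) h.
Let a0 i : 0 <= a i. Proof. exact: average_ge0. Qed.

(** Cells are averaged one at a time. The part of [h] outside the treated cells is carried along,
    because the next averaging acts on it. *)
Lemma N_step_rest n : N (fun s => step F a n s + (h \_ (~` U n)) s) <= N h.
Proof.
have pstep m : MeasPos L (step F a m).
  apply: nneg_MeasPos; first exact: step_Meas.
  by move=> s _; exact: step_ge0.
have ppatch (A : set T) : measurable A -> MeasPos L (h \_ A).
  by move=> mA; apply: nneg_MeasPos => //; exact: Meas_patch.
have mC m : measurable (~` U m) by exact: measurableC.
elim: n => [|n IH].
  rewrite (N_eq hN (g := h)) //.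
  - by apply: MeasPosD => //; exact: ppatch.
  - exact: nneg_MeasPos.
  move=> s _; rewrite /step big_ord0 add0e /patch mem_set//= => -[i /=].
  by rewrite ltn0.
apply: le_trans IH.
pose hF := h \_ (F n); pose hO s := step F a n s + (h \_ (~` U n.+1)) s.
have mhO : Meas L hO.
  by apply: emeasurable_funD; [exact: step_Meas|exact: Meas_patch].
have hO0 : nneg L hO.
  by move=> s Is; rewrite adde_ge0//; [exact: step_ge0|exact: nneg_patch].
have nFU m s : F n s -> (m <= n)%N -> ~ U m s.
  move=> Fs mn [i /= im Fi]; have := leq_trans im mn.
  by rewrite (tF Logic.I Logic.I (ex_intro _ s (conj Fi Fs))) ltnn.
have UnF s : ~ U n s -> ~ F n s -> ~ U n.+1 s.
  move=> nU nF [i /=]; rewrite ltnS leq_eqVlt => /predU1P[->//|ni Fi].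
  by apply: nU; exists i.
have U1 s : U n s -> U n.+1 s.
  by move=> [i /= ni Fi]; exists i => //=; exact: ltnW.
have H := N_average L0 hN (mF n) (@FI n) (Ff n) (Meas_patch (mF n)) (nneg_patch (F n))
  mhO hO0.
have E1 s : I s -> step F a n.+1 s + (h \_ (~` U n.+1)) s =
   cell (F n) ((fine (mu (F n)))^-1%:E * \int[mu]_(x in I) hF x) s + hO s.
  move=> _; have aE : a n = (fine (mu (F n)))^-1%:E * \int[mu]_(x in I) hF x.
    by rewrite /a /average /hF -integral_mkcondr (setIidr (@FI n)).
  by rewrite stepS aE -addeA addeCA.
have E2 s : I s -> step F a n s + (h \_ (~` U n)) s = hF s + hO s.
  move=> _; rewrite /hO addeCA; congr (_ + _).
  rewrite /hF /patch; have [Fs|nF] := pselect (F n s).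
    have nU : ~ U n s by exact: nFU Fs (leqnn n).
    rewrite (mem_set Fs) mem_set// memNset ?adde0//= => nU1; apply: nU1.
    by exists n => /=.
  rewrite (memNset nF) add0e; have [Us|nU] := pselect (U n s).
    have E m : U m s -> (s \in ~` U m) = false.
      by move=> Um; apply: memNset => /=; apply.
    by rewrite (E _ Us) (E _ (U1 _ Us)).
  by rewrite !mem_set//; exact: UnF.
rewrite (N_eq hN _ _ E1); last 2 first.
- by apply: MeasPosD; [exact: pstep|exact: ppatch].
- apply: MeasPosD; last exact: nneg_MeasPos.
  apply: nneg_MeasPos; first exact: cell_Meas.
  move=> s _; apply: cell_ge0; rewrite mule_ge0//.
    by rewrite lee_fin invr_ge0 fine_ge0.
  by apply: int_ge0 => x; exact: nneg_patch.
rewrite [leRHS](N_eq hN _ _ E2); last 2 first.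
- by apply: MeasPosD; [exact: pstep|exact: ppatch].
- by apply: MeasPosD; [exact: ppatch|exact: nneg_MeasPos].
apply: H.
- move=> s Fs; rewrite /hO step_out; last first.
    by move=> i ni Fi; apply: (nFU n s Fs (leqnn n)); exists i.
  by rewrite add0e /patch memNset//= => nU; apply: nU; exists n => /=.
- by move=> s nF; rewrite /hF /patch memNset.
Qed.

Lemma N_step_average n : N (step F a n) <= N h.
Proof.
apply: le_trans (N_step_rest n).
have mC : measurable (~` U n) by exact: measurableC.
have ps : MeasPos L (step F a n).
  apply: nneg_MeasPos; first exact: step_Meas.
  by move=> s _; exact: step_ge0.
have pp : MeasPos L (h \_ (~` U n)).
  by apply: nneg_MeasPos => //; exact: Meas_patch.
apply: (N_le hN ps); first exact: MeasPosD.
by move=> s Is; rewrite leeDl//; exact: nneg_patch.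
Qed.

End iterate.

Section chain.
Context (N : (R -> \bar R) -> \bar R) (hN : ri_norm L N).
Context (B : nat -> set T) (h : R -> \bar R).
Hypotheses (mB : forall i, measurable (B i)) (ndB : nondecreasing_seq B).
Hypotheses (BI : forall i, B i `<=` I) (Bf : forall i, mu (B i) < +oo).
Hypotheses (B0 : B 0%N = set0) (ph : MeasPos L h).

Let k := rearr L h.
Let b i := fine (mu (B i)).
Let bE i : mu (B i) = (b i)%:E.
Proof. by rewrite /b fineK// ge0_fin_numE. Qed.
Let J i : set T := oitv (b i)%:E (b i.+1)%:E.
Let D i : set T := B i.+1 `\` B i.
Let v i := average (J i) k.

Let subB i j : (i <= j)%N -> B i `<=` B j.
Proof. by move=> ij; apply/subsetPset; exact: ndB. Qed.

Let leb i j : (i <= j)%N -> (b i <= b j)%R.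
Proof.
move=> ij; rewrite -lee_fin -!bE; apply: le_measure; rewrite ?inE//.
exact: subB.
Qed.

Let b0 i : (0 <= b i)%R. Proof. by rewrite -lee_fin -bE measure_ge0. Qed.

Let bL i : (b i)%:E <= L.
Proof.
rewrite -bE -(mu_I L0); apply: le_measure; rewrite ?inE//; exact: measI.
Qed.

Let mJ i : measurable (J i). Proof. exact: oitv_measurable. Qed.
Let mD i : measurable (D i). Proof. exact: measurableD. Qed.
Let JI i : J i `<=` I.
Proof.
move=> s /andP[bs sb]; apply/andP; split; last exact: lt_le_trans sb (bL _).
by apply: le_lt_trans bs; rewrite lee_fin.
Qed.
Let DI i : D i `<=` I. Proof. by move=> s [/BI]. Qed.

Let muJ i : mu (J i) = (b i.+1 - b i)%:E.
Proof. by rewrite cleb_oitv ?EFinB// lee_fin leb. Qed.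

Let muD i : mu (D i) = (b i.+1 - b i)%:E.
Proof.
rewrite EFinB -!bE [LHS]measureD//; last exact: Bf.
by rewrite (_ : B i.+1 `&` B i = B i)//; apply/setIidPr; exact: subB.
Qed.

Let tJ : trivIset setT J.
Proof.
apply: ltn_trivIset => i j ij; apply/seteqP; split => s //= [/andP[_ sb] /andP[bs _]].
by have := lt_trans bs sb; rewrite lte_fin ltNge leb.
Qed.

Let tD : trivIset setT D.
Proof.
apply: ltn_trivIset => i j ij; apply/seteqP; split => s //= [[Bj _] [_ nB]].
by apply: nB; exact: subB Bj.
Qed.

Let mk : Meas L k. Proof. exact: rearr_Meas. Qed.
Let k0 : nneg L k. Proof. exact: rearr_nneg. Qed.
Let v0 i : 0 <= v i. Proof. exact: average_ge0. Qed.

Lemma chain_nneg n s : 0 <= step D v n s. Proof. exact: step_ge0. Qed.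

Lemma chain_Meas n : Meas L (step D v n). Proof. exact: step_Meas. Qed.

(** [D i] and [J i] have the same measure, so the step function is equimeasurable with the one that
    averages the rearrangement of [h] over the intervals [J i], and averaging does not increase the
    norm. *)
Lemma N_chain n : N (step D v n) <= N h.
Proof.
rewrite -(N_rearr L0 hN ph); apply: le_trans (N_step_average hN tJ mJ JI _ mk k0 n).
  apply: (N_le_dist L0 hN).
  - by apply: nneg_MeasPos; [exact: chain_Meas|move=> s _; exact: chain_nneg].
  - by apply: nneg_MeasPos; [exact: step_Meas|move=> s _; exact: step_ge0].
  move=> l l0; rewrite !dist_step//.
  by apply: lee_sum => i _; rewrite muD muJ.
by move=> i; rewrite muJ ltry.
Qed.

(** By the choice of the mean, the step function has the same integral over [D j] as the
    rearrangement over [J j]; these intervals fill [(0, b j)] up to finitely many points. *)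
Lemma integral_chain n j : (j <= n)%N ->
  \int[mu]_(s in oitv 0 (b j)%:E) k s <= \int[mu]_(s in B j) step D v n s.
Proof.
have mE (E : set T) g : measurable E -> E `<=` I -> Meas L g ->
    measurable_fun E (g : T -> _).
  by move=> ? ? mg; apply: measurable_funS mg => //; exact: measI.
elim: j => [|j IH] jn.
  have -> : b 0 = 0%R by rewrite /b B0 measure0.
  rewrite (_ : oitv 0 0 = set0) ?integral_set0.
    by apply: int_ge0 => s _; exact: chain_nneg.
  by apply/seteqP; split => s //= /andP[h1 h2]; have := lt_trans h1 h2; rewrite ltxx.
have -> : \int[mu]_(s in B j.+1) step D v n s =
    \int[mu]_(s in B j) step D v n s + \int[mu]_(s in D j) step D v n s.
  have BE : B j.+1 = B j `|` D j by rewrite /D setDUK//; exact: subB.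
  rewrite {1}BE ge0_integral_setU//.
  - by rewrite -BE; apply: mE => //; exact: chain_Meas.
  - by move=> s _; exact: chain_nneg.
  - by rewrite disj_set2E; apply/eqP; rewrite /D setDE setICA setICr setI0.
have -> : \int[mu]_(s in D j) step D v n s = \int[mu]_(s in J j) k s.
  rewrite (int_eq (g := fun _ => v j)); last first.
    by move=> s Ds; rewrite (step_in v tD jn Ds).
  rewrite int_cst// muD -muJ; apply: average_mulr => //.
  by rewrite muJ ltry.
apply: le_trans (leeD (IH (ltnW jn)) (lexx _)).
pose K := oitv 0 (b j.+1)%:E.
have mK : measurable (K : set T) by exact: oitv_measurable.
have KI : K `<=` I.
  by move=> s /andP[s0 sb]; apply/andP; split => //; exact: lt_le_trans sb (bL _).
rewrite (@ge0_negligible_integral _ T R mu K [set b j])//; last 4 first.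
- exact: (set1_measurable (b j)).
- exact: mE.
- by move=> s _; exact: rearr_ge0.
- exact: cleb_set1.
have m1 : measurable (oitv 0 (b j)%:E : set T) by exact: oitv_measurable.
have UK : oitv 0 (b j)%:E `|` J j `<=` K.
  move=> s [|] /andP[h1 h2]; apply/andP; split => //.
    by apply: lt_le_trans h2 _; rewrite lee_fin leb.
  by apply: le_lt_trans h1; rewrite lee_fin.
have mU : measurable (oitv 0 (b j)%:E `|` J j : set T) by exact: measurableU.
rewrite -ge0_integral_setU//.
- apply: int_subset => //.
  + apply: measurableD => //.
    exact: (set1_measurable (b j)).
  + by apply: mE => //; apply: subset_trans UK KI.
  + by move=> s _; exact: rearr_ge0.
  move=> s [/andP[s0 sb] /= sn]; case: (ltgtP s (b j)) => sj.
  + by left; apply/andP; rewrite lte_fin.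
  + by right; apply/andP; rewrite lte_fin.
  + by case: sn.
- by apply: mE => //; apply: subset_trans UK KI.
- by move=> s _; exact: rearr_ge0.
- rewrite disj_set2E; apply/eqP/seteqP; split => s //= [/andP[_ h1] /andP[h2 _]].
  by have := lt_trans h1 h2; rewrite ltxx.
Qed.

End chain.

Section assoc.
Context (N : (R -> \bar R) -> \bar R) (hN : ri_norm L N).

Lemma assoc_le f g : MeasPos L f -> MeasPos L g ->
  (\forall s \ae mu, I s -> f s <= g s) -> assoc_norm L N f <= assoc_norm L N g.
Proof.
move=> pf pg fg; apply: ge_ereal_sup => _ [h [ph Nh] <-].
apply: (@le_trans _ _ (\int[mu]_(s in I) (g s * h s))); last first.
  by apply: ereal_sup_ubound; exists h.
rewrite integral_abs_mul// [leRHS]integral_abs_mul//.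
have mm f' : MeasPos L f' -> Meas L (fun s => `|f' s| * `|h s|).
  by move=> [mf' _]; apply: emeasurable_funM; apply: Meas_abs => //; exact: ph.1.
apply: (@ae_ge0_le_integral _ T R mu I (oitv_measurable _ _) _ _ _ (mm _ pf) _ (mm _ pg)).
- by move=> s _; rewrite mule_ge0.
- by move=> s _; rewrite mule_ge0.
move: (ae_nneg pf) (ae_nneg pg) fg; rewrite /ae_eq; apply: filterS3 => s fE gE h' Is.
by apply: lee_wpmul2r => //; rewrite -(fE Is) -(gE Is); exact: h'.
Qed.

Lemma assoc_ubound f h : MeasPos L h -> N h <= 1 ->
  \int[mu]_(s in I) (f s * h s) <= assoc_norm L N f.
Proof. by move=> ph Nh; apply: ereal_sup_ubound; exists h. Qed.

Let layer_rearr f h n : Meas L f -> nneg L f -> MeasPos L h -> N h <= 1 ->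
  (forall l : R, (0 < l)%R -> mu (I `&` [set s | l%:E < f s]) < +oo) ->
  \int[mu]_(s in I) ((layer n (rearr L f s))%:E * rearr L h s) <= assoc_norm L N f.
Proof.
move=> mf f0 ph Nh fin.
set m := (n * 2 ^ n)%N.
have d0 : (0 < 2 ^- n :> R)%R by rewrite invr_gt0 exprn_gt0.
(* Level sets in increasing order, after an empty one: for [i < m], [B (m - i)] is the set where [f]
   exceeds [(i + 1) 2^-n]. *)
pose B (j : nat) : set T := if j == 0%N then set0
  else I `&` [set s | ((m - j).+1%:R * 2 ^- n)%:E < f s].
have lp j : (0 < (m - j).+1%:R * 2 ^- n :> R)%R by rewrite mulr_gt0// ltr0n.
have mB j : measurable (B j) by rewrite /B; case: ifP => // _; exact: Meas_gt.
have BI j : B j `<=` I by rewrite /B; case: ifP => _ s // [].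
have Bf j : mu (B j) < +oo.
  by rewrite /B; case: ifP => _; [rewrite measure0|exact: fin].
have ndB : nondecreasing_seq B.
  move=> i j ij; apply/subsetPset; rewrite /B; case: ifP => [_ s []|i0].
  case: ifP => j0; first by move: ij; rewrite (eqP j0) leqn0 i0.
  move=> s [Is /= h']; split => //=; apply: le_lt_trans h'.
  by rewrite lee_fin ler_pM2r// ler_nat ltnS leq_sub2l.
have B0 : B 0%N = set0 by rewrite /B.
pose h' := step (fun i => B i.+1 `\` B i) (fun i => average
  (oitv (fine (mu (B i)))%:E (fine (mu (B i.+1)))%:E) (rearr L h)) m.
have mh' : Meas L h' by exact: chain_Meas.
have h'0 s : 0 <= h' s by apply: chain_nneg.
have Nh' : N h' <= 1 by apply: le_trans Nh; exact: N_chain.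
have ph' : MeasPos L h' by apply: nneg_MeasPos => // s _; exact: h'0.
apply: le_trans (assoc_ubound f ph' Nh').
apply: (@le_trans _ _ (\int[mu]_(s in I) ((layer n (f s))%:E * h' s))); last first.
  apply: (int_le (oitv_measurable _ _)).
  - by apply: emeasurable_funM => //; apply: measurable_layer => //; exact: oitv_measurable.
  - exact: emeasurable_funM.
  - by move=> s Is; rewrite mule_ge0// lee_fin layer_ge0.
  - by move=> s Is; apply: lee_wpmul2r => //; apply: layer_le; exact: f0.
rewrite (integral_layer mu n (oitv_measurable _ _) (rearr_Meas f) (rearr_Meas h)); last first.
  by move=> s _; exact: rearr_ge0.
rewrite (integral_layer mu n (oitv_measurable _ _) mf mh'); last by move=> s _; exact: h'0.
apply: lee_sum => i _; apply: lee_wpmul2l; first by rewrite lee_fin ltW.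
have im : (i < m)%N := ltn_ord i.
have H := integral_chain h mB ndB BI Bf B0 (leq_subr i m).
pose z := I `&` [set s | (i.+1%:R * 2 ^- n)%:E < f s].
have BE : B (m - i)%N = z.
  by rewrite /B subKn ?(ltnW im)// ifN// -lt0n subn_gt0.
rewrite BE in H.
have E : I `&` [set s | (i.+1%:R * 2 ^- n)%:E < rearr L f s] =
    oitv 0 (fine (mu z))%:E.
  have l0 : (0 < i.+1%:R * 2 ^- n :> R)%R by rewrite mulr_gt0// ltr0n.
  rewrite fineK; last by rewrite ge0_fin_numE// fin.
  have dE : dist_fun L f (i.+1%:R * 2 ^- n) = mu z by rewrite dist_nneg.
  apply/seteqP; split => s /=.
    by move=> [/andP[s0 _]]; rewrite rearr_gt// dE => h''; apply/andP.
  move=> /andP[s0 h'']; rewrite rearr_gt// dE; split => //.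
  apply/andP; split => //; apply: lt_le_trans h'' _.
  by rewrite -dE; exact: dist_le_L.
by rewrite E.
Qed.

Let nneg_finite f h : Meas L f -> nneg L f -> MeasPos L h -> N h <= 1 ->
  (forall l : R, (0 < l)%R -> mu (I `&` [set s | l%:E < f s]) < +oo) ->
  \int[mu]_(s in I) (rearr L f s * rearr L h s) <= assoc_norm L N f.
Proof.
move=> mf f0 ph Nh fin.
have cv : \int[mu]_(s in I) ((layer n (rearr L f s))%:E * rearr L h s) @[n --> \oo] -->
    \int[mu]_(s in I) (rearr L f s * rearr L h s).
  apply: int_cvg.
  - exact: oitv_measurable.
  - move=> n; apply: emeasurable_funM; last exact: rearr_Meas.
    by apply: measurable_layer; [exact: oitv_measurable|exact: rearr_Meas].
  - by move=> n s _; rewrite mule_ge0 ?rearr_ge0// lee_fin layer_ge0.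
  - move=> s _ m n mn; apply: lee_wpmul2r; first exact: rearr_ge0.
    by rewrite lee_fin layer_nd.
  - by move=> s _; apply: layer_mul_cvg; exact: rearr_ge0.
apply: (cvge_ub cv) => n; exact: layer_rearr.
Qed.

(* For a simple [f] with level sets [B 1 <= B 2 <= ...], the test function is,
   on [B (i + 1) - B i], the mean of the rearrangement of [h] over
   [(mu (B i), mu (B (i + 1)))]. *)
Lemma resonance f h : MeasPos L f -> MeasPos L h -> N h <= 1 ->
  \int[mu]_(s in I) (rearr L f s * rearr L h s) <= assoc_norm L N f.
Proof.
move=> pf ph Nh; have [mf _] := pf.
(* Cutting off at [n] gives all superlevel sets at positive levels finite measure. *)
pose fk (n : nat) s := (\1_(oitv 0 n%:R%:E) s)%:E * `|f s|.
have mfk n : Meas L (fk n).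
  by apply: emeasurable_funM; [apply: Meas_indic; exact: oitv_measurable|exact: Meas_abs].
have fk0 n : nneg L (fk n) by move=> s _; rewrite mule_ge0// lee_fin.
have pfk n : MeasPos L (fk n) by exact: nneg_MeasPos.
have pa := MeasPos_abs mf.
have fkin n s : I s -> (s < n%:R)%R -> fk n s = `|f s|.
  move=> /andP[s0 _] sn; rewrite /fk indicE mem_set ?mul1e//.
  by apply/andP; rewrite lte_fin.
have fkout n s : ~ (s < n%:R)%R -> fk n s = 0.
  by move=> sn; rewrite /fk indicE memNset ?mul0e// => /andP[_]; rewrite lte_fin.
have fknd s : I s -> nondecreasing_seq (fk ^~ s).
  move=> Is m n mn; case: (pselect (s < m%:R)%R) => sm; last first.
    by rewrite (fkout m)// fk0.
  by rewrite !fkin// (lt_le_trans sm)// ler_nat.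
have fkcv s : I s -> fk n s @[n --> \oo] --> `|f s|.
  move=> Is; apply: cvg_near_cst.
  exists (Num.truncn s).+1 => // n /= sn; apply: fkin => //.
  by apply: lt_le_trans (truncnS_gt s) _; rewrite ler_nat.
have rcv t : nondecreasing_seq (fun n => rearr L (fk n) t) /\
    rearr L (fk n) t @[n --> \oo] --> rearr L f t.
  rewrite -rearr_abs; apply: rearr_cvg => //.
  by apply: aeW => s Is; split; [exact: fknd|exact: fkcv].
have cv : \int[mu]_(s in I) (rearr L (fk n) s * rearr L h s) @[n --> \oo] -->
    \int[mu]_(s in I) (rearr L f s * rearr L h s).
  apply: int_cvg.
  - exact: oitv_measurable.
  - by move=> n; apply: emeasurable_funM; exact: rearr_Meas.
  - by move=> n s _; rewrite mule_ge0 ?rearr_ge0.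
  - move=> s _ m n mn; apply: lee_wpmul2r; first exact: rearr_ge0.
    exact: (rcv s).1.
  - move=> s _; apply: nd_cvge_mulr; [exact: (rcv s).1| |exact: rearr_ge0|exact: (rcv s).2].
    by move=> n; exact: rearr_ge0.
apply: (cvge_ub cv) => n.
apply: (@le_trans _ _ (assoc_norm L N (fk n))).
  apply: nneg_finite => // l l0.
  apply: (@le_lt_trans _ _ (mu (oitv 0 n%:R%:E))).
    apply: le_measure; rewrite ?inE; [exact: Meas_gt|exact: oitv_measurable|].
    move=> s [/andP[s0 _] /= h']; apply/andP; split => //.
    rewrite ltNge; apply/negP => ns; move: h'.
    rewrite fkout; first by rewrite lte_fin ltNge ltW.
    by apply/negP; rewrite -leNgt -lee_fin.
  by rewrite cleb_oitv ?lee_fin// sube0 ltry.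
apply: assoc_le => //.
have := ae_nneg pf; rewrite /ae_eq; apply: filterS => s fE Is; rewrite (fE Is).
case: (pselect (s < n%:R)%R) => sn; first by rewrite fkin.
by rewrite fkout.
Qed.

End assoc.

End resonance.

(** * Associate norms and the Lorentz-Luxemburg theorem *)

Section associate.
Context {R : realType} (L : \bar R) (L0 : 0 < L).
Local Notation T := (lebesgueR R).
Local Notation mu := (@cleb R).
Local Notation I := (oitv 0 L).
Implicit Types (f g h w : R -> \bar R).
#[local] Existing Instance ae_cleb_filter.

Let mI : measurable (I : set T) := oitv_measurable _ _.

Lemma Meas_absM f g : Meas L f -> Meas L g -> Meas L (fun s => `|f s| * `|g s|).
Proof. by move=> mf mg; apply: emeasurable_funM; exact: Meas_abs. Qed.

Lemma pairing_scaler (c : R) f g : (0 <= c)%R -> MeasPos L f -> MeasPos L g ->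
  \int[mu]_(s in I) (f s * (c%:E * g s)) = c%:E * \int[mu]_(s in I) (f s * g s).
Proof.
move=> c0 pf pg; rewrite integral_abs_mul//; last exact: MeasPosZ.
rewrite (integral_abs_mul pf pg) -int_scale.
- apply: int_eq => s _; rewrite abseM (gee0_abs (x := c%:E)) ?lee_fin//.
  by rewrite muleCA.
- exact: mI.
- by apply: Meas_absM; [exact: pf.1|exact: pg.1].
- by move=> s _; rewrite mule_ge0.
- by rewrite lee_fin.
Qed.

Lemma pairingC f g : \int[mu]_(s in I) (f s * g s) = \int[mu]_(s in I) (g s * f s).
Proof. by apply: int_eq => s _; rewrite muleC. Qed.

Lemma pairingDl f g h : MeasPos L f -> MeasPos L g -> MeasPos L h ->
  \int[mu]_(s in I) ((f s + g s) * h s) =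
  \int[mu]_(s in I) (f s * h s) + \int[mu]_(s in I) (g s * h s).
Proof.
move=> pf pg ph; rewrite (integral_abs_mul pf ph) (integral_abs_mul pg ph).
have [mf _] := pf; have [mg _] := pg; have [mh _] := ph.
rewrite -(int_add mI (Meas_absM mf mh) (Meas_absM mg mh)); last 2 first.
- by move=> s _; rewrite mule_ge0.
- by move=> s _; rewrite mule_ge0.
apply: int_ae_eq.
- exact: mI.
- exact: (emeasurable_funM (emeasurable_funD mf mg) mh).
- by apply: emeasurable_funD; exact: Meas_absM.
move: (ae_nneg pf) (ae_nneg pg) (ae_nneg ph); rewrite /ae_eq; apply: filterS3.
move=> s fE gE hE Is; rewrite -ge0_muleDl// -(hE Is); congr (_ * _).
by rewrite {1}(fE Is) {1}(gE Is).
Qed.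

Lemma pairing_indic (E : set T) g : measurable E -> E `<=` I ->
  \int[mu]_(s in I) ((\1_E s)%:E * g s) = \int[mu]_(s in E) g s.
Proof.
move=> mE EI; rewrite -[in RHS](setIidr EI) integral_mkcondr.
apply: int_eq => s _; rewrite /patch indicE; case: (pselect (E s)) => Es.
  by rewrite mem_set// mul1e.
by rewrite memNset// mul0e.
Qed.

Lemma pairing_ae0 f g : MeasPos L f -> MeasPos L g ->
  (\forall s \ae mu, I s -> f s = 0) -> \int[mu]_(s in I) (f s * g s) = 0.
Proof.
move=> pf pg f0; have := @integral0 _ T R mu I; apply: etrans.
apply: (int_ae_eq mI (emeasurable_funM pf.1 pg.1)); first exact: measurable_cst.
by move: f0; rewrite /ae_eq; apply: filterS => s h Is; rewrite h// mul0e.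
Qed.

(** Monotone convergence, applied after the integrands are set to 0 on the exceptional null set,
    where neither sign nor monotonicity is known. *)
Lemma pairing_cvg (fk : nat -> R -> \bar R) f g :
  (forall k, MeasPos L (fk k)) -> MeasPos L f -> MeasPos L g ->
  (\forall s \ae mu, I s ->
     nondecreasing_seq (fun k => fk k s) /\ fk k s @[k --> \oo] --> f s) ->
  \int[mu]_(s in I) (fk k s * g s) @[k --> \oo] --> \int[mu]_(s in I) (f s * g s).
Proof.
move=> pk pf pg ae.
have aek : \forall s \ae mu, forall k, I s -> fk k s = `|fk k s|.
  by apply/ae_foralln => k; exact: ae_nneg.
have : \forall s \ae mu, I s -> [/\ nondecreasing_seq (fun k => fk k s),
    fk k s @[k --> \oo] --> f s, (forall k, fk k s = `|fk k s|), f s = `|f s| &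
    g s = `|g s|].
  have aefg : \forall s \ae mu, I s -> f s = `|f s| /\ g s = `|g s|.
    move: (ae_nneg pf) (ae_nneg pg); rewrite /ae_eq; apply: filterS2 => s fE gE Is.
    by split; [exact: fE|exact: gE].
  move: ae aek aefg; apply: filterS3 => s h1 h2 h3 Is.
  have [nd cv] := h1 Is; have [e1 e2] := h3 Is.
  by split => // k; exact: h2.
move=> [A [mA A0 sub]].
have good s : I s -> ~ A s -> [/\ nondecreasing_seq (fun k => fk k s),
    fk k s @[k --> \oo] --> f s, (forall k, fk k s = `|fk k s|), f s = `|f s| &
    g s = `|g s|].
  by move=> Is As; apply: contrapT => h'; apply: As; apply: sub => /= /(_ Is).
pose cut (h : R -> \bar R) (s : R) := (\1_(~` A) s)%:E * h s.
have cutin h s : ~ A s -> cut h s = h s.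
  by move=> As; rewrite /cut indicE mem_set// mul1e.
have cutout h s : A s -> cut h s = 0.
  by move=> As; rewrite /cut indicE memNset ?mul0e//=; apply.
have mcut h : Meas L h -> Meas L (cut h).
  move=> mh; have mi : Meas L (fun s => (\1_(~` A) s)%:E).
    by apply: Meas_indic; exact: measurableC.
  by apply: (emeasurable_funM mi); exact: mh.
have cutE h : MeasPos L h ->
    \int[mu]_(s in I) (h s * g s) = \int[mu]_(s in I) (cut (fun x => h x * g x) s).
  move=> [mh _]; apply: int_ae_eq.
  - exact: mI.
  - exact: (emeasurable_funM mh pg.1).
  - exact: (mcut _ (emeasurable_funM mh pg.1)).
  exists A; split => // s /= /not_implyP[Is ne]; apply: contrapT => As; apply: ne.
  by rewrite cutin.
rewrite (cutE _ pf); under eq_cvg do rewrite (cutE _ (pk _)).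
apply: int_cvg.
- exact: mI.
- by move=> k; apply: mcut; apply: emeasurable_funM; [exact: (pk k).1|exact: pg.1].
- move=> k s Is; case: (pselect (A s)) => As; first by rewrite cutout.
  by have [_ _ h1 _ h2] := good _ Is As; rewrite cutin// h1 h2 mule_ge0.
- move=> s Is m n mn; case: (pselect (A s)) => As; first by rewrite !cutout.
  have [nd _ _ _ h2] := good _ Is As; rewrite !cutin//.
  by apply: lee_wpmul2r; [rewrite h2|exact: nd].
- move=> s Is; case: (pselect (A s)) => As.
    rewrite cutout//; apply: cvg_near_cst; apply: nearW => n; exact: cutout.
  have [nd cv h1 _ h2] := good _ Is As; rewrite cutin//.
  under eq_cvg do rewrite cutin//.
  apply: nd_cvge_mulr => //; last by rewrite h2.
  by move=> n; rewrite h1.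
Qed.

(** The local bound makes the integral of [f] vanish over the part of (0, L) below each [n], so
    definiteness follows from it. [N] is any functional here, to serve both the associate norm and
    [targetDual]. *)
Lemma local_ae0 (N : (R -> \bar R) -> \bar R) f :
  (forall E : set T, measurable E -> E `<=` I -> mu E < +oo ->
    exists2 C : R, (0 < C)%R &
      forall f, MeasPos L f -> \int[mu]_(s in E) f s <= C%:E * N f) ->
  MeasPos L f -> N f = 0 -> \forall s \ae mu, I s -> f s = 0.
Proof.
move=> loc pf f0.
pose E (n : nat) : set T := I `&` oitv 0 n%:R%:E.
have mE n : measurable (E n) by apply: measurableI; exact: oitv_measurable.
have EI n : E n `<=` I by exact: subIsetl.
have Ef n : mu (E n) < +oo.
  apply: (@le_lt_trans _ _ (mu (oitv 0 n%:R%:E))).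
    by apply: measureIr; exact: oitv_measurable.
  by rewrite cleb_oitv ?lee_fin// sube0 ltry.
have z n : \forall s \ae mu, E n s -> f s = 0.
  have [C C0 H] := loc (E n) (mE n) (EI n) (Ef n).
  have mEf : measurable_fun (E n) (f : T -> _).
    by apply: measurable_funS pf.1 => //; exact: EI.
  apply/(ae_eq_integral_abs mu (mE n) mEf).
  apply/eqP; rewrite eq_le; apply/andP; split; last by apply: int_ge0.
  rewrite -(mule0 C%:E) -f0; apply: le_trans (H f pf).
  rewrite le_eqVlt; apply/orP; left; apply/eqP; apply: (int_ae_eq (mE n)).
  - by apply: measurableT_comp mEf; exact: abse_measurable.
  - exact: mEf.
  - by have := ae_nneg pf; rewrite /ae_eq; apply: filterS => s fE /EI Is; rewrite -fE.
have : \forall s \ae mu, forall n, E n s -> f s = 0 by apply/ae_foralln.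
apply: filterS => s h Is; apply: (h (Num.truncn s).+1); split => //.
move/andP: (Is) => [s0 _]; apply/andP; split => //.
by rewrite lte_fin truncnS_gt.
Qed.

(** * The associate norm is a rearrangement-invariant norm *)

Section assoc_ri.
Context (N : (R -> \bar R) -> \bar R) (hN : ri_norm L N).

Lemma assoc_ge0 f : 0 <= assoc_norm L N f.
Proof.
have N1 : N (fun _ => 0) <= 1 by rewrite (N0 hN).
apply: le_trans (@assoc_ubound _ L N f _ (MeasPos0 L) N1).
by apply: int_ge0 => s _; rewrite mule0.
Qed.

Lemma holder_assoc (C : R) f g : (0 < C)%R -> MeasPos L f -> MeasPos L g ->
  N g <= C%:E -> \int[mu]_(s in I) (f s * g s) <= C%:E * assoc_norm L N f.
Proof.
move=> C0 pf pg Ng.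
have c0 : (0 <= C^-1)%R by rewrite invr_ge0 ltW.
have := @assoc_ubound _ L N f _ (MeasPosZ c0 pg).
rewrite (ri_scale hN)// pairing_scaler// => H.
rewrite -lee_pdivrMl//; apply: H.
by rewrite -[leRHS](_ : C^-1%:E * C%:E = 1) ?lee_pmul2l ?lte_fin ?invr_gt0//;
  rewrite -EFinM mulVf// gt_eqF.
Qed.

(** The easy half of the Lorentz-Luxemburg theorem: the second associate norm is at most [N]. *)
Lemma le_pairing_norm f g : MeasPos L f -> MeasPos L g ->
  assoc_norm L N g <= 1 -> \int[mu]_(s in I) (f s * g s) <= N f.
Proof.
move=> pf pg Ng.
have [Nf|Nf] := eqVneq (N f) +oo; first by rewrite Nf leey.
have Nf0 := ri_ge0 hN pf.
have [Nf1|Nf1] := eqVneq (N f) 0.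
  have /(ri_eq0 hN pf) f0 := Nf1.
  by rewrite Nf1 (pairing_ae0 pf pg f0).
have [c cE c0] : exists2 c : R, N f = c%:E & (0 < c)%R.
  exists (fine (N f)); first by rewrite fineK// ge0_fin_numE// ltey.
  by rewrite fine_gt0// lt_neqAle eq_sym Nf1 Nf0 ltey.
have := @holder_assoc c g f c0 pg pf; rewrite cE lexx pairingC => /(_ isT) H.
apply: le_trans H _; rewrite -[leRHS]mule1; apply: lee_wpmul2l => //.
by rewrite lee_fin ltW.
Qed.

Lemma assoc_scale_le f (c : R) : MeasPos L f -> (0 <= c)%R ->
  assoc_norm L N (fun s => c%:E * f s) <= c%:E * assoc_norm L N f.
Proof.
move=> pf c0; apply: ge_ereal_sup => _ [g [pg Ng] <-].
rewrite pairingC pairing_scaler// pairingC.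
by apply: lee_wpmul2l; [rewrite lee_fin|exact: assoc_ubound].
Qed.

Lemma assoc_scale f (c : R) : MeasPos L f -> (0 <= c)%R ->
  assoc_norm L N (fun s => c%:E * f s) = c%:E * assoc_norm L N f.
Proof.
move=> pf c0; apply/eqP; rewrite eq_le assoc_scale_le//=.
have [<-|cn] := eqVneq 0%R c; first by rewrite mul0e assoc_ge0.
have cp : (0 < c)%R by rewrite lt_neqAle cn.
have -> : assoc_norm L N f = assoc_norm L N (fun s => c^-1%:E * (c%:E * f s)).
  by congr (assoc_norm L N _); apply/funext => s; rewrite muleA -EFinM mulVf ?mul1e// gt_eqF.
rewrite -lee_pdivlMl//; apply: assoc_scale_le; first exact: MeasPosZ.
by rewrite invr_ge0 ltW.
Qed.

Lemma assoc_local (E : set T) : measurable E -> E `<=` I -> mu E < +oo ->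
  exists2 C : R, (0 < C)%R &
    forall f, MeasPos L f -> \int[mu]_(s in E) f s <= C%:E * assoc_norm L N f.
Proof.
move=> mE EI Ef; have pE := MeasPos_indic L mE.
have NE0 := ri_ge0 hN pE; have NE := ri_indic hN mE EI Ef.
have c0 : (0 <= fine (N (fun s => (\1_E s)%:E)))%R by rewrite fine_ge0.
(* The constant of Hoelder's inequality with the indicator of [E]; the added 1 keeps it positive
   when [E] is null. *)
exists (fine (N (fun s => (\1_E s)%:E)) + 1)%R; first by rewrite ltr_wpDl.
move=> f pf; rewrite -pairing_indic// pairingC; apply: holder_assoc => //.
  by rewrite ltr_wpDl.
by rewrite EFinD fineK ?ge0_fin_numE// leeDl.
Qed.

(** Hardy-Littlewood passes to rearrangements, which agree for [f] and [g]; [resonance] returns to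
    the associate norm of [g]. *)
Lemma assoc_equi_le f g : MeasPos L f -> MeasPos L g -> equimeasurable L f g ->
  assoc_norm L N f <= assoc_norm L N g.
Proof.
move=> pf pg fg; apply: ge_ereal_sup => _ [h [ph Nh] <-].
apply: le_trans (hardy_littlewood L0 pf ph) _.
rewrite (int_eq (g := fun s => rearr L g s * rearr L h s)); first exact: (resonance L0).
move=> s _; congr (_ * _); apply/eqP; rewrite eq_le; apply/andP.
by split; apply: le_rearr; try exact: pf.1; try exact: pg.1; move=> l l0; rewrite fg.
Qed.

Lemma assoc_ri : ri_norm L (assoc_norm L N).
Proof.
constructor.
- by move=> f _; exact: assoc_ge0.
- move=> f pf; split => [f0|f0].
    exact: (local_ae0 assoc_local pf f0).
  apply/eqP; rewrite eq_le assoc_ge0 andbT.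
  apply: ge_ereal_sup => _ [g [pg _] <-].
  by rewrite (pairing_ae0 pf pg f0).
- by move=> f c pf c0; exact: assoc_scale.
- move=> f g pf pg; apply: ge_ereal_sup => _ [h [ph Nh] <-].
  by rewrite pairingDl//; apply: leeD; exact: assoc_ubound.
- by move=> f g pf pg; exact: assoc_le.
- move=> fk f pk pf ae.
  have nd : nondecreasing_seq (fun k => assoc_norm L N (fk k)).
    move=> m n mn; apply: assoc_le => //.
    by move: ae; apply: filterS => s h Is; have [nd _] := h Is; exact: nd.
  split => //.
  suff -> : assoc_norm L N f = ereal_sup (range (fun k => assoc_norm L N (fk k))).
    exact: ereal_nondecreasing_cvgn.
  apply/eqP; rewrite eq_le; apply/andP; split.
    apply: ge_ereal_sup => _ [g [pg Ng] <-].
    apply: (cvge_ub (pairing_cvg pk pf pg ae)) => k.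
    apply: (@le_trans _ _ (assoc_norm L N (fk k))); first exact: assoc_ubound.
    by apply: ereal_sup_ubound; exists k.
  apply: ge_ereal_sup => _ [k _ <-]; apply: assoc_le => //.
  move: ae; apply: filterS => s h Is; have [ndk cv] := h Is.
  exact: nd_cvge_le ndk cv.
(* Finiteness on indicators is dual to the local bound for [N]: pairing the indicator with [g]
   integrates [g] over [E]. *)
- move=> E mE EI Ef; have [C C0 H] := ri_local hN mE EI Ef.
  apply: (@le_lt_trans _ _ C%:E); last exact: ltry.
  apply: ge_ereal_sup => _ [g [pg Ng] <-]; rewrite pairing_indic//.
  apply: le_trans (H g pg) _; rewrite -[leRHS]mule1; apply: lee_wpmul2l => //.
  by rewrite lee_fin ltW.
- exact: assoc_local.
- move=> f g pf pg fg; apply/eqP; rewrite eq_le; apply/andP.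
  by split; apply: assoc_equi_le => // l l0; rewrite fg.
Qed.

End assoc_ri.

Lemma pairing_step (F : nat -> set T) (v : nat -> R) h n :
  (forall i, measurable (F i)) -> (forall i, F i `<=` I) -> (forall i, (0 <= v i)%R) ->
  MeasPos L h ->
  \int[mu]_(s in I) (step F (fun i => (v i)%:E) n s * h s) =
  \sum_(i < n) (v i)%:E * \int[mu]_(s in F i) h s.
Proof.
move=> mF FI v0 ph; elim: n => [|n IH].
  rewrite big_ord0; apply: pairing_ae0 => //; last by apply: aeW => s _; rewrite /step big_ord0.
  apply: nneg_MeasPos; first exact: step_Meas.
  by move=> s _; apply: step_ge0.
rewrite big_ord_recr/= -IH.
have pst : MeasPos L (step F (fun i => (v i)%:E) n).
  apply: nneg_MeasPos; first exact: step_Meas.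
  by move=> s _; apply: step_ge0 => i; rewrite lee_fin.
have pce : MeasPos L (cell (F n) (v n)%:E).
  apply: nneg_MeasPos; first exact: cell_Meas.
  by move=> s _; apply: cell_ge0; rewrite lee_fin.
have cE : \int[mu]_(s in I) (cell (F n) (v n)%:E s * h s) =
    (v n)%:E * \int[mu]_(s in F n) h s.
  rewrite -(pairing_indic h (mF n) (@FI n)) -(pairing_scaler (v0 n))//.
    by apply: int_eq => s _; rewrite /cell muleA.
  exact: MeasPos_indic.
rewrite -cE -(pairingDl pst pce ph).
by apply: int_eq => s _; rewrite stepS.
Qed.

(** * The hard half of the Lorentz-Luxemburg theorem *)

Section lorentz_luxemburg.
Context (N : (R -> \bar R) -> \bar R) (hN : ri_norm L N).

Section cells.
Context (F : nat -> set T).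
Hypotheses (tF : trivIset setT F) (mF : forall i, measurable (F i)).
Hypotheses (FI : forall i, F i `<=` I) (Ff : forall i, mu (F i) < +oo).

Let simp (v : nat -> R) n := step F (fun i => (v i)%:E) n.

Let simp_pos v n : (forall i, (0 <= v i)%R) -> MeasPos L (simp v n).
Proof.
move=> v0; apply: nneg_MeasPos; first exact: step_Meas.
by move=> s _; apply: step_ge0 => i; rewrite lee_fin.
Qed.

Let N_simp_fin v n : (forall i, (0 <= v i)%R) -> N (simp v n) \is a fin_num.
Proof.
move=> v0; rewrite ge0_fin_numE; last exact: (ri_ge0 hN (simp_pos n v0)).
have pc i : MeasPos L (cell (F i) (v i)%:E).
  apply: nneg_MeasPos; first exact: cell_Meas.
  by move=> s _; apply: cell_ge0; rewrite lee_fin.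
apply: le_lt_trans (N_sum hN n pc) _; apply: lte_sum_pinfty => i _.
have -> : cell (F i) (v i)%:E = fun s => (v i)%:E * (\1_(F i) s)%:E.
  by apply/funext => s; rewrite /cell muleC.
have pi := MeasPos_indic L (mF i).
rewrite (ri_scale hN pi (v0 i)); apply: lte_mul_pinfty; rewrite ?lee_fin//.
exact: (ri_indic hN (mF i) (@FI i) (Ff i)).
Qed.

(* On the finite-dimensional space of step functions over the cells, the norm is
   supported at [a] by a linear functional [b]; by [N_step_average] the step
   function with values [|b i| / mu (F i)] has associate norm at most 1. *)
Lemma lorentz_luxemburg_step (a : nat -> R) n : (forall i, (0 <= a i)%R) ->
  N (simp a n.+1) <= assoc_norm L (assoc_norm L N) (simp a n.+1).
Proof.
move=> a0.
pose p (c : 'rV[R]_n.+1) : R := fine (N (simp (fun i => `|c 0%R (inord i)|)%R n.+1)).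
have pE c : (p c)%:E = N (simp (fun i => `|c 0%R (inord i)|)%R n.+1).
  by rewrite fineK//; exact: N_simp_fin.
have hp : sublinear p.
  split => [c d|t c t0]; rewrite -?lee_fin.
    rewrite EFinD !pE; apply: le_trans (ri_triangle hN _ _) => //; try exact: simp_pos.
    apply: (N_le hN); [exact: simp_pos|by apply: MeasPosD; exact: simp_pos|move=> s _].
    rewrite /simp /step -big_split/=; apply: lee_sum => i _; rewrite /cell -muleDr//.
    by apply: lee_wpmul2l; rewrite ?lee_fin// mxE ler_normD.
  apply: EFin_inj; rewrite EFinM !pE -(ri_scale hN) //; last exact: simp_pos.
  congr (N _); apply/funext => s; rewrite /simp /step ge0_sume_distrr; last first.
    by move=> i _; apply: cell_ge0; rewrite lee_fin.
  apply: eq_bigr => i _; rewrite /cell muleCA -EFinM mxE normrM.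
  by rewrite (ger0_norm t0).
have [b [pa pb]] := finite_hahn_banach (\row_i a i)%R hp.
have aE : simp a n.+1 = simp (fun i => `|(\row_i a i : 'rV[R]_n.+1)%R 0%R (inord i)|%R) n.+1.
  apply/funext => s; apply: eq_bigr => i _.
  by rewrite mxE inord_val ger0_norm.
pose w i : R := (`|b (inord i)| / fine (mu (F i)))%R.
have w0 i : (0 <= w i)%R by rewrite divr_ge0// fine_ge0.
have pw := simp_pos n.+1 w0.
have Nw : assoc_norm L N (simp w n.+1) <= 1.
  apply: ge_ereal_sup => _ [h [ph Nh] <-].
  have mh := Meas_abs ph.1.
  have ph' : MeasPos L (fun s => `|h s|) by exact: MeasPos_abs ph.1.
  have -> : \int[mu]_(s in I) (simp w n.+1 s * h s) =
      \int[mu]_(s in I) (simp w n.+1 s * `|h s|).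
    by rewrite (integral_abs_mul pw ph) [RHS](integral_abs_mul pw ph');
      apply: int_eq => s _; rewrite abse_id.
  rewrite /simp (pairing_step _ mF FI w0 ph').
  have avf i : average (F i) (fun s => `|h s|) \is a fin_num.
    have [C C0 HC] := ri_local hN (mF i) (@FI i) (Ff i).
    rewrite fin_numM//; rewrite ge0_fin_numE; last by apply: int_ge0.
    apply: le_lt_trans (HC _ ph') _; rewrite (N_abs hN ph).
    apply: (@le_lt_trans _ _ (C%:E * 1)); last by rewrite mule1 ltry.
    by apply: lee_wpmul2l => //; rewrite lee_fin ltW.
  pose A i := fine (average (F i) (fun s => `|h s|)).
  have AE i : (A i)%:E = average (F i) (fun s => `|h s|) by rewrite fineK.
  have A0 i : (0 <= A i)%R.
    by rewrite fine_ge0//; apply: average_ge0 => // s _.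
  rewrite (eq_bigr (fun i : 'I_n.+1 => (`|b i| * A i)%R%:E)); last first.
    move=> i _; rewrite /w inord_val EFinM -muleA EFinM AE.
    by rewrite /average.
  (* Testing [b] on the means of [|h|] multiplied by the signs of [b] produces the coefficients
     [|b i|]; the corresponding step function has norm at most that of [h] by averaging. *)
  rewrite sumEFin; have := pb (\row_i (Num.sg (b i) * A i))%R.
  set S := (\sum_i _)%R; have -> : S = (\sum_(i < n.+1) `|b i| * A i)%R.
    by apply: eq_bigr => i _; rewrite mxE mulrA [(b i * _)%R]mulrC -normrEsg.
  rewrite -lee_fin pE => /le_trans; apply; apply: le_trans Nh.
  rewrite -(N_abs hN ph).
  apply: le_trans (N_step_average L0 hN tF mF FI Ff mh _ n.+1); last by move=> s _.
  apply: (N_le hN); first exact: simp_pos.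
    apply: nneg_MeasPos; first exact: step_Meas.
    by move=> s _; apply: step_ge0 => i; rewrite -AE lee_fin.
  move=> s _; apply: lee_sum => i _; rewrite /cell -AE.
  apply: lee_wpmul2l; rewrite ?lee_fin// mxE inord_val normrM (ger0_norm (A0 i)).
  by rewrite ler_piMl// normr_sg; case: eqVneq.
(* Division by 0 gives [w] the value 0 on a null cell. Nothing is lost: [p] vanishes on all
   multiples of this basis vector, which forces [b i = 0]. *)
have b0 (i : 'I_n.+1) : mu (F i) = 0 -> b i = 0%R.
  move=> Fi; have key (t : R) : (b i * t <= 0)%R.
    have := pb (t *: delta_mx 0%R i)%R.
    rewrite (bigD1 i)//= big1 ?addr0; last first.
      by move=> j ji; rewrite !mxE (negbTE ji) !mulr0.
    rewrite !mxE !eqxx mulr1 -lee_fin pE.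
    suff -> : N (simp (fun j => `|(t *: delta_mx 0 i : 'rV[R]_n.+1) 0 (inord j)|)%R n.+1) = 0.
      by rewrite lee_fin.
    apply/(ri_eq0 hN); first exact: simp_pos.
    exists (F i); split => // s /= /not_implyP[Is ne]; apply: contrapT => nF; apply: ne.
    rewrite /simp /step big1// => j _; have [->|ji] := eqVneq j i; first by rewrite cell_out.
    by rewrite !mxE inord_val (negbTE ji) mulr0 normr0 /cell mule0.
  by have := key 1%R; have := key (-1)%R; lra.
have NF : N (simp a n.+1) <= (\sum_(i < n.+1) `|b i| * a i)%R%:E.
  rewrite aE -pE lee_fin; apply: le_trans pa _; apply: ler_sum => i _.
  by rewrite mxE ler_wpM2r// ler_norm.
apply: (le_trans NF).
apply: le_trans (assoc_ubound (simp a n.+1) pw Nw).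
rewrite /simp (pairing_step _ mF FI a0 pw) -sumEFin; apply: lee_sum => i _.
have -> : \int[mu]_(s in F i) simp w n.+1 s = (w i)%:E * mu (F i).
  rewrite (int_eq (g := fun=> (w i)%:E)); first by rewrite int_cst.
  by move=> s Fs; rewrite /simp (step_in _ tF (ltn_ord i) Fs).
have Fif : mu (F i) \is a fin_num by rewrite ge0_fin_numE.
rewrite /w inord_val; have [Fi0|Fi0] := eqVneq (mu (F i)) 0.
  by rewrite (b0 _ Fi0) normr0 mul0r mul0r mul0e mule0.
rewrite -[X in _ * (_ * X)](fineK Fif) -!EFinM lee_fin divfK 1?mulrC//.
by apply: contra_neq Fi0 => Fi0; rewrite -(fineK Fif) Fi0.
Qed.

End cells.

Lemma layer_sum_nat (d : R) m x : exists2 j, (j <= m)%N & layer_sum d m x = (j%:R * d)%R.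
Proof.
elim: m => [|m [j jm E]]; first by exists 0%N => //; rewrite /layer_sum big_ord0 mul0r.
rewrite layer_sumS E; case: (_ < x); last by exists j; [exact: leqW|rewrite mulr0 addr0].
by exists j.+1 => //; rewrite mulr1 -natr1 mulrDl mul1r.
Qed.

(** On [(0, n)] the dyadic layer of [|f|] takes finitely many values, so it is a step function over
    the cells where it is constant; the Fatou property passes to the limit. *)
Lemma lorentz_luxemburg f : MeasPos L f -> N f <= assoc_norm L (assoc_norm L N) f.
Proof.
move=> pf; have mf := Meas_abs pf.1.
have pf' : MeasPos L (fun s => `|f s|) by exact: MeasPos_abs pf.1.
rewrite -(N_abs hN pf).
pose F (n j : nat) : set T :=
  (I `&` [set s | layer n `|f s| = (j%:R * 2 ^- n)%R]) `&` oitv 0 n%:R%:E.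
have mF n j : measurable (F n j).
  apply: measurableI; last exact: oitv_measurable.
  have ml : @measurable_fun _ _ T (measurableTypeR R) I (fun s : T => layer n `|f s|).
    apply/measurable_EFinP; apply: measurable_layer; [exact: mI|exact: mf].
  exact: (ml mI _ (measurable_set1 _)).
have FI n j : F n j `<=` I by move=> s [[]].
have Ff n j : mu (F n j) < +oo.
  apply: (@le_lt_trans _ _ (mu (oitv 0 n%:R%:E))).
    apply: le_measure; rewrite ?inE//; last by move=> s [].
    exact: oitv_measurable.
  by rewrite cleb_oitv ?lee_fin// sube0 ltry.
have d0 n : (0 < (2 ^- n : R))%R by rewrite invr_gt0 exprn_gt0.
have tF n : trivIset setT (F n).
  move=> i j _ _ [s [[[_ /= ei] _] [[_ /= ej] _]]].
  by apply/eqP; rewrite -(eqr_nat R); apply/eqP/(mulIf (lt0r_neq0 (d0 n))); rewrite -ei ej.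
pose g n := step (F n) (fun j => (j%:R * 2 ^- n)%:E) (n * 2 ^ n).+1.
have gE n s : I s -> g n s = (\1_(oitv 0 n%:R%:E) s)%:E * (layer n `|f s|)%:E.
  move=> Is; rewrite indicE; have [sn|sn] := pselect (oitv 0 n%:R%:E s).
    rewrite mem_set// mul1e.
    have [j jm E] := layer_sum_nat (2 ^- n)%R (n * 2 ^ n) `|f s|.
    by rewrite /g (step_in _ (tF n) (_ : j < _)%N (_ : F n j s))// /layer E.
  by rewrite memNset// mul0e /g step_out// => j _ [_].
have pg n : MeasPos L (g n).
  apply: nneg_MeasPos; first exact: step_Meas.
  by move=> s _; apply: step_ge0 => j; rewrite lee_fin mulr_ge0// ltW.
have gf n s : I s -> g n s <= `|f s|.
  move=> Is; rewrite gE//; apply: (@le_trans _ _ (layer n `|f s|)%:E); last exact: layer_le.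
  by rewrite -EFinM lee_fin ler_piMl ?layer_ge0// indicE; case: (_ \in _).
apply: (N_fatou_le hN (fk := g)) => //.
- move=> s Is m n mn; rewrite !gE// -!EFinM lee_fin; apply: ler_pM => //; rewrite ?layer_ge0//.
    rewrite !indicE; case: (pselect (oitv 0 m%:R%:E s)) => sm.
      rewrite !mem_set//; move/andP: sm => [s0 sm]; apply/andP; split => //.
      by apply: lt_le_trans sm _; rewrite lee_fin ler_nat.
    by rewrite memNset.
  by have := @layer_nd R `|f s| => /(_ _ _ mn).
- move=> s Is; apply: cvg_trans (layer_cvg (x := `|f s|) _) => //.
  apply: near_eq_cvg; near=> n; rewrite gE// indicE mem_set ?mul1e//.
  move/andP: Is => [s0 _]; apply/andP; split => //.
  rewrite lte_fin; apply: (lt_le_trans (truncnS_gt s)); rewrite ler_nat.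
  by near: n; exact: nbhs_infty_ge.
- move=> n; have c0 j : (0 <= j%:R * 2 ^- n :> R)%R by rewrite mulr_ge0// ltW.
  apply: (le_trans (lorentz_luxemburg_step (tF n) (mF n) (@FI n) (Ff n) _ c0)).
  apply: (assoc_le _ (pg n) pf).
  have := ae_nneg pf; rewrite /ae_eq; apply: filterS => s fE Is.
  by rewrite (fE Is); exact: gf.
Unshelve. all: by end_near.
Qed.

End lorentz_luxemburg.

End associate.

(** * The operators R, H and T *)

Section tail_essential_supremum.
Context {R : realType} (L : \bar R).
Local Notation T := (lebesgueR R).
Local Notation mu := (@cleb R).
Local Notation I := (oitv 0 L).
#[local] Existing Instance ae_cleb_filter.
Context (h : R -> \bar R) (h0 : nneg L h).

(** For [h] equal to [phi] times a rearrangement, this is the nonincreasing function whose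
    [xi]-weighted means are the values of [target_weight]. *)
Definition tail_sup (t : R) : \bar R :=
  ess_sup mu (h \_ [set s : R | t%:E <= s%:E < L]).

Let tail_in (t s : R) : (0 < t)%R -> t%:E <= s%:E < L -> I s.
Proof.
by move=> t0 /andP[ts sL]; apply/andP; split => //; apply: lt_le_trans ts; rewrite lte_fin.
Qed.

Lemma tail_sup_ge0 t : I t -> 0 <= tail_sup t.
Proof.
move=> /andP[t0 _]; apply: ess_sup_gee.
  apply: (@lt_le_trans _ _ (mu (oitv (0 : R)%:E (1 : R)%:E))).
    by rewrite cleb_oitv ?lee_fin// sube0 lte_fin.
  apply: le_measure; rewrite ?inE//; exact: oitv_measurable.
apply: aeW => s; rewrite /patch; case: ifP => // /set_mem/= sI.
by apply: h0; apply: tail_in sI; rewrite -lte_fin.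
Qed.

Lemma tail_sup_noninc : noninc L tail_sup.
Proof.
move=> s t Is It st; apply: le_ess_sup; apply: aeW => x.
have s0 : (0 < s)%R by rewrite -lte_fin; case/andP: Is.
rewrite /patch; case: ifP => [/set_mem/= /andP[tx xL]|_].
  by rewrite mem_set//=; apply/andP; split => //; apply: le_trans tx; rewrite lee_fin.
by case: ifP => // /set_mem/= sI; apply: h0; exact: tail_in sI.
Qed.

(* At an exceptional point [s], with a rational [tail_sup s <= r < h s], either
   [s] lies in the null set [q <= s, tail_sup q < h s] for a rational [q < s],
   or [s] is the left end point of [tail_sup <= r]. *)
Lemma le_tail_sup : \forall s \ae mu, I s -> h s <= tail_sup s.
Proof.
pose q (n : nat) : R := ratr (odflt 0%R (unpickle n)).
have qP (a b : R) : (a < b)%R -> exists n, (a < q n < b)%R.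
  move=> ab; have [r /andP[ar rb]] := rat_in_itvoo ab.
  by exists (pickle r); rewrite /q pickleK /=; move: ar rb; rewrite !bnd_simp => -> ->.
have H1 : \forall s \ae mu, forall n, (h \_ [set x : R | (q n)%:E <= x%:E < L]) s <= tail_sup (q n).
  by apply/ae_foralln => n; exact: ess_sup_ge.
pose D n := [set s : R | [/\ I s, tail_sup s <= (q n)%:E &
  forall t, I t -> (t < s)%R -> (q n)%:E < tail_sup t]].
have H2 : \forall s \ae mu, forall n, ~ D n s.
  apply/ae_foralln => n; have [[a [Ia aq Da]]|nD] := pselect (exists a, D n a).
    exists [set a]; split; [exact: set1_measurable|exact: cleb_set1|].
    move=> s /= /contrapT [Is sq Ds]; apply/eqP; rewrite eq_le !leNgt.
    apply/andP; split; apply/negP => st.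
      by have := Ds _ Ia st; rewrite ltNge aq.
    by have := Da _ Is st; rewrite ltNge sq.
  by apply: aeW => s Ds; apply: nD; exists s.
move: H1 H2; apply: filterS2 => s H1 H2 Is; rewrite leNgt; apply/negP => Sh.
have [n /andP[Sn nh]] : exists n, tail_sup s <= (q n)%:E < h s.
  have S0 := tail_sup_ge0 Is.
  have [r Sr] : exists r, tail_sup s = r%:E.
    move: S0 Sh; case: (tail_sup s) => [r| |]; [by exists r| |].
      by move=> _; rewrite ltNge leey.
    by rewrite leNgt ltNy0.
  have [r' rr' r'h] : exists2 r' : R, (r < r')%R & r'%:E <= h s.
    move: Sh; rewrite Sr; case: (h s) => [r'| |]//; first by rewrite lte_fin; exists r'.
    by move=> _; exists (r + 1)%R; rewrite ?ltrDl// leey.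
  have [n /andP[h1 h2]] := qP _ _ rr'; exists n.
  by rewrite Sr lee_fin (ltW h1)/=; apply: lt_le_trans r'h; rewrite lte_fin.
apply: (H2 n); split => // t It ts; rewrite ltNge; apply/negP => tq.
have t0 : (0 < t)%R by rewrite -lte_fin; case/andP: It.
have [m /andP[tm ms]] := qP _ _ ts.
have Im : I (q m).
  apply/andP; split; first by rewrite lte_fin; exact: lt_trans tm.
  by apply: lt_trans (proj2 (andP Is)); rewrite lte_fin.
have := H1 m; rewrite /patch mem_set; last first.
  by apply/andP; split; [rewrite lee_fin ltW|case/andP: Is].
by rewrite leNgt => /negP; apply; apply: le_lt_trans nh;
  apply: le_trans tq; apply: tail_sup_noninc => //; exact: ltW.
Qed.

End tail_essential_supremum.

(** * Weighted means of nonincreasing functions *)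

Section weighted_average.
Context {R : realType} (L : \bar R).
Local Notation T := (lebesgueR R).
Local Notation mu := (@cleb R).
Local Notation I := (oitv 0 L).

(** With [P] and [Q] the integrals of [w S] over [(0, x)] and over the rest of [(0, y)], and [c] the
    weight of the rest, the claim reads [a Q <= c P]. The value [a c S(x)] separates the two sides,
    as [S] is at least [S(x)] before [x] and at most [S(x)] after it. *)
Lemma weighted_average_le (w S : R -> \bar R) (x y a b : R) :
  Meas L w -> (forall s, I s -> 0 <= w s) -> noninc L S -> nneg L S ->
  I x -> I y -> (x <= y)%R -> (0 < a)%R -> (0 < b)%R ->
  \int[mu]_(s in oitv 0 x%:E) w s = a%:E -> \int[mu]_(s in oitv 0 y%:E) w s = b%:E ->
  b^-1%:E * \int[mu]_(s in oitv 0 y%:E) (w s * S s) <=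
  a^-1%:E * \int[mu]_(s in oitv 0 x%:E) (w s * S s).
Proof.
move=> mw w0 nS S0 Ix Iy xy a0 b0 wa wb.
pose A : set T := oitv 0 x%:E; pose C : set T := oitv 0 y%:E `\` A.
have mA : measurable A by exact: oitv_measurable.
have mC : measurable C by apply: measurableD => //; exact: oitv_measurable.
have AC : oitv 0 y%:E = A `|` C.
  rewrite /C setDE setUIr setUv setIT; apply/esym/setUidPr => s /andP[s0 sx].
  by apply/andP; split => //; apply: lt_le_trans sx _; rewrite lee_fin.
have yI : oitv 0 y%:E `<=` I.
  by move=> s /andP[s0 sy]; apply/andP; split => //; apply: lt_trans sy _; case/andP: Iy.
have AI : A `<=` I by move=> s As; apply: yI; rewrite AC; left.
have CI : C `<=` I by move=> s As; apply: yI; rewrite AC; right.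
have sub (D : set T) f : D `<=` I -> Meas L f -> measurable_fun D (f : T -> _).
  by move=> DI mf; apply: measurable_funS mf => //; exact: oitv_measurable.
have mS := noninc_Meas nS; have mwS := emeasurable_funM mw mS.
have split f : Meas L f -> nneg L f ->
    \int[mu]_(s in oitv 0 y%:E) f s = \int[mu]_(s in A) f s + \int[mu]_(s in C) f s.
  move=> mf f0; rewrite AC ge0_integral_setU//.
  - by rewrite -AC; apply: sub mf => //; exact: yI.
  - by move=> s; rewrite -AC => /yI; exact: f0.
  - by rewrite disj_set2E /C setDIK.
have wS0 s : I s -> 0 <= w s * S s by move=> Is; rewrite mule_ge0 ?w0 ?S0.
rewrite split//; set P := \int[mu]_(s in A) _; set Q := \int[mu]_(s in C) _.
have P0 : 0 <= P by apply: int_ge0 => s /AI/wS0.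
have Q0 : 0 <= Q by apply: int_ge0 => s /CI/wS0.
pose c := \int[mu]_(s in C) w s.
have c0 : 0 <= c by apply: int_ge0 => s /CI/w0.
have bE : b%:E = a%:E + c by rewrite -wb split// wa.
have Pa : a%:E * S x <= P.
  rewrite -wa muleC -(int_scale _ (sub _ _ AI mw)) ?S0//; last by move=> s /AI/w0.
  apply: (int_le mA).
  - exact: sub AI (measurable_funeM _ mw).
  - exact: sub AI mwS.
  - by move=> s /AI Is; rewrite mule_ge0 ?w0 ?S0.
  - move=> s As; rewrite muleC; apply: lee_wpmul2l; first by rewrite w0//; exact: AI.
    by apply: nS => //; [exact: AI|case/andP: As => _; rewrite lte_fin => /ltW].
have Qc : Q <= c * S x.
  rewrite muleC -(int_scale _ (sub _ _ CI mw)) ?S0//; last by move=> s /CI/w0.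
  apply: (int_le mC).
  - exact: sub CI mwS.
  - exact: sub CI (measurable_funeM _ mw).
  - by move=> s /CI/wS0.
  - move=> s Cs; rewrite [leRHS]muleC; apply: lee_wpmul2l; first by rewrite w0//; exact: CI.
    apply: nS => //; first exact: CI.
    case: Cs => /andP[s0 _] /negP; rewrite /A /oitv /= s0 /= -leNgt lee_fin//.
rewrite lee_pdivrMl// muleCA lee_pdivlMl// bE.
have a0' : 0 <= a%:E by rewrite lee_fin ltW.
rewrite (ge0_muleDr _ P0 Q0) (ge0_muleDl _ a0' c0) leeD2l//.
apply: (@le_trans _ _ (a%:E * (c * S x))); first exact: lee_wpmul2l.
by rewrite muleCA; exact: lee_wpmul2l.
Qed.
End weighted_average.

(** * Tonelli's theorem on the region below the graph of nu *)

Section tonelli.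
Context {R : realType} (L : \bar R).
Local Notation T := (lebesgueR R).
Local Notation mu := (@cleb R).
Local Notation I := (oitv 0 L).

(** Both sides integrate [p(t) q(s)] over the region [t < nu s], which is also the region
    [nui t < s]. *)
Lemma tonelli_triangle (p q : R -> \bar R) (nu nui : R -> R) :
  Meas L p -> nneg L p -> Meas L q -> nneg L q ->
  (forall s, I s -> I (nu s)) -> (forall t, I t -> I (nui t)) ->
  {in I &, {homo nu : x y / (x <= y)%R}} ->
  (forall t s, I t -> I s -> (nui t < s)%R = (t < nu s)%R) ->
  \int[mu]_(t in I) (p t * \int[mu]_(s in oitv (nui t)%:E L) q s) =
  \int[mu]_(s in I) (q s * \int[mu]_(t in oitv 0 (nu s)%:E) p t).
Proof.
move=> mp p0 mq q0 nuI nuiI nund adj.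
have mI : measurable (I : set T) by exact: oitv_measurable.
have mP : measurable_fun [set: T] (p \_ I : T -> _) by apply/(measurable_restrictT _ mI).
have mQ : measurable_fun [set: T] (q \_ I : T -> _) by apply/(measurable_restrictT _ mI).
have P0 t : 0 <= (p \_ I) t by rewrite /patch; case: ifP => // /set_mem; exact: p0.
have Q0 t : 0 <= (q \_ I) t by rewrite /patch; case: ifP => // /set_mem; exact: q0.
(* The negatives are nonincreasing, hence measurable; the region [t < nu s] becomes [b s < a t]. *)
pose a := (fun t : R => (- t)%:E) \_ I; pose b := (fun t : R => (- nu t)%:E) \_ I.
have ma : measurable_fun [set: T] (a : T -> _).
  apply/(measurable_restrictT _ mI); apply: noninc_Meas => s t _ _ st.
  by rewrite lee_fin lerN2.
have mb : measurable_fun [set: T] (b : T -> _).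
  apply/(measurable_restrictT _ mI); apply: noninc_Meas => s t Is It st.
  by rewrite lee_fin lerN2; apply: nund; rewrite ?inE.
pose B := [set z : T * T | b z.2 < a z.1].
have mB : measurable B.
  rewrite -[B]setTI; apply: measurable_lte => //.
  - exact: (measurableT_comp mb measurable_snd).
  - exact: (measurableT_comp ma measurable_fst).
pose K (z : T * T) := (p \_ I) z.1 * (q \_ I) z.2 * (\1_B z)%:E.
have mK : measurable_fun [set: T * T] K.
  apply: emeasurable_funM.
    apply: emeasurable_funM.
      exact: (measurableT_comp mP measurable_fst).
    exact: (measurableT_comp mQ measurable_snd).
  by apply/measurable_EFinP; exact: measurable_indic.
have K0 z : 0 <= K z by rewrite mule_ge0 ?lee_fin// mule_ge0.
have BE t s : I t -> I s -> B (t, s) <-> (t < nu s)%R.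
  by move=> It Is; rewrite /B /= /a /b /patch !mem_set// lte_fin ltrN2.
have := fubini_tonelli (m1 := mu) (m2 := mu) K mK K0.
have E1 t : \int[mu]_s K (t, s) =
    ((fun t => p t * \int[mu]_(s in oitv (nui t)%:E L) q s) \_ I) t.
  rewrite [in RHS]/patch; case: ifPn => [/set_mem It|nI]; last first.
    rewrite (int_eq (g := fun=> 0)) ?integral0// => s _.
    by rewrite /K /= /patch (negbTE nI) !mul0e.
  have sub : oitv (nui t)%:E L `<=` I.
    move=> s /andP[ts sL]; apply/andP; split => //; apply: lt_trans ts.
    by case/andP: (nuiI _ It).
  rewrite -int_scale ?p0//; last 3 first.
  - exact: oitv_measurable.
  - by apply: measurable_funS mq => //; exact: sub.
  - by move=> s /sub; exact: q0.
  rewrite [RHS]integral_mkcond; apply: int_eq => s _; rewrite /K /= /patch (mem_set It).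
  have [Ds|nDs] := pselect (oitv (nui t)%:E L s).
    rewrite !mem_set//; last exact: sub.
    rewrite indicE mem_set ?mule1//; apply/BE => //; first exact: sub.
    by rewrite -adj//; [case/andP: Ds; rewrite lte_fin|exact: sub].
  rewrite (memNset nDs); case: ifPn => [/set_mem Is|_]; last by rewrite mule0 mul0e.
  rewrite indicE memNset ?mule0// => /(BE _ _ It Is); rewrite -adj// => ts; apply: nDs.
  by apply/andP; rewrite lte_fin; split => //; case/andP: Is.
have E2 s : \int[mu]_t K (t, s) =
    ((fun s => q s * \int[mu]_(t in oitv 0 (nu s)%:E) p t) \_ I) s.
  rewrite [in RHS]/patch; case: ifPn => [/set_mem Is|nI]; last first.
    rewrite (int_eq (g := fun=> 0)) ?integral0// => t _.
    by rewrite /K /= /patch (negbTE nI) mule0 mul0e.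
  have sub : oitv 0 (nu s)%:E `<=` I.
    move=> t /andP[t0 ts]; apply/andP; split => //; apply: lt_trans ts _.
    by case/andP: (nuI _ Is).
  rewrite -int_scale ?q0//; last 3 first.
  - exact: oitv_measurable.
  - by apply: measurable_funS mp => //; exact: sub.
  - by move=> t /sub; exact: p0.
  rewrite [RHS]integral_mkcond; apply: int_eq => t _; rewrite /K /= /patch (mem_set Is).
  have [Dt|nDt] := pselect (oitv 0 (nu s)%:E t).
    rewrite !mem_set//; last exact: sub.
    rewrite indicE mem_set ?mule1 1?muleC//; apply/BE => //; first exact: sub.
    by case/andP: Dt; rewrite lte_fin.
  rewrite (memNset nDt); case: ifPn => [/set_mem It|_]; last by rewrite !mul0e.
  rewrite indicE memNset ?mule0// => /(BE _ _ It Is) ts; apply: nDt.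
  by apply/andP; rewrite lte_fin; split => //; case/andP: It.
under eq_integral do rewrite E1; under [in RHS]eq_integral do rewrite E2.
by rewrite -!integral_mkcond.
Qed.

End tonelli.

(** * Increasing bijections of (0, L) *)

Section increasing_bijection.
Context {R : realType} (L : \bar R) (nu : R -> R) (hnu : incr_bij L nu).
Local Notation I := (oitv 0 L).
Local Notation nui := (bij_inv L nu).

Lemma incr_bij_in s : I s -> I (nu s).
Proof. by case: hnu => -[h _ _] _ Is; exact: h. Qed.

Lemma bij_inv_in s : I s -> I (nui s).
Proof. by case: hnu => -[_ _ h] _ Is; apply: (surjpinv_image_sub h); exists s. Qed.

Lemma bij_invK s : I s -> nu (nui s) = s.
Proof. by case: hnu => -[_ _ h] _ Is; exact: (surjpK _ h (mem_set Is)). Qed.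

Lemma incr_bij_le : {in I &, {mono nu : x y / (x <= y)%R}}.
Proof. by apply: le_mono_in; case: hnu. Qed.

Lemma incr_bij_adj t s : I t -> I s -> (nui t < s)%R = (t < nu s)%R.
Proof.
move=> It Is; rewrite -[in RHS](bij_invK It).
by rewrite (leW_mono_in incr_bij_le)// inE//; exact: bij_inv_in.
Qed.

Lemma bij_inv_le s t : I s -> I t -> (s <= t)%R -> (nui s <= nui t)%R.
Proof.
move=> Is It st; rewrite -incr_bij_le ?inE; [|exact: bij_inv_in..].
by rewrite !bij_invK.
Qed.

End increasing_bijection.

(** * The operators and their pairings *)

Section target_dual.
Context {R : realType} (L : \bar R) (L0 : 0 < L).
Local Notation T := (lebesgueR R).
Local Notation mu := (@cleb R).
Local Notation I := (oitv 0 L).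
#[local] Existing Instance ae_cleb_filter.
Implicit Types (f g h w : R -> \bar R).
Context (nu : R -> R) (hnu : incr_bij L nu).
Context (u xi v : R -> R).
Hypothesis u_gt0 : forall t, I t -> (0 < u t)%R.
Hypothesis u_noninc : {in I &, nonincreasing_fun u}.
Hypothesis xi_gt0 : forall t, I t -> (0 < xi t)%R.
Hypothesis xi_meas : @measurable_fun _ _ T (measurableTypeR R) I xi.
Hypothesis v_gt0 : forall t, I t -> (0 < v t)%R.
Hypothesis hv : forall t, I t ->
  ((v t)^-1)%:E = \int[mu]_(s in oitv 0 (nu t)%:E) (xi s)%:E.

Local Notation nui := (bij_inv L nu).
Local Notation TT := (opT L (fun t => u t / xi t)%R).
Let h g (s : R) : \bar R := (u s / xi s)%:E * rearr L g s.

Let mI : measurable (I : set T) := oitv_measurable _ _.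

Lemma oitv_below x : I x -> oitv 0 x%:E `<=` I.
Proof.
by move=> /andP[_ xL] s /andP[s0 sx]; apply/andP; split => //; exact: lt_trans sx xL.
Qed.

Lemma oitv_above x : I x -> oitv x%:E L `<=` I.
Proof.
by move=> /andP[x0 _] s /andP[xs sL]; apply/andP; split => //; exact: lt_trans x0 xs.
Qed.

Lemma Meas_below x f : I x -> Meas L f -> measurable_fun (oitv 0 x%:E : set T) (f : T -> _).
Proof. by move=> Ix mf; by apply: measurable_funS mf; [exact: mI|exact: oitv_below]. Qed.

Lemma u_ge0 s : I s -> 0 <= (u s)%:E. Proof. by move=> /u_gt0 /ltW. Qed.
Lemma xi_ge0 s : I s -> 0 <= (xi s)%:E. Proof. by move=> /xi_gt0 /ltW. Qed.
Lemma v_ge0 s : I s -> 0 <= (v s)%:E. Proof. by move=> /v_gt0 /ltW. Qed.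

Lemma noninc_u : noninc L (fun s => (u s)%:E).
Proof. by move=> s t Is It st; rewrite lee_fin; apply: u_noninc; rewrite ?inE. Qed.

Lemma Meas_xi : Meas L (fun s => (xi s)%:E).
Proof. by apply/measurable_EFinP; exact: xi_meas. Qed.

Lemma incr_bij_nd s t : I s -> I t -> (s <= t)%R -> (nu s <= nu t)%R.
Proof. by move=> Is It; rewrite (incr_bij_le hnu) ?inE. Qed.

Lemma noninc_v : noninc L (fun s => (v s)%:E).
Proof.
move=> s t Is It st; rewrite lee_fin -lef_pV2 ?posrE ?v_gt0// -lee_fin !hv//.
have sub := oitv_below (incr_bij_in hnu It).
apply: int_subset.
- exact: oitv_measurable.
- exact: oitv_measurable.
- by apply: (@Meas_below _ (fun s => (xi s)%:E)); [exact: incr_bij_in|exact: Meas_xi].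
- by move=> x /sub; exact: xi_ge0.
- move=> x /andP[x0 xs]; apply/andP; split => //; apply: lt_le_trans xs _.
  by rewrite lee_fin; exact: incr_bij_nd.
Qed.

Lemma phi_rearr_nneg g : nneg L (h g).
Proof.
move=> s Is; rewrite /h mule_ge0 ?rearr_ge0//.
by rewrite lee_fin divr_ge0// ltW ?u_gt0 ?xi_gt0.
Qed.

(** The choice [phi = u / xi] is made for this: [u / phi] is [xi], the density behind [1 / v]. *)
Lemma opT_mulu g t : I t -> TT g t * (u t)%:E = (xi t)%:E * tail_sup L (h g) t.
Proof.
move=> It; rewrite /opT -/(tail_sup L (h g) t) muleAC -EFinM invf_div divfK//.
by rewrite gt_eqF// u_gt0.
Qed.

Lemma opT_nneg g : nneg L (TT g).
Proof.
move=> t It; rewrite /opT -/(tail_sup L (h g) t) mule_ge0//.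
  by rewrite lee_fin invr_ge0 divr_ge0// ltW ?u_gt0 ?xi_gt0.
by apply: tail_sup_ge0 => //; exact: phi_rearr_nneg.
Qed.

Lemma opT_Meas g : Meas L (TT g).
Proof.
have mS := noninc_Meas (tail_sup_noninc (@phi_rearr_nneg g)).
(* The measurability of [u] comes from monotonicity. Its negative reciprocal is nonincreasing, and
   the factor -1 below restores the sign. *)
have mV : Meas L (fun s => (- (u s)^-1)%:E).
  apply: noninc_Meas => s t Is It st; rewrite lee_fin lerN2 lef_pV2 ?posrE ?u_gt0//.
  by apply: u_noninc; rewrite ?inE.
have := measurable_funeM (-1)%:E (emeasurable_funM (emeasurable_funM Meas_xi mV) mS).
apply: eq_measurable_fun => t _ /=; rewrite /opT -/(tail_sup L (h g) t) muleA.
by rewrite invf_div -!EFinM mulrN mulN1r opprK.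
Qed.

Lemma opT_MeasPos g : MeasPos L (TT g).
Proof. by apply: nneg_MeasPos; [exact: opT_Meas|exact: opT_nneg]. Qed.

Lemma rearr_le_opT g : \forall s \ae mu, I s -> rearr L g s <= TT g s.
Proof.
apply: filterS (le_tail_sup (@phi_rearr_nneg g)) => s H Is.
rewrite /opT -/(tail_sup L (h g) s) lee_pdivlMl; first exact: H.
by rewrite divr_gt0 ?u_gt0 ?xi_gt0.
Qed.

Definition target_weight g (t : R) : \bar R :=
  (v t)%:E * \int[mu]_(s in oitv 0 (nu t)%:E) (TT g s * (u s)%:E).
Local Notation W := target_weight.

Lemma target_weight_nneg g : nneg L (W g).
Proof.
move=> t It; rewrite mule_ge0 ?v_ge0//; apply: int_ge0 => s /(oitv_below (incr_bij_in hnu It)) Is.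
by rewrite mule_ge0 ?opT_nneg ?u_ge0.
Qed.

Lemma target_weightE g t : I t -> W g t =
  (v t)%:E * \int[mu]_(s in oitv 0 (nu t)%:E) ((xi s)%:E * tail_sup L (h g) s).
Proof.
move=> It; rewrite /W; apply: (congr1 (fun z => (v t)%:E * z)); apply: int_eq.
by move=> s /(oitv_below (incr_bij_in hnu It)) Is; exact: opT_mulu.
Qed.

Lemma target_weight_noninc g : noninc L (W g).
Proof.
move=> s t Is It st; rewrite !target_weightE//.
rewrite -(invrK (v s)) -(invrK (v t)).
apply: (@weighted_average_le _ L (fun s => (xi s)%:E)).
- exact: Meas_xi.
- exact: xi_ge0.
- exact: tail_sup_noninc (@phi_rearr_nneg g).
- by move=> x Ix; apply: tail_sup_ge0 => //; exact: phi_rearr_nneg.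
- exact: incr_bij_in.
- exact: incr_bij_in.
- exact: incr_bij_nd.
- by rewrite invr_gt0 v_gt0.
- by rewrite invr_gt0 v_gt0.
- by rewrite -hv.
- by rewrite -hv.
Qed.

Lemma target_weight_Meas g : Meas L (W g).
Proof. exact: noninc_Meas (@target_weight_noninc g). Qed.

Lemma target_weight_MeasPos g : MeasPos L (W g).
Proof. by apply: nneg_MeasPos; [exact: target_weight_Meas|exact: target_weight_nneg]. Qed.

(** The weight [u] cut off at [x] is nonincreasing, so [|g|] may be replaced by its rearrangement,
    which lies below [T g] almost everywhere. *)
Lemma le_integral_opT g x : I x -> MeasPos L g ->
  \int[mu]_(s in oitv 0 x%:E) (`|g s| * (u s)%:E) <=
  \int[mu]_(s in oitv 0 x%:E) (TT g s * (u s)%:E).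
Proof.
move=> Ix pg; have xI := oitv_below Ix.
have mx : measurable (oitv 0 x%:E : set T) by exact: oitv_measurable.
pose w s := (\1_(oitv 0 x%:E) s)%:E * (u s)%:E.
have wE s : oitv 0 x%:E s -> w s = (u s)%:E.
  by move=> xs; rewrite /w indicE mem_set// mul1e.
have w0 s : ~ oitv 0 x%:E s -> w s = 0.
  by move=> xs; rewrite /w indicE memNset// mul0e.
have wnn : nneg L w by move=> s Is; rewrite mule_ge0 ?u_ge0// lee_fin.
have wni : noninc L w.
  move=> s t Is It st; have [xt|xt] := pselect (oitv 0 x%:E t); last first.
    by rewrite (w0 t)//; exact: wnn.
  rewrite !wE//; first exact: noninc_u.
  case/andP: xt => _ tx; apply/andP; split; first by case/andP: Is.
  by apply: le_lt_trans tx; rewrite lee_fin.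
have intE f : \int[mu]_(s in I) (f s * w s) = \int[mu]_(s in oitv 0 x%:E) (f s * (u s)%:E).
  rewrite -[in RHS](setIidr xI) integral_mkcondr; apply: int_eq => s _.
  rewrite /patch; case: (pselect (oitv 0 x%:E s)) => xs.
    by rewrite mem_set// wE.
  by rewrite memNset// w0// mule0.
have pg' := MeasPos_abs pg.1.
rewrite -(intE (fun s => `|g s|)) -intE.
apply: (le_trans (le_rearr_noninc L0 pg' wni wnn)).
have -> : \int[mu]_(s in I) (rearr L (fun s => `|g s|) s * w s) =
    \int[mu]_(s in I) (rearr L g s * w s).
  by apply: int_eq => s _; rewrite rearr_abs.
have mw := noninc_Meas wni; have mr := rearr_Meas (L := L) g.
have mT := opT_Meas g.
apply: (@ae_ge0_le_integral _ T R mu I mI).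
- by move=> s Is; rewrite mule_ge0 ?wnn// rearr_ge0.
- exact: (emeasurable_funM mr mw).
- by move=> s Is; rewrite mule_ge0 ?wnn// opT_nneg.
- exact: (emeasurable_funM mT mw).
- apply: filterS (rearr_le_opT g) => s H Is.
  by apply: lee_wpmul2r; [exact: wnn|exact: H].
Qed.

Lemma tonelli_target (f p : R -> \bar R) : Meas L f -> nneg L f -> Meas L p -> nneg L p ->
  \int[mu]_(t in I) (p t * ((u t)%:E * \int[mu]_(s in oitv (nui t)%:E L) (f s * (v s)%:E))) =
  \int[mu]_(s in I) (f s * ((v s)%:E * \int[mu]_(t in oitv 0 (nu s)%:E) (p t * (u t)%:E))).
Proof.
move=> mf f0 mp p0; have mv := noninc_Meas noninc_v; have mU := noninc_Meas noninc_u.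
under eq_integral do rewrite muleA; under [in RHS]eq_integral do rewrite muleA.
apply: (@tonelli_triangle _ L (fun t => p t * (u t)%:E) (fun s => f s * (v s)%:E)).
- exact: (emeasurable_funM mp mU).
- by move=> s Is; rewrite mule_ge0 ?p0 ?u_ge0.
- exact: (emeasurable_funM mf mv).
- by move=> s Is; rewrite mule_ge0 ?f0 ?v_ge0.
- exact: incr_bij_in.
- exact: bij_inv_in.
- by move=> s t; rewrite !inE; exact: incr_bij_nd.
- by move=> t s; exact: incr_bij_adj.
Qed.

Local Notation H f := (opH L u v nui (rearr L f)).

Lemma opHE f t : H f t = (u t)%:E * \int[mu]_(s in oitv (nui t)%:E L) (rearr L f s * (v s)%:E).
Proof.
rewrite /opH; apply: (congr1 (fun z => (u t)%:E * z)); apply: int_eq => s _.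
by rewrite gee0_abs// rearr_ge0.
Qed.

Lemma rearr_v_ge0 f s : I s -> 0 <= rearr L f s * (v s)%:E.
Proof. by move=> Is; rewrite mule_ge0 ?rearr_ge0 ?v_ge0. Qed.

Lemma opH_nneg f : nneg L (H f).
Proof.
move=> t It; rewrite opHE mule_ge0 ?u_ge0//.
by apply: int_ge0 => s /(oitv_above (bij_inv_in hnu It)); exact: rearr_v_ge0.
Qed.

Lemma opH_noninc f : noninc L (H f).
Proof.
move=> s t Is It st; rewrite !opHE.
have sub := oitv_above (bij_inv_in hnu Is).
have mrv : Meas L (fun s => rearr L f s * (v s)%:E).
  exact: (emeasurable_funM (rearr_Meas (L := L) f) (noninc_Meas noninc_v)).
apply: lee_pmul.
- exact: u_ge0.
- by apply: int_ge0 => x /(oitv_above (bij_inv_in hnu It)); exact: rearr_v_ge0.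
- exact: noninc_u.
- apply: int_subset.
  + exact: oitv_measurable.
  + exact: oitv_measurable.
  + exact: (measurable_funS mI sub mrv).
  + by move=> x /sub; exact: rearr_v_ge0.
  + move=> x /andP[tx xL]; apply/andP; split => //; apply: le_lt_trans tx.
    by rewrite lee_fin; exact: (bij_inv_le hnu).
Qed.

Lemma opH_MeasPos f : MeasPos L (H f).
Proof.
by apply: nneg_MeasPos; [exact: noninc_Meas (@opH_noninc f)|exact: opH_nneg].
Qed.

Lemma pairing_opH f p : Meas L p -> nneg L p ->
  \int[mu]_(t in I) (H f t * p t) =
  \int[mu]_(s in I) (rearr L f s *
    ((v s)%:E * \int[mu]_(t in oitv 0 (nu s)%:E) (p t * (u t)%:E))).
Proof.
move=> mp p0; rewrite -(tonelli_target (rearr_Meas (L := L) f) (rearr_nneg f) mp p0).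
by apply: int_eq => t _; rewrite opHE muleC.
Qed.

Lemma opR_MeasPos g : Meas L g -> MeasPos L (opR u v nu g).
Proof.
move=> mg; have gu0 s : I s -> 0 <= `|g s| * (u s)%:E by move=> Is; rewrite mule_ge0 ?u_ge0.
have mgu : Meas L (fun s => `|g s| * (u s)%:E).
  exact: (emeasurable_funM (Meas_abs mg) (noninc_Meas noninc_u)).
apply: nneg_MeasPos; last first.
  move=> t It; rewrite mule_ge0 ?v_ge0//.
  by apply: int_ge0 => s /(oitv_below (incr_bij_in hnu It)); exact: gu0.
apply: emeasurable_funM; first exact: noninc_Meas noninc_v.
pose J t := \int[mu]_(s in oitv 0 (nu t)%:E) (`|g s| * (u s)%:E).
have mJ : Meas L (fun t => (-1)%:E * J t).
  apply: noninc_Meas => s t Is It st; rewrite !EFinN !mulN1e leeN2.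
  have sub := oitv_below (incr_bij_in hnu It).
  apply: int_subset.
  - exact: oitv_measurable.
  - exact: oitv_measurable.
  - exact: (measurable_funS mI sub mgu).
  - by move=> x /sub; exact: gu0.
  - move=> x /andP[x0 xs]; apply/andP; split => //; apply: lt_le_trans xs _.
    by rewrite lee_fin; exact: incr_bij_nd.
have := measurable_funeM (-1)%:E mJ.
by apply: eq_measurable_fun => t _; rewrite !EFinN !mulN1e oppeK.
Qed.

Lemma opR_le_target_weight g t : I t -> MeasPos L g -> opR u v nu g t <= W g t.
Proof.
move=> It pg; apply: lee_wpmul2l; first exact: v_ge0.
by apply: le_integral_opT => //; exact: incr_bij_in.
Qed.

Lemma pairing_opH_opR f g : MeasPos L g ->
  \int[mu]_(t in I) (H f t * g t) = \int[mu]_(s in I) (rearr L f s * opR u v nu g s).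
Proof.
move=> pg; rewrite (integral_abs_mul (opH_MeasPos f) pg) -pairing_opH//; last first.
  exact: Meas_abs pg.1.
by apply: int_eq => s Is; rewrite gee0_abs//; exact: opH_nneg.
Qed.

Lemma pairing_opH_opT f g :
  \int[mu]_(t in I) (H f t * TT g t) = \int[mu]_(s in I) (rearr L f s * W g s).
Proof. by rewrite pairing_opH; [|exact: opT_Meas|exact: opT_nneg]. Qed.

Lemma oitv_point : exists e, I e.
Proof.
case: (L) L0 => [l l0| _|//]; last by exists 1%R; rewrite /oitv /= lte01 ltry.
by exists (l / 2)%R; rewrite /oitv /= !lte_fin divr_gt0//= gtr_pMr// invf_lt1// ltr1n.
Qed.

(** * The functional Z and its comparison with H *)

Section norm.
Context (X : (R -> \bar R) -> \bar R) (hX : ri_norm L X).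
Local Notation Z := (targetDual L u xi v nu X).

Lemma norm_indic (E : set T) : measurable E -> E `<=` I -> 0 < mu E -> mu E < +oo ->
  exists2 c : R, (0 < c)%R & X (fun s => (\1_E s)%:E) = c%:E.
Proof.
move=> mE EI E0 Ef; have pE := MeasPos_indic L mE.
have XE0 := ri_ge0 hX pE; have XEf := ri_indic hX mE EI Ef.
exists (fine (X (fun s => (\1_E s)%:E))); last by rewrite fineK// ge0_fin_numE.
apply: fine_gt0; rewrite XEf andbT lt_neqAle XE0 andbT eq_sym; apply/eqP.
move/(ri_eq0 hX pE) => [A [mA A0 sub]]; move: E0; rewrite ltNge => /negP; apply.
rewrite -A0; apply: le_measure; rewrite ?inE// => s Es; apply: sub => /= /(_ (EI _ Es)).
by rewrite indicE mem_set// => -[] /eqP; rewrite oner_eq0.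
Qed.

Lemma X_opT_ge g : MeasPos L g -> X g <= X (TT g).
Proof.
move=> pg; rewrite -(N_rearr L0 hX pg); apply: (ri_mono hX).
- exact: rearr_MeasPos.
- exact: opT_MeasPos.
- exact: rearr_le_opT.
Qed.

Lemma op_bound_opT C g : op_bound L TT X X C -> MeasPos L g -> X (TT g) <= C%:E * X g.
Proof.
move=> [_ HC] pg; have := HC g pg.1.
by rewrite /nrm (N_abs hX (opT_MeasPos g)) (N_abs hX pg).
Qed.

(** [T g] dominates the rearrangement of [g], and some indicator has positive finite norm. Hence
    every bound is positive, and the operator norm times [+oo] is [+oo]. *)
Lemma op_bound_ge1 C : op_bound L TT X X C -> (1 <= C)%R.
Proof.
move=> HC; have [e Ie] := oitv_point.
have e0 : (0 < e)%R by rewrite -lte_fin; case/andP: Ie.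
have muE : mu (oitv 0 e%:E) = e%:E by rewrite cleb_oitv ?lee_fin ?ltW// sube0.
have mE : measurable (oitv 0 e%:E : set T) by exact: oitv_measurable.
have [| |] := norm_indic mE (oitv_below Ie); first by rewrite muE lte_fin.
  by rewrite muE ltry.
move=> c c0 XE; have pE := MeasPos_indic L mE.
have := le_trans (X_opT_ge pE) (op_bound_opT HC pE).
by rewrite XE -EFinM lee_fin ler_pMl.
Qed.

Lemma target_dualE f : Z f = ereal_sup [set \int[mu]_(t in I) (rearr L f t * W g t) | g in
  [set g : R -> \bar R | MeasPos L g /\ X g <= 1]].
Proof.
rewrite /targetDual; apply: (congr1 (@ereal_sup R)); apply: eq_imagel => g _.
by apply: int_eq => t _; rewrite -muleA.
Qed.

Lemma target_dual_ubound f g : MeasPos L g -> X g <= 1 ->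
  \int[mu]_(t in I) (rearr L f t * W g t) <= Z f.
Proof. by move=> pg Xg; rewrite target_dualE; apply: ereal_sup_ubound; exists g. Qed.

Lemma target_dual_le f (M : \bar R) : (forall g, MeasPos L g -> X g <= 1 ->
  \int[mu]_(t in I) (rearr L f t * W g t) <= M) -> Z f <= M.
Proof.
by move=> HM; rewrite target_dualE; apply: ge_ereal_sup => _ [g [pg Xg] <-]; exact: HM.
Qed.

Lemma rearr_weight_ge0 f g s : I s -> 0 <= rearr L f s * W g s.
Proof. by move=> Is; rewrite mule_ge0 ?rearr_ge0 ?target_weight_nneg. Qed.

Lemma rearr_weight_Meas f g : Meas L (fun s => rearr L f s * W g s).
Proof. exact: (emeasurable_funM (rearr_Meas (L := L) f) (target_weight_Meas g)). Qed.

Lemma opH_le_target_dual f : assoc_norm L X (H f) <= Z f.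
Proof.
apply: ge_ereal_sup => _ [g [pg Xg] <-].
apply: le_trans (target_dual_ubound f pg Xg).
have [mR _] := opR_MeasPos pg.1.
rewrite (pairing_opH_opR f pg); apply: (int_le mI).
- exact: (emeasurable_funM (rearr_Meas (L := L) f) mR).
- exact: rearr_weight_Meas.
- move=> s Is; rewrite mule_ge0 ?rearr_ge0// mule_ge0 ?v_ge0//.
  by apply: int_ge0 => x /(oitv_below (incr_bij_in hnu Is)) Ix; rewrite mule_ge0 ?u_ge0.
- move=> s Is; apply: lee_wpmul2l; first exact: rearr_ge0.
  exact: opR_le_target_weight.
Qed.

Lemma target_dual_le_opH C f : op_bound L TT X X C -> Z f <= C%:E * assoc_norm L X (H f).
Proof.
move=> HC; have C0 : (0 < C)%R by apply: lt_le_trans (op_bound_ge1 HC).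
apply: target_dual_le => g pg Xg; rewrite -pairing_opH_opT.
apply: (holder_assoc hX C0 (opH_MeasPos f) (opT_MeasPos g)).
apply: le_trans (op_bound_opT HC pg) _; rewrite -[leRHS]mule1.
by apply: lee_wpmul2l; rewrite // lee_fin ltW.
Qed.

(** The infimum over all bounds is reached by dividing by the associate norm of the image under [H];
    its values 0 and [+oo] are treated apart. *)
Lemma target_dual_le_opnorm f : bounded_op L TT X X ->
  Z f <= op_norm L TT X X * assoc_norm L X (H f).
Proof.
move=> [C0 HC0]; have := target_dual_le_opH f HC0.
set A := assoc_norm L X (H f); have A0 : 0 <= A by exact: assoc_ge0.
have op1 : 1 <= op_norm L TT X X.
  by apply: le_ereal_inf_tmp => _ [C HC <-]; rewrite lee_fin; exact: op_bound_ge1.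
have [A1 _|A1] := eqVneq A +oo.
  by rewrite A1 gt0_muley ?leey//; exact: lt_le_trans op1.
have [A2|A2 _] := eqVneq A 0; first by rewrite A2 !mule0.
have [a aE] : exists a, A = a%:E.
  by exists (fine A); rewrite fineK// ge0_fin_numE// ltey.
have a0 : (0 < a)%R by rewrite -lte_fin -aE lt_neqAle eq_sym A2.
rewrite aE muleC -lee_pdivrMl//; apply: le_ereal_inf_tmp => _ [C HC <-].
by rewrite lee_pdivrMl// muleC -aE; exact: target_dual_le_opH.
Qed.

Lemma target_dual_rearr_le f g : (forall t, I t -> rearr L f t <= rearr L g t) -> Z f <= Z g.
Proof.
move=> fg; apply: target_dual_le => k pk Xk; apply: le_trans (target_dual_ubound g pk Xk).
apply: (int_le mI).
- exact: rearr_weight_Meas.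
- exact: rearr_weight_Meas.
- by move=> s; exact: rearr_weight_ge0.
- by move=> s Is; apply: lee_wpmul2r; [exact: target_weight_nneg|exact: fg].
Qed.

Lemma target_dual_ge0 f : 0 <= Z f.
Proof.
have X1 : X (fun _ => 0) <= 1 by rewrite (N0 hX).
apply: le_trans (target_dual_ubound f (MeasPos0 L) X1).
by apply: int_ge0 => s; exact: rearr_weight_ge0.
Qed.

Lemma rearr0 t : I t -> rearr L (fun _ => 0) t = 0.
Proof.
move=> /andP[t0 _]; have t0' : (0 <= t)%R by rewrite -lee_fin ltW.
rewrite (_ : (fun _ => 0) = (fun s => (\1_(set0 : set T) s)%:E)); last first.
  by apply/funext => s; rewrite indic0.
by rewrite (rearr_indic measurable0 (@sub0set _ _) t0') measure0 ltNge (ltW t0).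
Qed.

Lemma target_dual_ae0 f : MeasPos L f -> (\forall s \ae mu, I s -> f s = 0) -> Z f = 0.
Proof.
move=> pf f0; apply/eqP; rewrite eq_le target_dual_ge0 andbT.
apply: target_dual_le => g _ _; rewrite le_eqVlt; apply/orP; left; apply/eqP.
apply: (etrans _ (integral0 mu I)); apply: int_eq => s Is.
by rewrite (rearr_ae_eq s pf.1 (MeasPos0 L).1 f0) rearr0// mul0e.
Qed.

Lemma target_dual_scale_le f (c : R) : MeasPos L f -> (0 < c)%R ->
  Z (fun s => c%:E * f s) <= c%:E * Z f.
Proof.
move=> pf c0; apply: target_dual_le => g pg Xg.
have -> : \int[mu]_(t in I) (rearr L (fun s => c%:E * f s) t * W g t) =
    c%:E * \int[mu]_(t in I) (rearr L f t * W g t).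
  rewrite -(int_scale mI (rearr_weight_Meas f g)).
  - by apply: int_eq => s Is; rewrite (rearrZ s pf.1 c0) -muleA.
  - by move=> s; exact: rearr_weight_ge0.
  - by rewrite lee_fin ltW.
apply: lee_wpmul2l; first by rewrite lee_fin ltW.
exact: target_dual_ubound.
Qed.

Lemma target_dual_scale f (c : R) : MeasPos L f -> (0 <= c)%R ->
  Z (fun s => c%:E * f s) = c%:E * Z f.
Proof.
move=> pf c0; have [<-|cn] := eqVneq 0%R c.
  by rewrite mul0e; apply: target_dual_ae0; [exact: MeasPosZ|apply: aeW => s _; rewrite mul0e].
have cp : (0 < c)%R by rewrite lt_neqAle cn.
apply/eqP; rewrite eq_le target_dual_scale_le//=.
have {1}-> : f = (fun s => c^-1%:E * (c%:E * f s)).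
  by apply/funext => s; rewrite muleA -EFinM mulVf ?mul1e// gt_eqF.
rewrite -lee_pdivlMl//; apply: target_dual_scale_le; first exact: MeasPosZ.
by rewrite invr_gt0.
Qed.

Lemma target_dual_triangle f g : MeasPos L f -> MeasPos L g ->
  Z (fun s => f s + g s) <= Z f + Z g.
Proof.
move=> pf pg; apply: target_dual_le => k pk Xk.
apply: (le_trans (rearr_sublinear L0 pf pg (@target_weight_noninc k) (@target_weight_nneg k))).
by apply: leeD; exact: target_dual_ubound.
Qed.

Lemma target_dual_indic_le (E F : set T) : measurable E -> measurable F -> E `<=` I ->
  F `<=` I -> mu E <= mu F -> Z (fun s => (\1_E s)%:E) <= Z (fun s => (\1_F s)%:E).
Proof.
move=> mE mF EI FI EF; apply: target_dual_rearr_le => t /andP[t0 _].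
have t0' : (0 <= t)%R by rewrite -lee_fin ltW.
rewrite !rearr_indic//; case: ifPn => tE; last by case: ifP.
by rewrite ifT// (lt_le_trans tE).
Qed.

Lemma target_dual_fatou (fk : nat -> R -> \bar R) f :
  (forall k, MeasPos L (fk k)) -> MeasPos L f ->
  (\forall s \ae mu, I s ->
     nondecreasing_seq (fun k => fk k s) /\ fk k s @[k --> \oo] --> f s) ->
  nondecreasing_seq (fun k => Z (fk k)) /\ Z (fk k) @[k --> \oo] --> Z f.
Proof.
move=> pk pf ae; have rc t := rearr_cvg t pk pf ae.
have nd : nondecreasing_seq (fun k => Z (fk k)).
  by move=> m n mn; apply: target_dual_rearr_le => t _; apply: (rc t).1.
split => //.
suff -> : Z f = ereal_sup (range (fun k => Z (fk k))) by exact: ereal_nondecreasing_cvgn.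
apply/eqP; rewrite eq_le; apply/andP; split; last first.
  apply: ge_ereal_sup => _ [k _ <-]; apply: target_dual_rearr_le => t _.
  by have [h1 h2] := rc t; exact: (@nd_cvge_le _ (fun k => rearr L (fk k) t) _ k h1 h2).
apply: target_dual_le => g pg Xg.
have cv : \int[mu]_(t in I) (rearr L (fk k) t * W g t) @[k --> \oo] -->
    \int[mu]_(t in I) (rearr L f t * W g t).
  apply: (int_cvg mI).
  - by move=> k; exact: rearr_weight_Meas.
  - by move=> k s; exact: rearr_weight_ge0.
  - move=> s Is m n mn; apply: lee_wpmul2r; first exact: target_weight_nneg.
    exact: (rc s).1.
  - move=> s Is; apply: nd_cvge_mulr; [exact: (rc s).1| |exact: target_weight_nneg|exact: (rc s).2].
    by move=> n; exact: rearr_ge0.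
apply: (cvge_ub cv) => k; apply: (le_trans (target_dual_ubound (fk k) pg Xg)).
by apply: ereal_sup_ubound; exists k.
Qed.

Lemma target_dual_equi_le f g : MeasPos L f -> MeasPos L g -> equimeasurable L f g -> Z f <= Z g.
Proof.
move=> pf pg fg; apply: target_dual_rearr_le => t _.
by apply: le_rearr; [exact: pf.1|exact: pg.1|move=> l l0; rewrite fg].
Qed.

(** * The remaining norm axioms for Z *)

Section finiteness.
Hypothesis hfin : assoc_norm L X (fun t =>
  (u t)%:E * (\1_(oitv 0 (nu_cut_pt L nu)) t)%:E *
  \int[mu]_(s in oitv (nui t)%:E (cut_pt L)) (v s)%:E) < +oo.
Hypothesis hT : bounded_op L TT X X.

Lemma cut_pt_le : cut_pt L <= L.
Proof. by rewrite /cut_pt; case: (L) => [l| |]; rewrite ?leey ?lexx. Qed.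

Lemma cut_pt_gt0 : 0 < cut_pt L.
Proof. by rewrite /cut_pt; case: (L) L0 => // *; rewrite lte_fin ltr01. Qed.

Lemma cut_pt_sub : oitv 0 (cut_pt L) `<=` I.
Proof. by move=> s /andP[s0 sc]; apply/andP; split => //; exact: lt_le_trans sc cut_pt_le. Qed.

Lemma mu_cut_pt : mu (oitv 0 (cut_pt L)) = cut_pt L.
Proof.
have : cut_pt L \is a fin_num by rewrite /cut_pt; case: (L) L0.
move=> /fineK cE; rewrite -[in LHS]cE cleb_oitv ?sube0 ?cE//.
exact: ltW cut_pt_gt0.
Qed.

(** On (0, L) the indicator of [(0, a)], with [a] the cut point, is its own rearrangement. Its image
    under [H] is the function in [hfin]: beyond [nu a] the interval of integration from [nui t] to
    [a] is empty. *)
Lemma target_dual_cut : Z (fun s => (\1_(oitv 0 (cut_pt L)) s)%:E) < +oo.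
Proof.
have [C HC] := hT; apply: (le_lt_trans (target_dual_le_opH _ HC)).
have C0 : (0 <= C)%R by case: HC.
apply: lte_mul_pinfty; [by rewrite lee_fin|by []|].
rewrite (_ : assoc_norm L X (H _) = assoc_norm L X (fun t =>
  (u t)%:E * (\1_(oitv 0 (nu_cut_pt L nu)) t)%:E *
  \int[mu]_(s in oitv (nui t)%:E (cut_pt L)) (v s)%:E)); first exact: hfin.
rewrite /assoc_norm; apply: (congr1 (@ereal_sup R)); apply: eq_imagel => g _.
apply: int_eq => t It; apply: (congr1 (fun z => z * g t)); rewrite opHE.
have -> : \int[mu]_(s in oitv (nui t)%:E L)
     (rearr L (fun s => (\1_(oitv 0 (cut_pt L)) s)%:E) s * (v s)%:E) =
    \int[mu]_(s in oitv (nui t)%:E (cut_pt L)) (v s)%:E.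
  have rE s : I s -> rearr L (fun s => (\1_(oitv 0 (cut_pt L)) s)%:E) s =
      if s%:E < cut_pt L then 1 else 0.
    move=> /andP[s0 _]; rewrite rearr_indic ?mu_cut_pt//.
    - exact: oitv_measurable.
    - exact: cut_pt_sub.
    - by rewrite -lee_fin ltW.
  rewrite integral_mkcond [RHS]integral_mkcond; apply: int_eq => s _; rewrite /patch.
  have sI := oitv_above (bij_inv_in hnu It).
  have [sc|sc] := pselect (oitv (nui t)%:E (cut_pt L) s).
    have sL : oitv (nui t)%:E L s.
      by case/andP: sc => st sc; apply/andP; split => //; exact: lt_le_trans sc cut_pt_le.
    rewrite !mem_set// rE; last exact: sI.
    by case/andP: sc => _ ->; rewrite mul1e.
  rewrite [in RHS]memNset//; case: ifP => // /set_mem sL; rewrite rE; last exact: sI.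
  case: ifP => [h1|_]; last by rewrite mul0e.
  by exfalso; apply: sc; case/andP: sL => st _; apply/andP.
have [tc|tc] := pselect (oitv 0 (nu_cut_pt L nu) t).
  by rewrite indicE mem_set// mule1.
rewrite indicE memNset// mule0 mul0e.
rewrite (_ : oitv (nui t)%:E (cut_pt L) = set0) ?integral_set0 ?mule0//.
apply/seteqP; split => // s /andP[st sc]; apply: tc; move: It st sc.
rewrite /cut_pt /nu_cut_pt /oitv /=; case: (L) hnu => [l| |] hnu' //= /andP[t0 tL].
move=> st s1; apply/andP; split; first exact: t0.
rewrite lte_fin -(incr_bij_adj hnu'); first by have := lt_trans st s1.
- by rewrite /oitv /= t0 ltry.
- by rewrite /oitv /= lte_fin ltr01 ltry.
Qed.

(** For finite [L] the measure of [E] is at most [L], the cut point. For infinite [L] the interval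
    [(0, n]] splits into [n] unit intervals, each of the same measure as [(0, 1)], and the triangle
    inequality applies. *)
Lemma target_dual_indic (E : set T) : measurable E -> E `<=` I -> mu E < +oo ->
  Z (fun s => (\1_E s)%:E) < +oo.
Proof.
move=> mE EI Ef; have [L1|L1] := eqVneq L +oo; last first.
  apply: (le_lt_trans _ target_dual_cut); apply: target_dual_indic_le => //.
  - exact: oitv_measurable.
  - exact: cut_pt_sub.
  rewrite mu_cut_pt (_ : cut_pt L = mu I); last first.
    by rewrite (mu_I L0) /cut_pt; case: (L) L1.
  by apply: le_measure; rewrite ?inE.
pose A n : set T := `]0%R, n%:R]%classic.
have mA n : measurable (A n) by exact: itvoc_measurable.
have AI n : A n `<=` I.
  by rewrite L1; exact: itvoc_pos.
have muA n : mu (A n) = n%:R%:E by rewrite cleb_itvoc ?subr0.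
have c1 : cut_pt L = 1 by rewrite /cut_pt L1.
have ZA n : Z (fun s => (\1_(A n) s)%:E) < +oo.
  elim: n => [|n IH].
    rewrite target_dual_ae0 ?ltry//; first exact: MeasPos_indic.
    exists (A 0%N); split; [exact: mA|exact: muA|].
    move=> s /= /not_implyP[Is ne]; apply: contrapT => As; apply: ne.
    by rewrite indicE memNset.
  pose D : set T := `]n%:R, n.+1%:R]%classic.
  have mD : measurable D by exact: itvoc_measurable.
  have DI : D `<=` I by rewrite L1; apply: itvoc_pos.
  have ADE : A n.+1 = A n `|` D.
    rewrite /A /D; apply/seteqP; split => s; rewrite /= !in_itv /=.
      by move=> /andP[s0 sn]; have [ns|ns] := leP s n%:R; [left; rewrite s0|right; rewrite sn].
    case=> /andP[h1 h2]; apply/andP; split => //; first by apply: le_trans h2 _; rewrite ler_nat.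
    exact: le_lt_trans h1.
  apply: (@le_lt_trans _ _ (Z (fun s => (\1_(A n) s)%:E + (\1_D s)%:E))).
    apply: target_dual_rearr_le => t _; apply: le_rearr_ae.
    - exact: MeasPos_indic.
    - by apply: MeasPosD; exact: MeasPos_indic.
    apply: aeW => s _; rewrite ADE -EFinD lee_fin !indicE in_setU.
    by case: (s \in A n); case: (s \in D); rewrite /= ?addr0 ?add0r ?lerDl.
  apply: le_lt_trans (target_dual_triangle (MeasPos_indic L (mA n)) (MeasPos_indic L mD)) _.
  apply: lte_add_pinfty; first exact: IH.
  apply: (le_lt_trans _ target_dual_cut).
  apply: target_dual_indic_le => //; [exact: oitv_measurable|exact: cut_pt_sub|].
  by rewrite mu_cut_pt c1 cleb_itvoc ?ler_nat// -natrB// subSnn.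
have Efin : mu E \is a fin_num by rewrite ge0_fin_numE.
apply: (le_lt_trans _ (ZA (Num.truncn (fine (mu E))).+1)).
apply: target_dual_indic_le => //; rewrite muA -(fineK Efin) lee_fin ltW//.
exact: truncnS_gt.
Qed.

Hypothesis hvL : forall l : R, L = l%:E -> (0 < lim (v t @[t --> l^'-]))%R.

Lemma v_lower_bound (b : R) : (0 < b)%R -> b%:E <= L ->
  exists2 l : R, (0 < l)%R & forall t, (0 < t < b)%R -> (l <= v t)%R.
Proof.
move=> b0; rewrite le_eqVlt => /predU1P[bL|bL]; last first.
  have Ib : I b by apply/andP; rewrite lte_fin.
  exists (v b); first exact: v_gt0.
  move=> t /andP[t0 tb]; rewrite -lee_fin; apply: noninc_v => //; last exact: ltW.
  by apply/andP; split; [rewrite lte_fin|apply: lt_trans bL; rewrite lte_fin].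
have := hvL (esym bL) => l0; exists (lim (v t @[t --> b^'-])) => // t /andP[t0 tb].
(* A divergent limit has the default value 0, which its positivity excludes. *)
have [cv|/dvgP E] := pselect (cvg (v t @[t --> b^'-])); last first.
  by move: l0; rewrite E ltxx.
apply: (limr_le cv); near=> x.
have tx : (t < x)%R by near: x; exact: nbhs_left_gt.
have xb : (x < b)%R by near: x; exact: nbhs_left_lt.
rewrite -lee_fin; apply: noninc_v; last exact: ltW.
- by rewrite -bL; apply/andP; rewrite !lte_fin.
- by rewrite -bL; apply/andP; rewrite !lte_fin xb (lt_trans t0).
Unshelve. all: by end_near.
Qed.

(** [g] is the normalized indicator of [(0, c)] with [c = nu (b / 2)]. From [b / 2] on, the integral
    in [target_weight] covers [(0, c)], where [u] is at least [u c], and [v] is bounded below;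
    before [b / 2] the monotonicity of the weight suffices. The midpoint keeps [c] inside (0, L)
    even if [b = L]. *)
Lemma target_weight_lower_bound (b : R) : (0 < b)%R -> b%:E <= L ->
  exists2 g, MeasPos L g /\ X g <= 1 &
    exists2 k : R, (0 < k)%R & forall t, I t -> (t < b)%R -> k%:E <= W g t.
Proof.
move=> b0 bL; have [l l0 lv] := v_lower_bound b0 bL.
have b2 : (0 < b / 2 < b)%R by rewrite divr_gt0//= gtr_pMr// invf_lt1// ltr1n.
have It0 : I (b / 2)%R.
  case/andP: b2 => h1 h2; apply/andP; split; first by rewrite lte_fin.
  by apply: lt_le_trans bL; rewrite lte_fin.
set c := nu (b / 2)%R; have Ic : I c by exact: incr_bij_in.
have c0 : (0 < c)%R by rewrite -lte_fin; case/andP: Ic.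
have mE : measurable (oitv 0 c%:E : set T) by exact: oitv_measurable.
have muE : mu (oitv 0 c%:E) = c%:E by rewrite cleb_oitv ?lee_fin ?ltW// sube0.
have [| |d d0 XE] := norm_indic mE (oitv_below Ic).
- by rewrite muE lte_fin.
- by rewrite muE ltry.
have di0 : (0 <= d^-1)%R by rewrite invr_ge0 ltW.
have pE := MeasPos_indic L mE; pose g s := d^-1%:E * (\1_(oitv 0 c%:E) s)%:E.
have pg : MeasPos L g by exact: MeasPosZ.
have Xg : X g <= 1 by rewrite (ri_scale hX pE di0) XE -EFinM mulVf// gt_eqF.
have uc0 := u_gt0 Ic.
have k0 : (0 < l * (d^-1 * u c * c))%R by rewrite !mulr_gt0// invr_gt0.
exists g => //; exists (l * (d^-1 * u c * c))%R => // t It tb.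
wlog t0t : t It tb / (b / 2 <= t)%R => [hw|].
  have [h1|h1] := leP (b / 2)%R t; first exact: hw.
  have := hw _ It0; case/andP: (b2) => _ -> /(_ isT (lexx _)) h2.
  by apply: (le_trans h2); apply: target_weight_noninc => //; exact: ltW.
have t0 : (0 < t)%R by rewrite -lte_fin; case/andP: It.
rewrite EFinM; apply: lee_pmul; rewrite ?lee_fin ?(ltW l0)//.
- by rewrite !mulr_ge0// ltW.
- by apply: lv; rewrite t0.
have sub := oitv_below (incr_bij_in hnu It).
have mu' := noninc_Meas noninc_u.
have mgu : Meas L (fun s => `|g s| * (u s)%:E) by exact: (emeasurable_funM (Meas_abs pg.1) mu').
apply: (@le_trans _ _ (\int[mu]_(s in oitv 0 (nu t)%:E) (`|g s| * (u s)%:E))); last first.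
  by apply: le_integral_opT => //; exact: incr_bij_in.
have subc : oitv 0 c%:E `<=` oitv 0 (nu t)%:E.
  move=> s /andP[s0 sc]; apply/andP; split => //; apply: lt_le_trans sc _.
  by rewrite lee_fin; exact: incr_bij_nd.
have gu0 s : I s -> 0 <= `|g s| * (u s)%:E by move=> Is; rewrite mule_ge0 ?u_ge0.
apply: (@le_trans _ _ (\int[mu]_(s in oitv 0 c%:E) (`|g s| * (u s)%:E))); last first.
  apply: int_subset.
  - exact: mE.
  - exact: oitv_measurable.
  - exact: (measurable_funS mI sub mgu).
  - by move=> s /sub; exact: gu0.
  - exact: subc.
have -> : (d^-1 * u c * c)%:E = \int[mu]_(s in oitv 0 c%:E) (d^-1 * u c)%:E.
  by rewrite (int_cst _ mE) muE.
apply: (int_le mE).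
- exact: measurable_cst.
- exact: (measurable_funS mI (subset_trans subc sub) mgu).
- by move=> s _; rewrite lee_fin mulr_ge0// ltW.
- move=> s sc; rewrite EFinM; apply: lee_pmul; rewrite ?lee_fin ?(ltW uc0)//.
    by rewrite indicE mem_set// mulr1 ler_norm.
  rewrite -lee_fin; apply: noninc_u => //; first exact: oitv_below Ic _ sc.
  by case/andP: sc => _; rewrite lte_fin => /ltW.
Qed.

(** With [b = mu E], Hardy-Littlewood bounds the integral over [E] by that of the rearrangement of
    [f] over [(0, b)], where an admissible weight is at least [k]. *)
Lemma target_dual_local (E : set T) : measurable E -> E `<=` I -> mu E < +oo ->
  exists2 C : R, (0 < C)%R &
    forall f, MeasPos L f -> \int[mu]_(s in E) f s <= C%:E * Z f.
Proof.
move=> mE EI Ef; have pE := MeasPos_indic L mE.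
have [E0|E0] := eqVneq (mu E) 0.
  exists 1%R => // f pf; rewrite mul1e -(pairing_indic _ mE EI).
  rewrite (pairing_ae0 pE pf) ?target_dual_ge0//; exists E; split => // s /= /not_implyP[Is ne].
  by apply: contrapT => Es; apply: ne; rewrite indicE memNset.
have [b bE] : exists b, mu E = b%:E by exists (fine (mu E)); rewrite fineK// ge0_fin_numE.
have b0 : (0 < b)%R by rewrite -lte_fin -bE lt_neqAle eq_sym E0 measure_ge0.
have bL : b%:E <= L.
  by rewrite -bE -(mu_I L0); apply: le_measure; rewrite ?inE.
have [g [pg Xg] [k k0 kW]] := target_weight_lower_bound b0 bL.
have ki0 : (0 <= k^-1)%R by rewrite invr_ge0 ltW.
exists k^-1%R; first by rewrite invr_gt0.
move=> f pf; rewrite -(pairing_indic _ mE EI).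
apply: (le_trans (hardy_littlewood L0 pE pf)).
apply: (@le_trans _ _ (k^-1%:E * \int[mu]_(s in I) (rearr L f s * W g s))); last first.
  by apply: lee_wpmul2l; [rewrite lee_fin|exact: target_dual_ubound].
rewrite -(int_scale mI (rearr_weight_Meas f g)); last 2 first.
- by move=> s; exact: rearr_weight_ge0.
- by rewrite lee_fin.
apply: (int_le mI).
- exact: (emeasurable_funM (rearr_Meas (L := L) _) (rearr_Meas (L := L) f)).
- exact: (measurable_funeM _ (rearr_weight_Meas f g)).
- by move=> s Is; rewrite mule_ge0 ?rearr_ge0.
- move=> s Is; have s0 : (0 <= s)%R by rewrite -lee_fin ltW//; case/andP: Is.
  rewrite (rearr_indic mE EI s0) bE; case: ifPn => sb; last first.
    by rewrite mul0e mule_ge0 ?lee_fin// rearr_weight_ge0.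
  rewrite mul1e muleCA -[leLHS]mule1; apply: lee_wpmul2l; first exact: rearr_ge0.
  rewrite -(_ : k^-1%:E * k%:E = 1); last by rewrite -EFinM mulVf// gt_eqF.
  by apply: lee_wpmul2l; rewrite ?lee_fin//; apply: kW => //; rewrite -lte_fin.
Qed.

Lemma target_dual_ri : ri_norm L Z.
Proof.
constructor.
- by move=> f _; exact: target_dual_ge0.
- move=> f pf; split; first exact: (local_ae0 target_dual_local pf).
  exact: target_dual_ae0.
- by move=> f c pf c0; exact: target_dual_scale.
- by move=> f g pf pg; exact: target_dual_triangle.
- by move=> f g pf pg fg; apply: target_dual_rearr_le => t _; exact: le_rearr_ae.
- exact: target_dual_fatou.
- exact: target_dual_indic.
- exact: target_dual_local.
- move=> f g pf pg fg; apply/eqP; rewrite eq_le; apply/andP.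
  by split; apply: target_dual_equi_le => // l l0; rewrite fg.
Qed.

Lemma target_dual_bidual f : MeasPos L f -> assoc_norm L (assoc_norm L Z) f = Z f.
Proof.
move=> pf; apply/eqP; rewrite eq_le (lorentz_luxemburg L0 target_dual_ri pf) andbT.
by apply: ge_ereal_sup => _ [g [pg Ng] <-]; exact: (le_pairing_norm target_dual_ri).
Qed.

End finiteness.

(** * Boundedness into the target space and optimality *)

Section target.
Context (Y : (R -> \bar R) -> \bar R) (hY : ri_norm L Y).
Hypothesis YZ : forall f, MeasPos L f -> assoc_norm L Y f = Z f.

(** A test function [k] may be rearranged against the nonincreasing [target_weight g]; the pairing
    is then one of the terms whose supremum is [Z k], the associate norm of [k]. *)
Lemma opR_norm_le1 g : MeasPos L g -> X g <= 1 -> Y (opR u v nu g) <= 1.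
Proof.
move=> pg Xg; have pW := target_weight_MeasPos g.
apply: (@le_trans _ _ (Y (W g))).
  by apply: (N_le hY) => //; [exact: opR_MeasPos pg.1|move=> s Is; exact: opR_le_target_weight].
apply: (le_trans (lorentz_luxemburg L0 hY pW)).
apply: ge_ereal_sup => _ [k [pk Yk] <-]; rewrite pairingC.
apply: (le_trans (le_rearr_noninc L0 pk (@target_weight_noninc g) (@target_weight_nneg g))).
by apply: le_trans Yk; rewrite YZ//; exact: target_dual_ubound.
Qed.

Lemma opR_scale (c : R) g t : (0 <= c)%R -> MeasPos L g -> I t ->
  opR u v nu (fun s => c%:E * g s) t = c%:E * opR u v nu g t.
Proof.
move=> c0 pg It; rewrite /opR muleCA; apply: (congr1 (fun z => (v t)%:E * z)).
have sub := oitv_below (incr_bij_in hnu It).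
have mgu : Meas L (fun s => `|g s| * (u s)%:E).
  exact: (emeasurable_funM (Meas_abs pg.1) (noninc_Meas noninc_u)).
rewrite -int_scale.
- by apply: int_eq => s _; rewrite abseM gee0_abs ?lee_fin// muleA.
- exact: oitv_measurable.
- exact: (measurable_funS mI sub mgu).
- by move=> s /sub Is; rewrite mule_ge0 ?u_ge0.
- by rewrite lee_fin.
Qed.

Lemma opR_norm_le g : MeasPos L g -> Y (opR u v nu g) <= X g.
Proof.
move=> pg; have Xg0 := ri_ge0 hX pg; have pR := opR_MeasPos pg.1.
have [Xg|Xg] := eqVneq (X g) +oo; first by rewrite Xg leey.
have Xfin : X g \is a fin_num by rewrite ge0_fin_numE// ltey.
apply/lee_addgt0Pr => e e0; rewrite -(fineK Xfin) -EFinD.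
(* [X g] may be 0, so [g] is normalized by [X g + e]. *)
set c := (fine (X g) + e)%R; have c0 : (0 < c)%R by rewrite ltr_wpDl// fine_ge0.
have ci0 : (0 <= c^-1)%R by rewrite invr_ge0 ltW.
rewrite -[leRHS]mule1 -lee_pdivrMl// -(ri_scale hY pR ci0).
have pcg := MeasPosZ ci0 pg; have pcR := opR_MeasPos pcg.1.
rewrite -(N_eq hY pcR); last by move=> t It; exact: opR_scale.
  apply: opR_norm_le1 => //; rewrite (ri_scale hX pg ci0) lee_pdivrMl// mule1.
  by rewrite -(fineK Xfin) lee_fin lerDl ltW.
exact: MeasPosZ.
Qed.

Lemma opR_bounded : bounded_op L (opR u v nu) X Y.
Proof.
exists 1%R; split => // g mg; rewrite mul1e /nrm.
rewrite (N_abs hY (opR_MeasPos mg)).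
have pg := MeasPos_abs mg; rewrite (_ : opR u v nu g = opR u v nu (fun s => `|g s|)).
  exact: opR_norm_le.
apply/funext => t; rewrite /opR; apply: (congr1 (fun z => (v t)%:E * z)).
by apply: int_eq => s _; rewrite abse_id.
Qed.

Lemma pairing_le_scale (K : R) f k : (0 < K)%R -> MeasPos L f -> MeasPos L k ->
  assoc_norm L Y k <= K%:E -> \int[mu]_(s in I) (f s * k s) <= K%:E * Y f.
Proof.
move=> K0 pf pk Yk; have ki0 : (0 <= K^-1)%R by rewrite invr_ge0 ltW.
have := @le_pairing_norm _ L Y hY f _ pf (MeasPosZ ki0 pk).
rewrite (assoc_scale hY pk ki0) lee_pdivrMl// mule1 => /(_ Yk).
by rewrite (pairing_scaler ki0 pf pk) lee_pdivrMl.
Qed.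

Lemma opR_optimal (N : (R -> \bar R) -> \bar R) : ri_norm L N -> bounded_op L TT X X ->
  bounded_op L (opR u v nu) X N -> embeds L Y N.
Proof.
move=> hN [C HC] [D [D0 HD]].
have C0 : (0 < C)%R by apply: lt_le_trans (op_bound_ge1 HC).
have D1 : (0 < D + 1)%R by rewrite ltr_wpDl.
have K0 : (0 < C * (D + 1))%R by rewrite mulr_gt0.
(* [C] bounds [T] on [X] and [D] bounds [opR] from [X] to [N]; the added 1 keeps the constant
   positive. *)
exists (C * (D + 1))%R => // f mf; have pf := MeasPos_abs mf.
apply: (le_trans (lorentz_luxemburg L0 hN pf)).
apply: ge_ereal_sup => _ [k [pk Nk] <-]; apply: pairing_le_scale => //.
rewrite YZ//; apply: (le_trans (target_dual_le_opH k HC)).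
rewrite EFinM; apply: lee_wpmul2l; first by rewrite lee_fin ltW.
apply: ge_ereal_sup => _ [g [pg Xg] <-].
rewrite (pairing_opH_opR k pg).
have pR := opR_MeasPos pg.1; have pr := rearr_MeasPos L k.
have NR : N (opR u v nu g) <= (D + 1)%:E.
  have := HD _ pg.1; rewrite /nrm (N_abs hN pR) (N_abs hX pg) => /le_trans; apply.
  apply: (@le_trans _ _ (D%:E * 1)); first by apply: lee_wpmul2l.
  by rewrite mule1 lee_fin lerDl.
apply: (le_trans (holder_assoc hN D1 pr pR NR)).
(* The associate norm of [N] is itself invariant, so the rearrangement of [k] has the same associate
   norm as [k]. *)
rewrite (N_rearr L0 (assoc_ri L0 hN) pk) -[leRHS]mule1.
by apply: lee_wpmul2l; rewrite // lee_fin ltW.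
Qed.

End target.

End norm.
End target_dual.

Unset Implicit Arguments.

(** [Y] is given through its associate norm only, so there are two halves: some norm has this
    associate norm, and every such norm has the claimed properties. *)
Theorem proposition3p14 (R : realType) (L : \bar R) (hL : 0 < L)
    (X : (R -> \bar R) -> \bar R) (hX : ri_norm L X)
    (nu : R -> R) (hnu : incr_bij L nu)
    (hnuD : L = +oo -> lowerDinfty (bij_inv L nu))
    (u : R -> R) (u_gt0 : forall t, oitv 0 L t -> (0 < u t)%R)
    (u_noninc : {in oitv 0 L &, nonincreasing_fun u})
    (xi : R -> R) (xi_gt0 : forall t, oitv 0 L t -> (0 < xi t)%R)
    (xi_meas : @measurable_fun _ _ (lebesgueR R) (measurableTypeR R) (oitv 0 L) xi)
    (v : R -> R) (v_gt0 : forall t, oitv 0 L t -> (0 < v t)%R)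
    (hv : forall t, oitv 0 L t ->
      ((v t)^-1)%:E = \int[cleb]_(s in oitv 0 (nu t)%:E) (xi s)%:E)
    (hvL : forall l : R, L = l%:E -> (0 < lim (v t @[t --> l^'-]))%R)
    (hfin : assoc_norm L X (fun t =>
        (u t)%:E * (\1_(oitv 0 (nu_cut_pt L nu)) t)%:E *
        \int[cleb]_(s in oitv (bij_inv L nu t)%:E (cut_pt L)) (v s)%:E) < +oo)
    (hT : bounded_op L (opT L (fun t => u t / xi t)%R) X X) :
  (exists Y : (R -> \bar R) -> \bar R,
     ri_norm L Y /\
     forall f, MeasPos L f -> assoc_norm L Y f = targetDual L u xi v nu X f) /\
  (forall Y : (R -> \bar R) -> \bar R,
     ri_norm L Y ->
     (forall f, MeasPos L f -> assoc_norm L Y f = targetDual L u xi v nu X f) ->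
     optimal_target L (opR u v nu) X Y /\
     forall f, MeasPos L f ->
       assoc_norm L X (opH L u v (bij_inv L nu) (rearr L f)) <= assoc_norm L Y f /\
       assoc_norm L Y f <=
         op_norm L (opT L (fun t => u t / xi t)%R) X X *
         assoc_norm L X (opH L u v (bij_inv L nu) (rearr L f))).
Proof.
have hZ := target_dual_ri hL hnu u_gt0 u_noninc xi_gt0 xi_meas v_gt0 hv hX hfin hT hvL.
split.
  exists (assoc_norm L (targetDual L u xi v nu X)); split; first exact: (assoc_ri hL hZ).
  move=> f pf; exact: (target_dual_bidual hL hnu u_gt0 u_noninc xi_gt0 xi_meas v_gt0 hv
    hX hfin hT hvL).
move=> Y hY YZ; split; last first.
  move=> f pf; rewrite (YZ f pf); split.
    exact: (opH_le_target_dual hL hnu u_gt0 u_noninc xi_gt0 xi_meas v_gt0 hv).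
  exact: (target_dual_le_opnorm hL hnu u_gt0 u_noninc xi_gt0 xi_meas v_gt0 hv hX).
split => //.
  exact: (opR_bounded hL hnu u_gt0 u_noninc xi_gt0 xi_meas v_gt0 hv hX hY YZ).
move=> NZ hNZ; exact: (opR_optimal hL hnu u_gt0 u_noninc xi_gt0 xi_meas v_gt0 hv
  hX hY YZ hNZ hT).
Qed.
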